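(* Let $\mu$ be a complex Borel measure on $\ell^2(\mathbb{N})$ (real Hilbert space of square-summable real sequences), let $h:\mathbb{R}^\infty\setminus\ell^2(\mathbb{N})\to\mathbb{C}$ be an arbitrary function, and let $f:\mathbb{R}^\infty\to\mathbb{C}$ be $$f(x)=\begin{cases}\int_{\ell^2}e^{i\langle x,y\rangle}\,d\mu(y)&x\in\ell^2(\mathbb{N}),\\ h(x)&x\in\mathbb{R}^\infty\setminus\ell^2(\mathbb{N}).\end{cases}$$ Then $f\in D(L')$ and $$L'(f)=\int_{\ell^2}e^{-\frac{i\hbar}{2}|x|^2}\,d\mu(x).$$
   Context: Fix $\hbar\in(0,1]$; $i^{s}=e^{i\pi s/2}$, so $(2\pi i\hbar)^{-n/2}=(2\pi\hbar)^{-n/2}e^{-i\pi n/4}$. $\mathbb{R}^\infty=\mathbb{R}^{\mathbb{N}}$. For $g\in\mathcal{S}(\mathbb{R}^n)$ and $u\in\mathcal{S}'(\mathbb{R}^n)$, $V_gu(x,\xi)$ is the Fourier transform of $u\,\overline{g(\cdot-x)}$ at $\xi$, normalized as $V_gu(x,\xi)=(2\pi\hbar)^{-n/2}\int e^{-\frac i\hbar\xi\cdot y}u(y)\overline{g(y-x)}\,dy$. $M^{\infty,1}(\mathbb{R}^n)$ is the space of $u\in\mathcal{S}'(\mathbb{R}^n)$ with $\int_{\mathbb{R}^n}\sup_x|V_gu(x,\xi)|\,d\xi<\infty$ for some (equivalently every) $g\in\mathcal{S}(\mathbb{R}^n)\setminus\{0\}$; its elements are bounded continuous functions. For $u\in M^{\infty,1}(\mathbb{R}^n)$,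 $L_n(u):=\lim_{\varepsilon\downarrow0}(2\pi i\hbar)^{-n/2}\int_{\mathbb{R}^n}e^{\frac i{2\hbar}|x|^2}u(x)\varphi(\varepsilon x)\,dx$ for any $\varphi\in\mathcal{S}(\mathbb{R}^n)$ with $\varphi(0)=1$ (the limit exists and is independent of $\varphi$). For $f:\mathbb{R}^\infty\to\mathbb{C}$ and $n\in\mathbb{N}$ let $f^{(n)}(x_1,\dots,x_n)=f(x_1,\dots,x_n,0,0,\dots)$. $D(L')$ is the set of $f:\mathbb{R}^\infty\to\mathbb{C}$ such that $f^{(n)}\in M^{\infty,1}(\mathbb{R}^n)$ for every $n$ and $\lim_nL_n(f^{(n)})$ exists and is finite; then $L'(f):=\lim_{n\to\infty}L_n(f^{(n)})$. *)

(* Defs.v *)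
(* The real numbers are an arbitrary realType R and the complex numbers are
   R[i]. *)
From HB Require Import structures.
From mathcomp Require Import all_boot all_order all_algebra.
From mathcomp Require Import all_classical all_reals all_analysis.
From mathcomp Require Import complex.

Set Implicit Arguments.
Unset Strict Implicit.
Unset Printing Implicit Defensive.

Import Order.TTheory GRing.Theory Num.Theory.
Import numFieldNormedType.Exports.

Local Open Scope classical_set_scope.
Local Open Scope ring_scope.
Local Open Scope complex_scope.

(* The usual topology of the complex plane: R[i] as a normed space over
   itself. *)
HB.instance Definition _ (R : rcfType) := NormedModule.copy R[i] R[i]^o.

Definition expi (R : realType) (t : R) : R[i] := cos t +i* sin t.

Definition cabs (R : realType) (z : R[i]) : R := ComplexField.Normc.normc z.

Definition cintegral d (T : measurableType d) (R : realType)
    (m : {measure set T -> \bar R}) (f : T -> R[i]) : R[i] :=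
  Rintegral m setT (fun x => complex.Re (f x)) +i*
  Rintegral m setT (fun x => complex.Im (f x)).

Section tuple_cons.
Context d (T : measurableType d) (R : realType) (n : nat).

Definition tuple_cons (p : T * n.-tuple T) : n.+1.-tuple T :=
  [tuple of p.1 :: p.2].

Lemma measurable_tuple_cons : measurable_fun setT tuple_cons.
Proof. exact: measurable_cons. Qed.

Variables (m1 : {sigma_finite_measure set T -> \bar R})
  (m : {sigma_finite_measure set (n.-tuple T) -> \bar R}).

Definition cons_measure : set (n.+1.-tuple T) -> \bar R :=
  pushforward (m1 \x m)%E tuple_cons.

Let preim_measurable A : measurable A -> measurable (tuple_cons @^-1` A).
Proof. by move=> mA; rewrite -[X in measurable X]setTI; exact: measurable_tuple_cons. Qed.

Let cons_measure0 : cons_measure set0 = 0%E.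
Proof. by rewrite /cons_measure /pushforward preimage_set0 measure0. Qed.

Let cons_measure_ge0 A : (0 <= cons_measure A)%E.
Proof. by rewrite /cons_measure /pushforward measure_ge0. Qed.

Let cons_measure_sigma_additive : semi_sigma_additive cons_measure.
Proof.
move=> F mF tF mUF; rewrite /cons_measure /pushforward preimage_bigcup.
apply: measure_semi_sigma_additive.
- by move=> k; exact: preim_measurable.
- apply/trivIsetP => /= i j _ _ ij; rewrite -preimage_setI.
  by move/trivIsetP : tF => /(_ _ _ _ _ ij) ->//; rewrite preimage_set0.
- by rewrite -preimage_bigcup; exact: preim_measurable.
Qed.

HB.instance Definition _ := isMeasure.Build _ _ _ cons_measure
  cons_measure0 cons_measure_ge0 cons_measure_sigma_additive.

Let cons_measure_sigma_finite : sigma_finite setT cons_measure.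
Proof.
have /sigma_finiteP[F [TF ndF Foo]] := sigma_finiteT m1.
have /sigma_finiteP[G [TG ndG Goo]] := sigma_finiteT m.
pose u (t : n.+1.-tuple T) : T * n.-tuple T := (thead t, [tuple of behead t]).
have uK : cancel tuple_cons u.
  by case=> a t; rewrite /u /tuple_cons/= theadE; congr pair; exact: val_inj.
have mu_ : measurable_fun setT u.
  by apply: measurable_fun_pair; [exact: measurable_tnth|exact: measurable_behead].
exists (fun k => u @^-1` (F k `*` G k)) => [|k].
  rewrite -preimage_bigcup; apply/esym; rewrite -subTset => t _ /=.
  have : (\bigcup_k F k) (thead t) by rewrite -TF.
  have : (\bigcup_k G k) [tuple of behead t] by rewrite -TG.
  move=> [j _ Gj] [i _ Fi]; exists (maxn i j) => //; split.
    by move: Fi; exact/subsetPset/ndF/leq_maxl.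
  by move: Gj; exact/subsetPset/ndG/leq_maxr.
have [mF Fk] := Foo k; have [mG Gk] := Goo k.
split; first by rewrite -[X in measurable X]setTI; apply: mu_ => //; exact: measurableX.
rewrite /cons_measure /pushforward -comp_preimage.
rewrite (_ : u \o tuple_cons = id) ?preimage_id; last by apply/funext => p/=.
by rewrite product_measure1E// lte_mul_pinfty// ge0_fin_numE.
Qed.

HB.instance Definition _ := Measure_isSigmaFinite.Build _ _ _ cons_measure
  cons_measure_sigma_finite.

End tuple_cons.

Section euclidean_integral.
Variable R : realType.
Local Notation M := (measurableTypeR R).

(* Lebesgue measure on the n-fold power of R, as an iterated product measure. *)
Fixpoint lebesgue_tuple n : {sigma_finite_measure set (n.-tuple M) -> \bar R} :=
  if n is n'.+1 then cons_measure (@lebesgue_measure R) (lebesgue_tuple n')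
  else \d_([tuple] : 0.-tuple M).

(* R^n is 'rV[R]_n, which carries the topology and the derivatives; the
   measurable structure lives on n-tuples. *)
Definition row_of n (t : n.-tuple M) : 'rV[R]_n := \row_i tnth t i.

Definition eintegral_Rn n (F : 'rV[R]_n -> \bar R) : \bar R :=
  (\int[lebesgue_tuple n]_t F (row_of t))%E.

Definition cintegral_Rn n (F : 'rV[R]_n -> R[i]) : R[i] :=
  cintegral (lebesgue_tuple n) (fun t => F (row_of t)).

End euclidean_integral.

Section schwartz.
Variables (R : realType) (n : nat).
Implicit Types (f : 'rV[R]_n -> R) (phi psi : 'rV[R]_n -> R[i]).

Definition dotr (x y : 'rV[R]_n) : R := \sum_i x 0 i * y 0 i.

(* Iterated partial derivative along a list of coordinate directions. *)
Definition partial (a : seq 'I_n) f : 'rV[R]_n -> R :=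
  foldr (fun i g => 'D_(delta_mx 0 i) g) f a.

Definition smooth f := forall a : seq 'I_n,
  continuous (partial a f) /\
  forall i x, derivable (partial a f) x (delta_mx 0 i).

Definition cpartial (a : seq 'I_n) phi (x : 'rV[R]_n) : R[i] :=
  partial a (fun y => complex.Re (phi y)) x +i*
  partial a (fun y => complex.Im (phi y)) x.

(* `|x| is the maximum norm, which is equivalent to the Euclidean one. *)
Definition schwartz_weight (k : nat) (a : seq 'I_n) phi (x : 'rV[R]_n) : R :=
  `|x| ^+ k * cabs (cpartial a phi x).

Definition schwartz : set ('rV[R]_n -> R[i]) := [set phi |
  [/\ smooth (fun x => complex.Re (phi x)),
      smooth (fun x => complex.Im (phi x)) &
      forall k a, has_ubound (range (schwartz_weight k a phi))]].

Definition schwartz_seminorm (k : nat) (a : seq 'I_n) phi : R :=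
  sup (range (schwartz_weight k a phi)).

(* A functional is only meaningful on Schwartz functions; its values elsewhere
   are ignored. Continuity is expressed by the seminorms of the Schwartz
   space. *)
Definition tempered (u : ('rV[R]_n -> R[i]) -> R[i]) :=
  (forall (c : R[i]) phi psi, schwartz phi -> schwartz psi ->
    u (fun x => c * phi x + psi x) = c * u phi + u psi) /\
  exists (N : nat) (K : R), forall phi, schwartz phi ->
    cabs (u phi) <= K * \sum_(k < N.+1) \sum_(m < N.+1)
      \sum_(a : m.-tuple 'I_n) schwartz_seminorm k a phi.

(* The tempered distribution phi |-> \int f phi attached to a function f. *)
Definition distr_of (f : 'rV[R]_n -> R[i]) (phi : 'rV[R]_n -> R[i]) : R[i] :=
  cintegral_Rn (fun x => f x * phi x).

End schwartz.

Section modulation.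
Variables (R : realType) (hbar : R) (n : nat).

Definition planck_factor : R := (2 * pi * hbar) `^ (- (n%:R / 2)).

Definition stft (g : 'rV[R]_n -> R[i]) (u : ('rV[R]_n -> R[i]) -> R[i])
    (x xi : 'rV[R]_n) : R[i] :=
  planck_factor%:C *
  u (fun y => expi (- (hbar^-1 * dotr xi y)) * conjc (g (y - x))).

Definition modulation_distr (u : ('rV[R]_n -> R[i]) -> R[i]) :=
  tempered u /\
  exists g : 'rV[R]_n -> R[i], [/\ schwartz g, exists x, g x != 0 &
    (eintegral_Rn
       (fun xi => ereal_sup (range (fun x => (cabs (stft g u x xi))%:E)))
     < +oo)%E].

(* Elements of M^{oo,1} are bounded continuous functions: a function f belongs
   to M^{oo,1} when it is the bounded continuous representative of a
   distribution in that space. *)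
Definition modulation : set ('rV[R]_n -> R[i]) := [set f |
  [/\ continuous f, exists K, forall x, cabs (f x) <= K &
      modulation_distr (distr_of f)]].

(* The branch i^s = e^(i pi s / 2) gives i^(-n/2) = e^(- i pi n / 4). *)
Definition fresnel_reg (phi u : 'rV[R]_n -> R[i]) (eps : R) : R[i] :=
  planck_factor%:C * expi (- (pi * n%:R / 4)) *
  cintegral_Rn (fun x =>
    expi ((2 * hbar)^-1 * dotr x x) * u x * phi (eps *: x)).

(* The common value of the limits for all regularizations phi; the default 0 is
   only used when there is no such value. *)
Definition fresnel (u : 'rV[R]_n -> R[i]) : R[i] :=
  xget 0 [set l | forall phi, schwartz phi -> phi 0 = 1 ->
    fresnel_reg phi u eps @[eps --> 0^'+] --> l].

End modulation.

Section infinite_dimension.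
Variables (R : realType) (hbar : R).

Definition extend0 n (x : 'rV[R]_n) : nat -> R :=
  fun k => oapp (fun i : 'I_n => x 0 i) 0 (insub k).

Definition cylinder (f : (nat -> R) -> R[i]) n (x : 'rV[R]_n) : R[i] :=
  f (extend0 x).

Definition DL' : set ((nat -> R) -> R[i]) := [set f |
  (forall n, (0 < n)%N -> modulation hbar (@cylinder f n)) /\
  cvgn (fun n => fresnel hbar (@cylinder f n))].

Definition L' (f : (nat -> R) -> R[i]) : R[i] :=
  limn (fun n => fresnel hbar (@cylinder f n)).

End infinite_dimension.

Section ell2.
Variable R : realType.

Definition ell2_seq : set (nat -> R) :=
  [set x : nat -> R | cvgn (series (fun k => x k ^+ 2))].

Definition ell2 := {x : nat -> R | x \in ell2_seq}.

Lemma ell2_seq0 : (fun=> 0 : R) \in ell2_seq.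
Proof.
rewrite inE /ell2_seq/= (_ : series _ = fun=> 0); first exact: is_cvg_cst.
by apply/funext => n; rewrite /series/= big1// => k _; rewrite expr0n.
Qed.

HB.instance Definition _ := Choice.on ell2.
HB.instance Definition _ := isPointed.Build ell2 
  (exist (fun x => x \in ell2_seq) _ ell2_seq0).

Definition ell2_dot (x y : ell2) : R :=
  limn (series (fun k => sval x k * sval y k)).

Definition ell2_dist (x y : ell2) : R :=
  Num.sqrt (limn (series (fun k => (sval x k - sval y k) ^+ 2))).

Definition ell2_open : set (set ell2) := [set A |
  forall x, A x -> exists2 e : R, 0 < e & forall y, ell2_dist x y < e -> A y].

Definition ell2_borel := g_sigma_algebraType ell2_open.

End ell2.
Arguments ell2_seq R : clear implicits.
Arguments ell2_open R : clear implicits.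

Lemma cvg_Re_Im (R : realType) (u : nat -> R[i]) (l : R[i]) :
  u @ \oo --> l ->
  (fun k => complex.Re (u k)) @ \oo --> complex.Re l /\
  (fun k => complex.Im (u k)) @ \oo --> complex.Im l.
Proof.
move=> /cvgrPdist_lt ul.
split; apply/cvgrPdist_lt => e e0; have := ul e%:C.
  rewrite ltcR => /(_ e0); apply: filterS => k.
  rewrite -raddfB/= -ltcR; apply: le_lt_trans.
  exact: normc_ge_Re.
rewrite ltcR => /(_ e0); apply: filterS => k.
rewrite -raddfB/= -ltcR; apply: le_lt_trans.
set z := l - u k; rewrite normc_def lecR -sqrtr_sqr.
by apply: ler_wsqrtr; rewrite lerDr sqr_ge0.
Qed.

Section complex_measure.
Context d (T : measurableType d) (R : realType).

Record complex_measure := ComplexMeasure {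
  complex_measure_fun :> set T -> R[i] ;
  complex_measure_sigma_additive : forall F : nat -> set T,
    (forall k, measurable (F k)) -> trivIset setT F ->
    series (fun k => complex_measure_fun (F k)) @ \oo -->
      complex_measure_fun (\bigcup_k F k) }.

Variable mu : complex_measure.

Definition cmeas_Re : set T -> \bar R := fun A => (complex.Re (mu A))%:E.
Definition cmeas_Im : set T -> \bar R := fun A => (complex.Im (mu A))%:E.

Lemma complex_measure0 : mu set0 = 0.
Proof.
have := @complex_measure_sigma_additive mu (fun=> set0) (fun=> measurable0)
  (@trivIset_set0 _ _ _).
rewrite bigcup0// => h.
have [/cvgP/cvg_series_cvg_0 hRe /cvgP/cvg_series_cvg_0 hIm] :
    series (fun=> complex.Re (mu set0)) @ \oo --> complex.Re (mu set0) /\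
    series (fun=> complex.Im (mu set0)) @ \oo --> complex.Im (mu set0).
  have [hr hi] := cvg_Re_Im h; split.
    by apply: cvg_trans hr; apply: near_eq_cvg; near=> k; rewrite /series/= raddf_sum.
  by apply: cvg_trans hi; apply: near_eq_cvg; near=> k; rewrite /series/= raddf_sum.
have r0 := cvg_unique (@norm_hausdorff _ R) hRe (@cvg_cst _ _ _ _ _).
have i0 := cvg_unique (@norm_hausdorff _ R) hIm (@cvg_cst _ _ _ _ _).
by apply/eqP; rewrite eq_complex/= -r0 -i0 !eqxx.
Unshelve. all: by end_near. Qed.

Let cmeas_Re_sigma_additive : semi_sigma_additive cmeas_Re.
Proof.
move=> F mF tF _.
have [h _] := cvg_Re_Im (@complex_measure_sigma_additive mu F mF tF).
apply/fine_cvgP; split.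
  by apply: nearW => n; rewrite /cmeas_Re sumEFin.
apply: cvg_trans h; apply: near_eq_cvg; apply: nearW => n /=.
by rewrite /cmeas_Re sumEFin/= raddf_sum.
Qed.

Let cmeas_Im_sigma_additive : semi_sigma_additive cmeas_Im.
Proof.
move=> F mF tF _.
have [_ h] := cvg_Re_Im (@complex_measure_sigma_additive mu F mF tF).
apply/fine_cvgP; split.
  by apply: nearW => n; rewrite /cmeas_Im sumEFin.
apply: cvg_trans h; apply: near_eq_cvg; apply: nearW => n /=.
by rewrite /cmeas_Im sumEFin/= raddf_sum.
Qed.

Let cmeas_Re0 : cmeas_Re set0 = 0%E.
Proof. by rewrite /cmeas_Re complex_measure0. Qed.

Let cmeas_Im0 : cmeas_Im set0 = 0%E.
Proof. by rewrite /cmeas_Im complex_measure0. Qed.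

HB.instance Definition _ := isCharge.Build _ _ _ cmeas_Re
  cmeas_Re0 (fun _ _ => erefl) cmeas_Re_sigma_additive.
HB.instance Definition _ := isCharge.Build _ _ _ cmeas_Im
  cmeas_Im0 (fun _ _ => erefl) cmeas_Im_sigma_additive.

End complex_measure.

Section measure_integral.
Context d (T : measurableType d) (R : realType).

(* Integral against a finite signed measure, through its Jordan
   decomposition (which does not depend on the Hahn decomposition chosen). *)
Definition charge_cintegral (nu : {charge set T -> \bar R}) (f : T -> R[i]) :
    R[i] :=
  let nuP := cid (Hahn_decomposition nu) in
  let nuPN := svalP (cid (svalP nuP)) in
  cintegral (jordan_pos nuPN) f - cintegral (jordan_neg nuPN) f.

Definition cmeasure_integral (mu : complex_measure T R) (f : T -> R[i]) :
    R[i] :=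
  charge_cintegral (cmeas_Re mu) f + (0 +i* 1) * charge_cintegral (cmeas_Im mu) f.

End measure_integral.

(* Main.v *)
Require Import Defs.
From HB Require Import structures.
From mathcomp Require Import all_boot all_order all_algebra.
From mathcomp Require Import all_classical all_reals all_analysis.
From mathcomp Require Import measurable_realfun.
From mathcomp Require Import complex.
From mathcomp Require Import ring lra.

(** The function f is a linear combination, with coefficients 1, -1, i, -i, of
    Fourier transforms of finite positive measures nu, so that its cylinder
    functions are superpositions of plane waves exp(i <x, w>).

    For one plane wave, write the chirp exp(i x_j^2 / 2 hbar + i w_j x_j), times
    its normalization, as the derivative of a bounded function A_j.
    Integrating by parts once in each coordinate moves all the derivatives to
    phi(eps x); the resulting weight has the size of the Poisson kernel at scale
    1 / eps, so only the limits of A_j at infinity matter: these are 0 at -oo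
    and, after completing the square, exp(- i hbar w_j^2 / 2) at +oo. Replacing
    A_j by the corresponding multiple of the Heaviside function makes the
    integral equal to the product of these constants times phi(0) = 1. All the
    bounds are uniform in w, so dominated convergence gives the Fresnel integral
    of a cylinder function, and then its limit as n grows.

    The short-time Fourier transform of a plane wave with a Gaussian window is,
    up to a phase, a translate of the Fourier transform of the window, which two
    integrations by parts bound by C prod_j 1 / (1 + (xi_j / hbar - w_j)^2). This
    is integrable in xi with an integral independent of w, hence remains so
    after integration against nu. *)

Set Implicit Arguments.
Unset Strict Implicit.
Unset Printing Implicit Defensive.

Import Order.TTheory GRing.Theory Num.Theory.
Import numFieldNormedType.Exports.

Local Open Scope classical_set_scope.
Local Open Scope ring_scope.
Local Open Scope complex_scope.

(** The chirp has modulus 1, so no limit can be taken under the integral sign before the integration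
    by parts. After it, the weight eps^n |d_1 ... d_n phi(eps x)| is at most C prod_j eps / (1 +
    (eps x_j)^2), whose mass C pi^n is the same for every eps. The comparison with Heaviside
    functions is an identity, not an asymptotic statement: n uses of the fundamental theorem on the
    positive orthant return (-1)^n phi(0) for each eps > 0, so only the differences between A_j and
    its Heaviside multiple need an estimate, one coordinate at a time by telescoping. Two kinds of
    bounds are kept apart: those uniform in eps and w, which feed dominated convergence, and those
    whose constants degenerate as eps tends to 0, which serve only to justify Fubini and the
    integrations by parts at fixed eps. That A_j tends exactly to exp(- i hbar w_j^2 / 2) at +oo
    rests on the value sqrt pi exp(i pi / 4) of the integral of exp(i y^2) over R, which is derived
    here by real-variable means. *)

Section complex_modulus.
Variable R : realType.
Implicit Types (z w : R[i]) (x : R).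

Lemma cabsE z : `|z| = (cabs z)%:C.
Proof. by rewrite normc_def; case: z. Qed.

Lemma cabs_ge0 z : 0 <= cabs z.
Proof. by case: z => a b; exact: sqrtr_ge0. Qed.

Lemma cabs0 : cabs (0 : R[i]) = 0.
Proof. by apply: complexI; rewrite -cabsE normr0. Qed.

Lemma cabs1 : cabs (1 : R[i]) = 1.
Proof. by apply: complexI; rewrite -cabsE normr1. Qed.

Lemma cabsM z w : cabs (z * w) = cabs z * cabs w.
Proof. by apply: complexI; rewrite -cabsE normrM !cabsE rmorphM. Qed.

Lemma cabsN z : cabs (- z) = cabs z.
Proof. by apply: complexI; rewrite -!cabsE normrN. Qed.

Lemma cabsB z w : cabs (z - w) = cabs (w - z).
Proof. by rewrite -cabsN opprB. Qed.

Lemma ler_cabsD z w : cabs (z + w) <= cabs z + cabs w.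
Proof. by rewrite -lecR rmorphD/= -!cabsE ler_normD. Qed.

Lemma cabs_prod (I : Type) (r : seq I) (P : pred I) (F : I -> R[i]) :
  cabs (\prod_(i <- r | P i) F i) = \prod_(i <- r | P i) cabs (F i).
Proof.
by elim/big_ind2 : _ => //; [exact: cabs1|move=> a b c d <- <-; rewrite cabsM].
Qed.

Lemma cabsX z n : cabs (z ^+ n) = cabs z ^+ n.
Proof. by apply: complexI; rewrite -cabsE normrX cabsE rmorphXn. Qed.

Lemma cabs_real x : cabs x%:C = `|x|.
Proof. by rewrite /cabs /ComplexField.Normc.normc /= expr0n addr0 sqrtr_sqr. Qed.

Lemma normr_Re_le z : `|complex.Re z| <= cabs z.
Proof.
case: z => a b; rewrite /cabs /ComplexField.Normc.normc /= -sqrtr_sqr.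
by apply: ler_wsqrtr; rewrite lerDl sqr_ge0.
Qed.

Lemma normr_Im_le z : `|complex.Im z| <= cabs z.
Proof.
case: z => a b; rewrite /cabs /ComplexField.Normc.normc /= -sqrtr_sqr.
by apply: ler_wsqrtr; rewrite lerDr sqr_ge0.
Qed.

Lemma cabs_le_ReIm z : cabs z <= `|complex.Re z| + `|complex.Im z|.
Proof.
case: z => a b; have -> : a +i* b = a%:C + (0 +i* 1) * b%:C :> R[i].
  by apply/eqP; rewrite eq_complex/=; apply/andP; split; apply/eqP; ring.
apply: le_trans (ler_cabsD _ _) _; rewrite cabsM !cabs_real /=.
rewrite /cabs /ComplexField.Normc.normc /= expr0n expr1n add0r sqrtr1 mul1r.
by rewrite !mul0r !mulr0 !mul1r subr0 !addr0 !add0r.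
Qed.

Lemma complex_ReM z w : complex.Re (z * w) =
  complex.Re z * complex.Re w - complex.Im z * complex.Im w.
Proof. by case: z => a b; case: w. Qed.

Lemma complex_ImM z w : complex.Im (z * w) =
  complex.Re z * complex.Im w + complex.Im z * complex.Re w.
Proof. by case: z => a b; case: w. Qed.

Lemma complex_ReD z w : complex.Re (z + w) = complex.Re z + complex.Re w.
Proof. exact: raddfD. Qed.

Lemma complex_ImD z w : complex.Im (z + w) = complex.Im z + complex.Im w.
Proof. exact: raddfD. Qed.

Lemma complex_ReN z : complex.Re (- z) = - complex.Re z.
Proof. exact: raddfN. Qed.

Lemma complex_ImN z : complex.Im (- z) = - complex.Im z.
Proof. exact: raddfN. Qed.

Lemma complex_ext z w : complex.Re z = complex.Re w ->
  complex.Im z = complex.Im w -> z = w.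
Proof. by case: z => a b; case: w => c d /= -> ->. Qed.

Lemma cabs_expi x : cabs (expi x) = 1.
Proof.
by rewrite /cabs /ComplexField.Normc.normc /expi cos2Dsin2 sqrtr1.
Qed.

Lemma expiD x y : expi (x + y) = expi x * expi y.
Proof.
by apply: complex_ext; rewrite /expi /= ?cosD ?sinD //; ring.
Qed.

Lemma expi0 : expi (0 : R) = 1.
Proof. by rewrite /expi cos0 sin0. Qed.

Lemma expi_sum (I : Type) (r : seq I) (P : pred I) (F : I -> R) :
  expi (\sum_(i <- r | P i) F i) = \prod_(i <- r | P i) expi (F i).
Proof.
by elim/big_ind2 : _ => //; [exact: expi0|move=> a b c d <- <-; rewrite expiD].
Qed.

Lemma expiMn x n : expi (x *+ n) = expi x ^+ n.
Proof. by elim: n => [|n IH]; rewrite ?mulr0n ?expi0// mulrS expiD IH exprS. Qed.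

End complex_modulus.

(** * Limits, measurability and integrals of complex functions *)

Section complex_convergence.
Variables (R : realType) (T : Type) (F : set_system T).
Hypothesis FF : Filter F.

Lemma cvg_cabsP (f : T -> R[i]) (l : R[i]) :
  (f @ F --> l) <-> (cabs (f x - l) @[x --> F] --> (0 : R)).
Proof.
split => [/cvgrPdist_lt fl|/cvgrPdist_lt fl]; apply/cvgrPdist_lt => e e0.
  have := fl e%:C; rewrite ltcR => /(_ e0); apply: filterS => x.
  by rewrite cabsE ltcR sub0r normrN ger0_norm ?cabs_ge0// cabsB.
(* The order of [R[i]] compares only numbers with equal imaginary parts, so a positive radius is
   automatically a real one. *)
have er : complex.Im e = 0.
  by move: e0; rewrite ltcE /= => /andP[/eqP].
have e0' : 0 < complex.Re e by move: e0; rewrite ltcE /= => /andP[].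
have := fl _ e0'; apply: filterS => x.
rewrite sub0r normrN ger0_norm ?cabs_ge0// cabsB => h.
rewrite cabsE (_ : e = (complex.Re e)%:C) ?ltcR//.
by apply: complex_ext.
Qed.

Lemma cvg_ReImP (f : T -> R[i]) (l : R[i]) :
  (f @ F --> l) <-> (complex.Re (f x) @[x --> F] --> complex.Re l) /\
                    (complex.Im (f x) @[x --> F] --> complex.Im l).
Proof.
split => [/cvg_cabsP/cvgrPdist_lt fl|[fR fI]].
  by split; apply/cvgrPdist_lt => e e0; have := fl _ e0; apply: filterS => x;
    rewrite sub0r normrN ger0_norm ?cabs_ge0// cabsB; apply: le_lt_trans;
    rewrite -raddfB; [exact: normr_Re_le|exact: normr_Im_le].
apply/cvg_cabsP; apply/cvgrPdist_lt => e e0.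
have e20 : 0 < e / 2 by lra.
move/cvgrPdist_lt : fR => /(_ _ e20); move/cvgrPdist_lt : fI => /(_ _ e20).
apply: filterS2 => x hI hR.
rewrite sub0r normrN ger0_norm ?cabs_ge0// cabsB.
apply: le_lt_trans (cabs_le_ReIm _) _; rewrite !raddfB/=.
by rewrite (splitr e) ltrD.
Qed.

End complex_convergence.

Section complex_measurability.
Context d (T : measurableType d) (R : realType).
Implicit Types f g : T -> R[i].

Definition cmeasurable f :=
  measurable_fun setT (fun x => complex.Re (f x)) /\
  measurable_fun setT (fun x => complex.Im (f x)).

Lemma cmeasurable_cst (c : R[i]) : cmeasurable (fun=> c).
Proof. by split; exact: measurable_cst. Qed.

Lemma cmeasurableD f g : cmeasurable f -> cmeasurable g ->
  cmeasurable (fun x => f x + g x).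
Proof.
move=> [a b] [c e]; split.
  under eq_fun do rewrite raddfD; exact: measurable_funD.
under eq_fun do rewrite raddfD; exact: measurable_funD.
Qed.

Lemma cmeasurableM f g : cmeasurable f -> cmeasurable g ->
  cmeasurable (fun x => f x * g x).
Proof.
move=> [a b] [c e]; split.
  under eq_fun do rewrite complex_ReM.
  by apply: measurable_funB; exact: measurable_funM.
under eq_fun do rewrite complex_ImM.
by apply: measurable_funD; exact: measurable_funM.
Qed.

Lemma cmeasurableN f : cmeasurable f -> cmeasurable (fun x => - f x).
Proof.
by move=> [a b]; split; under eq_fun do rewrite raddfN;
  exact: measurableT_comp.
Qed.

Lemma cmeasurableB f g : cmeasurable f -> cmeasurable g ->
  cmeasurable (fun x => f x - g x).
Proof. by move=> mf mg; apply: cmeasurableD => //; exact: cmeasurableN. Qed.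

Lemma cmeasurable_prod (I : Type) (r : seq I) (P : pred I)
    (F : I -> T -> R[i]) : (forall i, cmeasurable (F i)) ->
  cmeasurable (fun x => \prod_(i <- r | P i) F i x).
Proof.
move=> mF; elim: r => [|i r IH].
  by under eq_fun do rewrite big_nil; exact: cmeasurable_cst.
under eq_fun do rewrite big_cons.
by case: (P i) => //; exact: cmeasurableM.
Qed.

Lemma cmeasurable_expi (h : T -> R) : measurable_fun setT h ->
  cmeasurable (fun x => expi (h x)).
Proof.
by move=> mh; split; apply: measurableT_comp => //=;
  apply: continuous_measurable_fun; [exact: continuous_cos|exact: continuous_sin].
Qed.

Lemma cmeasurable_real (h : T -> R) : measurable_fun setT h ->
  cmeasurable (fun x => (h x)%:C).
Proof. by move=> mh; split => //=. Qed.

Lemma measurable_cabs f : cmeasurable f ->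
  measurable_fun setT (fun x => cabs (f x)).
Proof.
move=> [mR mI].
have -> : (fun x => cabs (f x)) = (fun x =>
    Num.sqrt (complex.Re (f x) ^+ 2 + complex.Im (f x) ^+ 2)).
  by apply/funext => x; rewrite /cabs /ComplexField.Normc.normc; case: (f x).
apply: measurableT_comp; first by apply: continuous_measurable_fun; exact: sqrt_continuous.
by apply: measurable_funD; apply: measurable_funX.
Qed.

End complex_measurability.

Lemma cmeasurable_comp d d' (T : measurableType d) (U : measurableType d')
    (R : realType) (f : U -> R[i]) (h : T -> U) :
  cmeasurable f -> measurable_fun setT h -> cmeasurable (fun x => f (h x)).
Proof.
by move=> [a b] mh; split; [exact: (measurableT_comp a mh)|exact: (measurableT_comp b mh)].
Qed.

Section complex_integral.
Context d (T : measurableType d) (R : realType).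
Variable m : {measure set T -> \bar R}.
Implicit Types (f : T -> R[i]) (g : T -> R).

Definition cintegrable f :=
  m.-integrable setT (EFin \o (fun x => complex.Re (f x))) /\
  m.-integrable setT (EFin \o (fun x => complex.Im (f x))).

Lemma cintegrable_cmeasurable f : cintegrable f -> cmeasurable f.
Proof. by move=> [/measurable_int/measurable_EFinP a /measurable_int/measurable_EFinP b]. Qed.

Lemma cintegrable_dom f g : cmeasurable f -> m.-integrable setT (EFin \o g) ->
  (forall x, cabs (f x) <= g x) -> cintegrable f.
Proof.
move=> [mR mI] ig fg; split; apply: le_integrable ig => //=.
- exact/measurable_EFinP.
- move=> x _; rewrite lee_fin; apply: le_trans (normr_Re_le _) _.
  exact: le_trans (fg x) (ler_norm _).
- exact/measurable_EFinP.
- move=> x _; rewrite lee_fin; apply: le_trans (normr_Im_le _) _.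
  exact: le_trans (fg x) (ler_norm _).
Qed.

Lemma cintegrable_cabs f : cintegrable f ->
  m.-integrable setT (EFin \o (fun x => cabs (f x))).
Proof.
move=> fi; have [iR iI] := fi; have mf := cintegrable_cmeasurable fi.
apply: (@le_integrable _ _ _ _ _ measurableT _
  (EFin \o (fun x => `|complex.Re (f x)| + `|complex.Im (f x)|))).
- by apply/measurable_EFinP; exact: measurable_cabs.
- move=> x _ /=; rewrite lee_fin (ger0_norm (cabs_ge0 _)) [leRHS]ger0_norm ?addr_ge0//.
  exact: cabs_le_ReIm.
- have -> : (EFin \o (fun x => `|complex.Re (f x)| + `|complex.Im (f x)|)) =
    ((fun x => `|complex.Re (f x)|%:E) \+ (fun x => `|complex.Im (f x)|%:E))%E.
    by apply/funext => x.
  by apply: integrableD => //; exact: integrable_norm.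
Qed.

Lemma cintegrableZ c f : cintegrable f -> cintegrable (fun x => c * f x).
Proof.
move=> fi; have mf := cintegrable_cmeasurable fi.
apply: (@cintegrable_dom _ (fun x => cabs c * cabs (f x))).
- by apply: cmeasurableM => //; exact: cmeasurable_cst.
- exact: (integrableZl measurableT (cabs c) (cintegrable_cabs fi)).
- by move=> x; rewrite cabsM.
Qed.

Lemma cintegralD f1 f2 : cintegrable f1 -> cintegrable f2 ->
  cintegral m (fun x => f1 x + f2 x) = cintegral m f1 + cintegral m f2.
Proof.
move=> [a b] [c e]; apply: complex_ext => /=.
  rewrite -RintegralD//; apply: eq_Rintegral => x _; exact: raddfD.
rewrite -RintegralD//; apply: eq_Rintegral => x _; exact: raddfD.
Qed.

Lemma cintegralZ c f : cintegrable f ->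
  cintegral m (fun x => c * f x) = c * cintegral m f.
Proof.
move=> [a b]; apply: complex_ext => /=.
  rewrite complex_ReM/= -!RintegralZl// -RintegralB//; last 2 first.
    exact: (integrableZl measurableT _ a).
    exact: (integrableZl measurableT _ b).
  by apply: eq_Rintegral => x _; rewrite complex_ReM.
rewrite complex_ImM/= -!RintegralZl// -RintegralD//; last 2 first.
  exact: (integrableZl measurableT _ b).
  exact: (integrableZl measurableT _ a).
by apply: eq_Rintegral => x _; rewrite complex_ImM.
Qed.

Lemma cintegralB f1 f2 : cintegrable f1 -> cintegrable f2 ->
  cintegral m (fun x => f1 x - f2 x) = cintegral m f1 - cintegral m f2.
Proof.
move=> a b; have := cintegralD a (cintegrableZ (-1) b).
rewrite cintegralZ// mulN1r => <-; congr cintegral.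
by apply/funext => x; rewrite mulN1r.
Qed.

(** The factor 2 comes from bounding the real and imaginary parts separately; every later use needs
    only some fixed constant. *)
Lemma cabs_cintegral_le f g : cmeasurable f ->
  m.-integrable setT (EFin \o g) -> (forall x, cabs (f x) <= g x) ->
  cabs (cintegral m f) <= 2 * Rintegral m setT g.
Proof.
move=> mf ig fg; have [a b] := cintegrable_dom mf ig fg.
apply: le_trans (cabs_le_ReIm _) _ => /=; rewrite mulr2n mulrDl !mul1r.
apply: lerD; apply: le_trans (le_normr_Rintegral measurableT _) _ => //;
  apply: le_Rintegral => //; try exact: integrable_norm.
- by move=> x _; apply: le_trans (normr_Re_le _) _.
- by move=> x _; apply: le_trans (normr_Im_le _) _.
Qed.

Lemma Rintegral_dct (f_ : nat -> T -> R) (f g : T -> R) :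
  (forall n, measurable_fun setT (f_ n)) ->
  (forall x, f_ n x @[n --> \oo] --> f x) ->
  m.-integrable setT (EFin \o g) -> (forall n x, `|f_ n x| <= g x) ->
  Rintegral m setT (f_ n) @[n --> \oo] --> Rintegral m setT f.
Proof.
move=> mf_ f_f ig f_g.
have mf : measurable_fun setT f.
  by apply: (measurable_fun_cvg (h := f_)) => // x _; exact: f_f.
have := @dominated_cvg _ T R m setT measurableT (fun n => EFin \o f_ n)
  (EFin \o f) (EFin \o g) (fun n => (measurable_EFinP _ _).2 (mf_ n))
  (fun x _ => cvg_EFin (nearW _ _) (f_f x)) (fun x _ => erefl) ig
  (fun n x _ => f_g n x).
(* Integrability of the limit makes its extended integral finite, so that the [fine] hidden in
   [Rintegral] can be undone. *)
have fi : m.-integrable setT (EFin \o f).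
  apply: le_integrable ig => //; first exact/measurable_EFinP.
  move=> x _ /=; rewrite lee_fin; apply: le_trans (ler_norm (g x)).
  have h : `|f_ n x| @[n --> \oo] --> `|f x| by apply: cvg_norm; exact: f_f.
  rewrite -(cvg_lim (@Rhausdorff R) h); apply: limr_le; first exact: cvgP h.
  by apply: nearW => n; exact: f_g.
move=> h; apply: fine_cvg; rewrite fineK; first exact: h.
exact: integrable_fin_num.
Qed.

Lemma cintegral_dct (f_ : nat -> T -> R[i]) f g :
  (forall n, cmeasurable (f_ n)) ->
  (forall x, f_ n x @[n --> \oo] --> f x) ->
  m.-integrable setT (EFin \o g) -> (forall n x, cabs (f_ n x) <= g x) ->
  cintegral m (f_ n) @[n --> \oo] --> cintegral m f.
Proof.
move=> mf_ f_f ig f_g; apply/cvg_ReImP; split => /=.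
  apply: (Rintegral_dct (g := g)) => //.
  - by move=> n; exact: (mf_ n).1.
  - by move=> x; have /cvg_ReImP[] := f_f x.
  - by move=> n x; apply: le_trans (normr_Re_le _) _.
apply: (Rintegral_dct (g := g)) => //.
- by move=> n; exact: (mf_ n).2.
- by move=> x; have /cvg_ReImP[] := f_f x.
- by move=> n x; apply: le_trans (normr_Im_le _) _.
Qed.

Lemma eq_cintegral f1 f2 : f1 =1 f2 -> cintegral m f1 = cintegral m f2.
Proof. by move=> /funext ->. Qed.

End complex_integral.

Section complex_fubini.
Context d1 d2 (T1 : measurableType d1) (T2 : measurableType d2) (R : realType).
Variables (m1 : {sigma_finite_measure set T1 -> \bar R})
  (m2 : {sigma_finite_measure set T2 -> \bar R}).

(** Asking for integrability of every section, not almost every one, identifies the inner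
    [Rintegral] with [fubini_F] at each point, so no exceptional null set has to be carried
    along. *)
Lemma Rintegral_fubini1 (f : T1 * T2 -> R) :
  (m1 \x m2)%E.-integrable setT (EFin \o f) ->
  (forall x, m2.-integrable setT (EFin \o (fun y => f (x, y)))) ->
  m1.-integrable setT (EFin \o (fun x => Rintegral m2 setT (fun y => f (x, y)))) /\
  Rintegral (m1 \x m2)%E setT f =
  Rintegral m1 setT (fun x => Rintegral m2 setT (fun y => f (x, y))).
Proof.
move=> fi sf.
have E : (EFin \o (fun x => Rintegral m2 setT (fun y => f (x, y)))) =
    fubini_F m2 (EFin \o f).
  apply/funext => x /=; rewrite /Rintegral fineK//.
  exact: (integrable_fin_num measurableT (sf x)).
split; first by rewrite E; exact: integrable_fubini_F.
rewrite /Rintegral -integral12_prod_meas1//; congr fine.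
by rewrite -E.
Qed.

Lemma Rintegral_fubini2 (f : T1 * T2 -> R) :
  (m1 \x m2)%E.-integrable setT (EFin \o f) ->
  (forall y, m1.-integrable setT (EFin \o (fun x => f (x, y)))) ->
  m2.-integrable setT (EFin \o (fun y => Rintegral m1 setT (fun x => f (x, y)))) /\
  Rintegral (m1 \x m2)%E setT f =
  Rintegral m2 setT (fun y => Rintegral m1 setT (fun x => f (x, y))).
Proof.
move=> fi sf.
have E : (EFin \o (fun y => Rintegral m1 setT (fun x => f (x, y)))) =
    fubini_G m1 (EFin \o f).
  apply/funext => x /=; rewrite /Rintegral fineK//.
  exact: (integrable_fin_num measurableT (sf x)).
split.
  rewrite E; apply/integrableP; split.
    exact: (measurable_fubini_G fi).
  have /integrable21ltyP := fi; move/(_ (measurable_int _ fi)).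
  apply: le_lt_trans; apply: ge0_le_integral => //.
  - apply: measurableT_comp => //; exact: (measurable_fubini_G fi).
  - apply: (@measurable_fun_fubini_tonelli_G _ _ _ _ _ m1
      (fun z => `|(EFin \o f) z|%E)) => //.
    by apply: measurableT_comp => //; exact: measurable_int fi.
  - by move=> y _; apply: le_abse_integral => //; exact: measurable_int (sf y).
rewrite /Rintegral -integral21_prod_meas1//; congr fine.
by rewrite -E.
Qed.

Lemma cintegral_fubini1 (f : T1 * T2 -> R[i]) :
  cintegrable (m1 \x m2)%E f -> (forall x, cintegrable m2 (fun y => f (x, y))) ->
  cintegrable m1 (fun x => cintegral m2 (fun y => f (x, y))) /\
  cintegral (m1 \x m2)%E f = cintegral m1 (fun x => cintegral m2 (fun y => f (x, y))).
Proof.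
move=> [fR fI] sf.
have [a b] := Rintegral_fubini1 fR (fun x => (sf x).1).
have [c e] := Rintegral_fubini1 fI (fun x => (sf x).2).
by split => //; apply: complex_ext; [exact: b|exact: e].
Qed.

Lemma cintegral_fubini2 (f : T1 * T2 -> R[i]) :
  cintegrable (m1 \x m2)%E f -> (forall y, cintegrable m1 (fun x => f (x, y))) ->
  cintegrable m2 (fun y => cintegral m1 (fun x => f (x, y))) /\
  cintegral (m1 \x m2)%E f = cintegral m2 (fun y => cintegral m1 (fun x => f (x, y))).
Proof.
move=> [fR fI] sf.
have [a b] := Rintegral_fubini2 fR (fun x => (sf x).1).
have [c e] := Rintegral_fubini2 fI (fun x => (sf x).2).
by split => //; apply: complex_ext; [exact: b|exact: e].
Qed.

Lemma integrable_prod (f : T1 -> R) (g : T2 -> R) :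
  (forall x, 0 <= f x) -> (forall x, 0 <= g x) ->
  m1.-integrable setT (EFin \o f) -> m2.-integrable setT (EFin \o g) ->
  (m1 \x m2)%E.-integrable setT (EFin \o (fun z => f z.1 * g z.2)) /\
  Rintegral (m1 \x m2)%E setT (fun z => f z.1 * g z.2) =
  Rintegral m1 setT f * Rintegral m2 setT g.
Proof.
move=> f0 g0 fi gi.
have mf : measurable_fun setT (EFin \o (fun z : T1 * T2 => f z.1 * g z.2)).
  apply/measurable_EFinP; apply: measurable_funM.
    by apply: measurableT_comp => //; apply/measurable_EFinP; exact: measurable_int fi.
  by apply: measurableT_comp => //; apply/measurable_EFinP; exact: measurable_int gi.
have E x : (\int[m2]_y `|(EFin \o (fun z => (f z.1 * g z.2)%R)) (x, y)| =
    (f x * Rintegral m2 setT g)%:E)%E.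
  rewrite EFinM /Rintegral fineK; last exact: integrable_fin_num.
  rewrite -integralZl//; apply: eq_integral => y _ /=.
  by rewrite ger0_norm ?mulr_ge0.
have fgi : (m1 \x m2)%E.-integrable setT (EFin \o (fun z => f z.1 * g z.2)).
  apply/integrable12ltyP => //.
  under eq_integral do rewrite E.
  under eq_integral do rewrite mulrC.
  apply: integrable_lty => //; exact: (integrableZl measurableT _ fi).
split => //.
have [_ ->] := Rintegral_fubini1 fgi (fun x => integrableZl measurableT (f x) gi).
rewrite -RintegralZr//; apply: eq_Rintegral => x _ /=.
exact: RintegralZl.
Qed.

End complex_fubini.

(** * Calculus on the line and the kernel 1 / (1 + x^2) *)

Section line_integrals.
Variable R : realType.
Notation mu := (@lebesgue_measure R).
Notation M := (measurableTypeR R).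
Implicit Types (F f u : R -> R).

Lemma is_derive_continuous F f : (forall x, is_derive x (1 : R) F (f x)) ->
  continuous F.
Proof.
move=> dF x; apply: differentiable_continuous; apply/derivable1_diffP.
exact: ex_derive.
Qed.

Lemma continuous_integrable_itv f (a b : R) : continuous f ->
  mu.-integrable `[a, b] (EFin \o f).
Proof.
move=> cf; apply: continuous_compact_integrable; first exact: segment_compact.
exact: continuous_subspaceT.
Qed.

Lemma ftc_itv F f a b : a <= b -> (forall x, is_derive x (1 : R) F (f x)) ->
  continuous f -> Rintegral mu `[a, b] f = F b - F a.
Proof.
move=> + dF cf; rewrite le_eqVlt => /predU1P[->|ab].
  by rewrite set_itv1 Rintegral_set1 subrr.
have cF := is_derive_continuous dF.
rewrite /Rintegral (@continuous_FTC2 _ f F)//.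
- exact: continuous_subspaceT.
- split; first by move=> x _; exact: ex_derive.
    by apply: cvg_at_right_filter; exact: cF.
  by apply: cvg_at_left_filter; exact: cF.
- by move=> x _; rewrite derive1E derive_val.
Qed.

Lemma cvg_natr : (n%:R : R) @[n --> \oo] --> +oo.
Proof. exact: cvgr_idn. Qed.

(** Dominated convergence for the restrictions of [f], with majorant |f|; it reduces integrals over
    the line to the fundamental theorem on segments. *)
Lemma cvg_Rintegral_itv f : mu.-integrable setT (EFin \o f) ->
  Rintegral mu `[- n%:R, n%:R] f @[n --> \oo] --> Rintegral mu setT f.
Proof.
move=> fi; have mf : measurable_fun setT f.
  by apply/measurable_EFinP; exact: measurable_int fi.
under eq_cvg do rewrite Rintegral_mkcond.
apply: (@Rintegral_dct _ M R mu (fun n => f \_ `[- n%:R, n%:R]) f (fun x => `|f x|)).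
- by move=> n; apply/(measurable_restrictT (f : M -> R)); [exact: measurable_itv|exact: (measurable_funTS mf)].
- move=> x; apply: cvg_near_cst; near=> n.
  rewrite patchE mem_set//= in_itv/=.
  rewrite -ler_norml; near: n; exact: nbhs_infty_ger.
- exact: integrable_norm.
- by move=> n x; rewrite patchE; case: ifP => // _; rewrite normr0.
Unshelve. all: by end_near. Qed.

Lemma ftc_line F f (a b : R) : (forall x, is_derive x (1 : R) F (f x)) ->
  continuous f -> mu.-integrable setT (EFin \o f) ->
  F x @[x --> -oo] --> a -> F x @[x --> +oo] --> b ->
  Rintegral mu setT f = b - a.
Proof.
move=> dF cf fi Fa Fb.
have h := cvg_Rintegral_itv fi.
have h2 : Rintegral mu `[- n%:R, n%:R] f @[n --> \oo] --> b - a.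
  under eq_cvg => n.
    rewrite (ftc_itv (F := F) _ dF)//; last by rewrite (@le_trans _ _ 0) ?oppr_le0.
    over.
  apply: cvgB.
    exact: (cvg_comp _ _ cvg_natr Fb).
  have := cvg_comp _ _ ((cvgNrNy _).2 cvg_natr) Fa.
  exact.
exact: (cvg_unique _ h h2).
Qed.

Lemma ftc_half_line u u' : (forall x, is_derive x (1 : R) u (u' x)) ->
  continuous u' -> mu.-integrable setT (EFin \o u') ->
  u x @[x --> +oo] --> (0 : R) ->
  Rintegral mu setT (fun x => (0 <= x)%R%:R * u' x) = - u 0.
Proof.
move=> du cu ui u0.
have mH : measurable_fun setT (fun x : M => (0 <= x)%R%:R : R).
  have -> : (fun x : M => (0 <= x)%R%:R : R) = \1_(`[0, +oo[).
    by apply/funext => x; rewrite indicE mem_setE in_itv/= andbT.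
  exact: measurable_indic.
have mu' : measurable_fun setT u'.
  by apply/measurable_EFinP; exact: measurable_int ui.
have fi : mu.-integrable setT (EFin \o (fun x => (0 <= x)%R%:R * u' x)).
  apply: le_integrable ui => //.
    by apply/measurable_EFinP; exact: measurable_funM.
  move=> x _ /=; rewrite lee_fin normrM; apply: ler_piMl => //.
  by case: (0 <= x); rewrite ?normr1 ?normr0.
have h := cvg_Rintegral_itv fi.
have h2 : Rintegral mu `[- n%:R, n%:R] (fun x => (0 <= x)%R%:R * u' x)
    @[n --> \oo] --> 0 - u 0.
  (* The cut-off turns the segment [- n, n] into [0, n], which is why the value at 0 appears and
     nothing is asked of [u] at -oo. *)
  have E n : Rintegral mu `[- n%:R, n%:R] (fun x => (0 <= x)%R%:R * u' x) =
      u n%:R - u 0.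
    rewrite -(ftc_itv (F := u) _ du)// Rintegral_mkcond [RHS]Rintegral_mkcond.
    apply: eq_Rintegral => x _; rewrite !patchE !mem_setE !in_itv/=.
    case: (leP 0 x) => x0 /=; last by rewrite mul0r if_same.
    by rewrite mul1r (@le_trans _ _ 0) ?oppr_le0.
  under eq_cvg do rewrite E.
  apply: cvgB; last exact: cvg_cst.
  exact: (cvg_comp _ _ cvg_natr u0).
by rewrite sub0r in h2; exact: (cvg_unique _ h h2).
Qed.

(** Monotone convergence over [- n, n] yields integrability from the primitive alone. This is how
    the reference kernel is shown integrable, before any majorant is at hand. *)
Lemma ge0_integrable_ftc F f (a b : R) : (forall x, is_derive x (1 : R) F (f x)) ->
  continuous f -> (forall x, 0 <= f x) ->
  F x @[x --> -oo] --> a -> F x @[x --> +oo] --> b ->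
  mu.-integrable setT (EFin \o f) /\ Rintegral mu setT f = b - a.
Proof.
move=> dF cf f0 Fa Fb.
suff fi : mu.-integrable setT (EFin \o f) by split => //; exact: ftc_line Fa Fb.
have mf : measurable_fun (setT : set M) f by exact: continuous_measurable_fun.
apply/integrableP; split; first exact/measurable_EFinP.
have UE : \bigcup_n `[- n%:R, n%:R]%classic = [set: R].
  rewrite -subTset => x _; exists (Num.truncn `|x|).+1 => //=.
  by rewrite in_itv/= -ler_norml ltW// truncnS_gt.
have := @ge0_nondecreasing_set_cvg_integral _ M R (fun n => `[- n%:R, n%:R]%classic)
  (fun x => `|f x|%:E) mu.
rewrite UE => /(_ _ _ _ _) h.
have {}h : (\int[mu]_(x in `[(- n%:R)%R, n%:R%R]) `|f x|%:E)%E @[n --> \oo] -->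
    (\int[mu]_x `|f x|%:E)%E.
  apply: h.
  - move=> n m nm; apply/subsetPset; apply: subset_itv; rewrite bnd_simp ?lerN2 ler_nat//.
  - by move=> n; exact: measurable_itv.
  - by move=> n; apply: measurable_funTS; apply/measurable_EFinP; exact: measurableT_comp.
  - by move=> n x _; rewrite lee_fin.
have h2 : (\int[mu]_(x in `[(- n%:R)%R, n%:R%R]) `|f x|%:E)%E @[n --> \oo] --> (b - a)%:E.
  have E n : (\int[mu]_(x in `[(- n%:R)%R, n%:R%R]) `|f x|%:E)%E = (F n%:R - F (- n%:R))%:E.
    under eq_integral do rewrite ger0_norm//.
    rewrite -(ftc_itv (F := F) _ dF)//; last by rewrite (@le_trans _ _ 0) ?oppr_le0.
    rewrite /Rintegral fineK//; apply: (integrable_fin_num) => //.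
    exact: continuous_integrable_itv.
  under eq_cvg do rewrite E.
  apply: cvg_EFin; first by apply: nearW.
  apply: cvgB; first exact: (cvg_comp _ _ cvg_natr Fb).
  have := cvg_comp _ _ ((cvgNrNy _).2 cvg_natr) Fa.
  exact.
by rewrite [ltLHS](cvg_unique _ h h2) ?ltry.
Qed.

End line_integrals.

Section real_derivatives.
Variable R : realType.
Implicit Types f g : R -> R.

Lemma is_derive_mul f g x a b : is_derive x (1 : R) f a -> is_derive x (1 : R) g b ->
  is_derive x (1 : R) (fun y => f y * g y) (a * g x + f x * b).
Proof.
move=> fa gb; apply: (is_derive_eq (is_deriveM fa gb)).
by rewrite /GRing.scale/=; ring.
Qed.

Lemma is_derive_chain f g x a b : is_derive (g x) (1 : R) f a ->
  is_derive x (1 : R) g b -> is_derive x (1 : R) (fun y => f (g y)) (a * b).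
Proof. by move=> fa gb; apply: (is_derive_eq (is_derive1_comp fa gb)); rewrite mulrC. Qed.

Lemma is_derive_affine (a b x : R) : is_derive x (1 : R) (fun y => a * y + b) a.
Proof.
apply: (is_derive_eq (is_deriveD (is_deriveM (is_derive_cst a x 1) (is_derive_id x 1)) (is_derive_cst b x 1))).
by rewrite /GRing.scale/= !mulr1 mulr0 !addr0.
Qed.

Lemma is_derive_sqr (x : R) : is_derive x (1 : R) (fun y => y ^+ 2) (2 * x).
Proof.
have h := is_derive_mul (is_derive_id x (1:R)) (is_derive_id x (1:R)).
have -> : 2 * x = 1 * x + x * 1 by ring.
exact: h.
Qed.

End real_derivatives.

Section kernel.
Variable R : realType.
Notation mu := (@lebesgue_measure R).
Notation M := (measurableTypeR R).

(** The universal majorant: products of it over the coordinates dominate Schwartz functions in every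
    dimension, and its primitive [atan] gives its mass at all scales. *)
Definition kern (x : R) : R := (1 + x ^+ 2)^-1.

Lemma kern_den_gt0 (x : R) : 0 < 1 + x ^+ 2.
Proof. by rewrite ltr_pwDl ?sqr_ge0. Qed.

Lemma kern_gt0 (x : R) : 0 < kern x.
Proof. by rewrite invr_gt0 kern_den_gt0. Qed.

Lemma kern_ge0 (x : R) : 0 <= kern x.
Proof. exact/ltW/kern_gt0. Qed.

Lemma kern_le1 (x : R) : kern x <= 1.
Proof. by rewrite invf_le1 ?kern_den_gt0// lerDl sqr_ge0. Qed.

Lemma continuous_kern : continuous kern.
Proof. exact: continuous_oneDsqrV. Qed.

Lemma measurable_kern : measurable_fun (setT : set M) kern.
Proof. exact: continuous_measurable_fun continuous_kern. Qed.

(** The constant blows up as e tends to 0, so this serves only for integrability at a fixed e;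
    uniform estimates keep the dilated kernel. *)
Lemma kern_scale_le (e x : R) : 0 < e -> kern (e * x) <= (1 + e ^- 2) * kern x.
Proof.
move=> e0; rewrite /kern ler_pdivlMr ?kern_den_gt0// mulrC ler_pdivrMr ?kern_den_gt0//.
have -> : (1 + e ^- 2) * (1 + (e * x) ^+ 2) = 1 + x ^+ 2 + e ^- 2 + (e * x) ^+ 2.
  by field; rewrite gt_eqF.
have := sqr_ge0 (e * x); have : 0 <= e ^- 2 by rewrite invr_ge0 sqr_ge0.
lra.
Qed.

Lemma cvg_affine_y (a b : R) : 0 < a -> a * x + b @[x --> +oo] --> +oo.
Proof.
move=> a0; apply/cvgryPge => A; near=> x; rewrite -lerBlDr -ler_pdivrMl//.
Unshelve. all: by end_near. Qed.

Lemma cvg_affine_Ny (a b : R) : 0 < a -> a * x + b @[x --> -oo] --> -oo.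
Proof.
move=> a0; apply/cvgrNyPle => A; near=> x; rewrite -lerBrDr -ler_pdivlMl//.
Unshelve. all: by end_near. Qed.

Lemma cvgNy_atan : (@atan R) x @[x --> -oo] --> - (pi / 2).
Proof.
rewrite (_ : atan = fun x : R => - atan (- x)); last first.
  by apply/funext => x; rewrite atanN opprK.
apply: cvgN; apply: (cvg_comp _ _ _ (@cvgy_atan R)).
apply/cvgryPge => A; near=> x; rewrite lerNr; near: x.
by apply: nbhs_ninfty_le; rewrite num_real.
Unshelve. all: by end_near.
Qed.

(** The primitive atan(a x + b) shows that the mass depends neither on the scale nor on the centre;
    the uniformity in eps and in the frequencies comes from here. *)
Lemma integral_kern_affine (a b : R) : 0 < a ->
  mu.-integrable setT (EFin \o (fun x => a * kern (a * x + b))) /\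
  Rintegral mu setT (fun x => a * kern (a * x + b)) = pi.
Proof.
move=> a0.
have [] := @ge0_integrable_ftc R (fun x => atan (a * x + b))
  (fun x => a * kern (a * x + b)) (- (pi / 2)) (pi / 2).
- move=> x; have := is_derive_chain (g := fun y => a * y + b) (is_derive1_atan (a * x + b)) (is_derive_affine a b x).
  by rewrite mulrC.
- move=> x; apply: cvgM; first exact: cvg_cst.
  apply: (continuous_comp (f := fun x => a * x + b)); last exact: continuous_kern.
  by apply: cvgD; [apply: cvgM; [exact: cvg_cst|exact: cvg_id]|exact: cvg_cst].
- by move=> x; rewrite mulr_ge0 ?kern_ge0 ?ltW.
- exact: (cvg_comp _ _ (cvg_affine_Ny b a0) cvgNy_atan).
- exact: (cvg_comp _ _ (cvg_affine_y b a0) (@cvgy_atan R)).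
by move=> i ->; split => //; rewrite opprK -splitr.
Qed.

Lemma integrable_kern : mu.-integrable setT (EFin \o kern).
Proof.
have [] := @integral_kern_affine 1 0 ltr01.
by under eq_fun do rewrite mul1r mul1r addr0.
Qed.

Lemma cvg_kern (l : set_system R) : (l = pinfty_nbhs R) \/ (l = ninfty_nbhs R) ->
  kern x @[x --> l] --> (0 : R).
Proof.
have K (e x : R) : 0 < e -> e^-1 <= `|x| -> kern x <= e.
  move=> e0 ex; rewrite /kern invf_ple ?posrE ?kern_den_gt0//.
  apply: le_trans ex _; rewrite -real_normK ?num_real//.
  have [x1|x1] := leP 1 `|x|.
    by rewrite (@le_trans _ _ (`|x| ^+ 2)) ?ler_eXnr// lerDr.
  by rewrite (le_trans (ltW x1))// lerDl.
case=> ->; apply/cvgrPdist_le => e e0; near=> x;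
  rewrite sub0r normrN ger0_norm ?kern_ge0//; apply: K => //.
  apply: le_trans (ler_norm _); near: x; apply: nbhs_pinfty_ge; exact: num_real.
rewrite -normrN; apply: le_trans (ler_norm _); rewrite lerNr; near: x.
apply: nbhs_ninfty_le; exact: num_real.
Unshelve. all: by end_near. Qed.

End kernel.

(** * Integration by parts and Fourier decay in one variable *)

Section complex_line.
Variable R : realType.
Notation mu := (@lebesgue_measure R).
Notation M := (measurableTypeR R).
Implicit Types F f u e A : R -> R[i].

Definition ccontinuous f := continuous (fun x => complex.Re (f x)) /\
  continuous (fun x => complex.Im (f x)).

Definition cderive F f := forall x,
  is_derive x (1 : R) (fun y => complex.Re (F y)) (complex.Re (f x)) /\
  is_derive x (1 : R) (fun y => complex.Im (F y)) (complex.Im (f x)).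

Lemma ccontinuous_cmeasurable f : ccontinuous f -> cmeasurable (f : M -> R[i]).
Proof. by move=> [a b]; split; exact: continuous_measurable_fun. Qed.

Lemma cderive_ccontinuous F f : cderive F f -> ccontinuous F.
Proof.
by move=> dF; split; apply: is_derive_continuous => x; case: (dF x) => a b;
  [exact: a|exact: b].
Qed.

Lemma ccontinuousM f u : ccontinuous f -> ccontinuous u ->
  ccontinuous (fun x => f x * u x).
Proof.
move=> [a b] [c d]; split => x.
  rewrite /continuous_at; under eq_cvg do rewrite complex_ReM.
  rewrite complex_ReM; apply: cvgB; apply: cvgM; by [exact: a|exact: b|exact: c|exact: d].
rewrite /continuous_at; under eq_cvg do rewrite complex_ImM.
rewrite complex_ImM; apply: cvgD; apply: cvgM; by [exact: a|exact: b|exact: c|exact: d].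
Qed.

Lemma ccontinuousD f u : ccontinuous f -> ccontinuous u ->
  ccontinuous (fun x => f x + u x).
Proof.
move=> [a b] [c d]; split => x.
  rewrite /continuous_at; under eq_cvg do rewrite raddfD.
  by rewrite raddfD; apply: cvgD; [exact: a|exact: c].
rewrite /continuous_at; under eq_cvg do rewrite raddfD.
by rewrite raddfD; apply: cvgD; [exact: b|exact: d].
Qed.

Lemma cderiveM F f u e : cderive F f -> cderive u e ->
  cderive (fun x => F x * u x) (fun x => f x * u x + F x * e x).
Proof.
move=> dF du x; have [a b] := dF x; have [c d] := du x; split.
  have -> : (fun y => complex.Re (F y * u y)) = (fun y => complex.Re (F y) * complex.Re (u y))
    - (fun y => complex.Im (F y) * complex.Im (u y)) by apply/funext => y; exact: complex_ReM.
  apply: (is_derive_eq (is_deriveB (is_derive_mul a c) (is_derive_mul b d))).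
  by rewrite complex_ReD !complex_ReM; ring.
have -> : (fun y => complex.Im (F y * u y)) = (fun y => complex.Re (F y) * complex.Im (u y))
    + (fun y => complex.Im (F y) * complex.Re (u y)) by apply/funext => y; exact: complex_ImM.
apply: (is_derive_eq (is_deriveD (is_derive_mul a d) (is_derive_mul b c))).
by rewrite complex_ImD !complex_ImM; ring.
Qed.

Lemma cderive_expi (h h' : R -> R) : (forall x, is_derive x (1 : R) h (h' x)) ->
  cderive (fun x => expi (h x)) (fun x => (0 +i* h' x) * expi (h x)).
Proof.
move=> dh x; split => /=.
  apply: (is_derive_eq (is_derive_chain (is_derive_cos (h x)) (dh x))).
  by rewrite mul0r sub0r mulNr mulrC.
apply: (is_derive_eq (is_derive_chain (is_derive_sin (h x)) (dh x))).
by rewrite mul0r add0r mulrC.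
Qed.

Lemma cderive_chain F f (h h' : R -> R) : cderive F f ->
  (forall x, is_derive x (1 : R) h (h' x)) ->
  cderive (fun x => F (h x)) (fun x => (h' x)%:C * f (h x)).
Proof.
move=> dF dh x; have [a b] := dF (h x); split.
  apply: (is_derive_eq (is_derive_chain (f := fun y => complex.Re (F y)) a (dh x))).
  by rewrite complex_ReM/=; ring.
apply: (is_derive_eq (is_derive_chain (f := fun y => complex.Im (F y)) b (dh x))).
by rewrite complex_ImM/=; ring.
Qed.

Lemma cderiveD F f u e : cderive F f -> cderive u e ->
  cderive (fun x => F x + u x) (fun x => f x + e x).
Proof.
move=> dF du x; have [a b] := dF x; have [c d] := du x; split.
  have -> : (fun y => complex.Re (F y + u y)) = (fun y => complex.Re (F y))
    + (fun y => complex.Re (u y)) by apply/funext => y; exact: raddfD.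
  by apply: (is_derive_eq (is_deriveD a c)); rewrite raddfD.
have -> : (fun y => complex.Im (F y + u y)) = (fun y => complex.Im (F y))
    + (fun y => complex.Im (u y)) by apply/funext => y; exact: raddfD.
by apply: (is_derive_eq (is_deriveD b d)); rewrite raddfD.
Qed.

Lemma cderive_cst c : cderive (fun=> c) (fun=> 0).
Proof. by move=> x; split; exact: is_derive_cst. Qed.

Lemma cderiveZ c F f : cderive F f -> cderive (fun x => c * F x) (fun x => c * f x).
Proof.
move=> dF; have := cderiveM (cderive_cst c) dF.
by under [X in cderive _ X -> _]eq_fun do rewrite mul0r add0r.
Qed.

Lemma cintegrable_kern f C : cmeasurable (f : M -> R[i]) ->
  (forall x, cabs (f x) <= C * kern x) -> cintegrable mu (f : M -> R[i]).
Proof.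
move=> mf fC; apply: (@cintegrable_dom _ M R mu f (fun x => C * kern x)) => //.
exact: (integrableZl measurableT C (integrable_kern R)).
Qed.

Lemma cftc_line F f C C' : cderive F f -> ccontinuous f ->
  (forall x, cabs (F x) <= C * kern x) -> (forall x, cabs (f x) <= C' * kern x) ->
  cintegral mu f = 0.
Proof.
move=> dF [cR cI] FC fC.
have [iR iI] := cintegrable_kern (ccontinuous_cmeasurable (conj cR cI)) fC.
have cvg0 (G : R -> R) l : (forall x, `|G x| <= cabs (F x)) ->
    (l = pinfty_nbhs R) \/ (l = ninfty_nbhs R) -> G x @[x --> l] --> (0 : R).
  move=> GF hl; have Fl : Filter l by case: hl => ->; exact: _.
  apply: norm_cvg0; apply: (squeeze_cvgr (f := fun=> 0) (h := fun x => C * kern x)).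
  - by apply: nearW => x; rewrite normr_ge0 (le_trans (GF x)).
  - exact: cvg_cst.
  - by rewrite -(mulr0 C); apply: cvgM; [exact: cvg_cst|exact: cvg_kern].
apply: complex_ext => /=.
  apply: etrans (subr0 0); apply: (@ftc_line R (fun x => complex.Re (F x))) => //.
  - by move=> x; case: (dF x).
  - by apply: cvg0; [move=> x; exact: normr_Re_le|right].
  - by apply: cvg0; [move=> x; exact: normr_Re_le|left].
apply: etrans (subr0 0); apply: (@ftc_line R (fun x => complex.Im (F x))) => //.
- by move=> x; case: (dF x).
- by apply: cvg0; [move=> x; exact: normr_Im_le|right].
- by apply: cvg0; [move=> x; exact: normr_Im_le|left].
Qed.

(** The product A u decays like [kern], so there is no boundary term although [A] itself is merely
    bounded and may have nonzero limits. *)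
Lemma cftc_line_sum A e u u' B E C : cderive A e -> ccontinuous e ->
  cderive u u' -> ccontinuous u' ->
  (forall x, cabs (A x) <= B) -> (forall x, cabs (e x) <= E) ->
  (forall x, cabs (u x) <= C * kern x) -> (forall x, cabs (u' x) <= C * kern x) ->
  [/\ cintegrable mu (fun x : M => e x * u x), cintegrable mu (fun x : M => A x * u' x) &
  cintegral mu (fun x => e x * u x) = - cintegral mu (fun x => A x * u' x)].
Proof.
move=> dA ce du cu' AB eE uC u'C.
have B0 : 0 <= B := le_trans (cabs_ge0 _) (AB 0).
have E0 : 0 <= E := le_trans (cabs_ge0 _) (eE 0).
have cA := cderive_ccontinuous dA; have cu := cderive_ccontinuous du.
have b1 x : cabs (e x * u x) <= (E * C) * kern x.
  by rewrite cabsM -mulrA ler_pM ?cabs_ge0.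
have b2 x : cabs (A x * u' x) <= (B * C) * kern x.
  by rewrite cabsM -mulrA ler_pM ?cabs_ge0.
have b3 x : cabs (A x * u x) <= (B * C) * kern x.
  by rewrite cabsM -mulrA ler_pM ?cabs_ge0.
have i1 : cintegrable mu (fun x : M => e x * u x).
  by apply: cintegrable_kern b1; apply: ccontinuous_cmeasurable; exact: ccontinuousM.
have i2 : cintegrable mu (fun x : M => A x * u' x).
  by apply: cintegrable_kern b2; apply: ccontinuous_cmeasurable; exact: ccontinuousM.
split => //; apply/eqP; rewrite -addr_eq0 -cintegralD//; apply/eqP.
apply: (cftc_line (F := fun x => A x * u x) (C := B * C) (C' := E * C + B * C)) => //.
- exact: cderiveM.
- by apply: ccontinuousD; exact: ccontinuousM.
- by move=> x; rewrite mulrDl; apply: le_trans (ler_cabsD _ _) _; exact: lerD.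
Qed.

Definition heaviside (x : R) : R[i] := ((0 <= x)%R%:R : R)%:C.

Lemma cabs_heaviside x : cabs (heaviside x) <= 1.
Proof. by rewrite cabs_real; case: (0 <= x); rewrite ?normr1 ?normr0. Qed.

Lemma cmeasurable_heaviside : cmeasurable (heaviside : M -> R[i]).
Proof.
apply: cmeasurable_real.
have -> : (fun x : M => (0 <= x)%R%:R : R) = \1_(`[0, +oo[).
  by apply/funext => x; rewrite indicE mem_setE in_itv/= andbT.
exact: measurable_indic.
Qed.

Lemma chalf_line u u' C : cderive u u' -> ccontinuous u' ->
  (forall x, cabs (u x) <= C * kern x) -> (forall x, cabs (u' x) <= C * kern x) ->
  cintegrable mu (fun x : M => heaviside x * u' x) /\
  cintegral mu (fun x => heaviside x * u' x) = - u 0.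
Proof.
move=> du cu' uC u'C.
have mu' := ccontinuous_cmeasurable cu'; have [iR iI] := cintegrable_kern mu' u'C.
have cvg0 (G : R -> R) : (forall x, `|G x| <= cabs (u x)) ->
    G x @[x --> +oo] --> (0 : R).
  move=> Gu; apply: norm_cvg0; apply: (squeeze_cvgr (f := fun=> 0) (h := fun x => C * kern x)).
  - by apply: nearW => x; rewrite normr_ge0 (le_trans (Gu x)).
  - exact: cvg_cst.
  - by rewrite -(mulr0 C); apply: cvgM; [exact: cvg_cst|apply: cvg_kern; left].
split.
  apply: (@cintegrable_kern _ C).
    by apply: cmeasurableM => //; exact: cmeasurable_heaviside.
  move=> x; rewrite cabsM (le_trans _ (u'C x))//.
  by rewrite ler_piMl ?cabs_ge0 ?cabs_heaviside.
have [cR cI] := cu'; apply: complex_ext => /=.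
  rewrite complex_ReN -(ftc_half_line (u := fun x => complex.Re (u x)) (fun x => (du x).1))//.
  - by apply: eq_Rintegral => x _; rewrite complex_ReM /= mul0r subr0.
  - by apply: cvg0 => x; exact: normr_Re_le.
rewrite complex_ImN -(ftc_half_line (u := fun x => complex.Im (u x)) (fun x => (du x).2))//.
- by apply: eq_Rintegral => x _; rewrite complex_ImM /= mul0r addr0.
- by apply: cvg0 => x; exact: normr_Im_le.
Qed.

(** Two integrations by parts turn eta^2 I into the same kind of integral with u'' in place of u.
    Both |I| and |eta^2 I| are at most 2 C pi, which adds up to 4 pi C for (1 + eta^2) |I|. The
    centre - b does not enter, because the mass of the kernel is translation invariant. *)
Lemma cabs_fourier_le (u u' u'' : R -> R[i]) (eta C b : R) :
  cderive u u' -> cderive u' u'' -> ccontinuous u'' ->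
  (forall x, cabs (u x) <= C * kern (x + b)) ->
  (forall x, cabs (u' x) <= C * kern (x + b)) ->
  (forall x, cabs (u'' x) <= C * kern (x + b)) ->
  cintegrable mu (fun x : M => expi (- (eta * x)) * u x) /\
  cabs (cintegral mu (fun x => expi (- (eta * x)) * u x)) <= 4 * pi * C * kern eta.
Proof.
move=> du du' cu'' uC u'C u''C.
have C0 : 0 <= C.
  by have := le_trans (cabs_ge0 _) (uC 0); rewrite pmulr_lge0 ?kern_gt0.
have [ik ikE] := @integral_kern_affine R 1 b ltr01.
have [ik' ikE'] : mu.-integrable setT (EFin \o (fun x => C * kern (x + b))) /\
    Rintegral mu setT (fun x => C * kern (x + b)) = C * pi.
  have E : (fun x : R => C * kern (x + b)) = (fun x => C * (1 * kern (1 * x + b))).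
    by apply/funext => x; rewrite !mul1r.
  rewrite E; split; first exact: (integrableZl measurableT _ ik).
  by rewrite RintegralZl// ikE.
(* Recentring costs a constant depending on b. It is spent only on the decay hypotheses of
   [cftc_line_sum]; the final bound uses the translated kernel itself. *)
have kb (x : R) : kern (x + b) <= 2 * (1 + b ^+ 2) * kern x.
  rewrite /kern ler_pdivlMr ?kern_den_gt0// mulrC ler_pdivrMr ?kern_den_gt0//.
  rewrite -subr_ge0.
  have -> : 2 * (1 + b ^+ 2) * (1 + (x + b) ^+ 2) - (1 + x ^+ 2) =
     1 + 2 * (b * (x + b)) ^+ 2 + (x + 2 * b) ^+ 2  by ring.
  apply: addr_ge0; last exact: sqr_ge0.
  by apply: addr_ge0 => //; apply: mulr_ge0 => //; exact: sqr_ge0.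
have dom (v : R -> R[i]) : (forall x, cabs (v x) <= C * kern (x + b)) ->
    forall x, cabs (v x) <= C * (2 * (1 + b ^+ 2)) * kern x.
  by move=> vC x; apply: le_trans (vC x) _; rewrite -mulrA ler_wpM2l.
have dE : cderive (fun x => expi (- (eta * x)))
    (fun x => (0 +i* - eta) * expi (- (eta * x))).
  apply: (cderive_expi (h := fun x => - (eta * x)) (h' := fun=> - eta)) => x.
  have := is_derive_affine (- eta) 0 x.
  by under eq_fun do rewrite addr0 mulNr.
have cE := cderive_ccontinuous dE.
have cE' : ccontinuous (fun x => (0 +i* - eta) * expi (- (eta * x))).
  by apply: ccontinuousM => //; exact: cderive_ccontinuous (cderive_cst _).
have bE x : cabs (expi (- (eta * x))) <= 1 by rewrite cabs_expi.
have bE' x : cabs ((0 +i* - eta) * expi (- (eta * x))) <= cabs (0 +i* - eta).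
  by rewrite cabsM cabs_expi mulr1.
have ibp v v' : cderive v v' -> ccontinuous v' ->
    (forall x, cabs (v x) <= C * kern (x + b)) ->
    (forall x, cabs (v' x) <= C * kern (x + b)) ->
    (0 +i* - eta) * cintegral mu (fun x => expi (- (eta * x)) * v x) =
    - cintegral mu (fun x => expi (- (eta * x)) * v' x).
  move=> dv cv vC v'C.
  have [_ _ <-] := cftc_line_sum dE cE' dv cv bE bE' (dom _ vC) (dom _ v'C).
  rewrite -cintegralZ; last first.
    apply: (@cintegrable_dom _ M R mu _ _ _ ik').
      by apply: ccontinuous_cmeasurable; apply: ccontinuousM => //; exact: cderive_ccontinuous dv.
    by move=> x; rewrite cabsM cabs_expi mul1r.
  by apply: eq_cintegral => x; rewrite mulrA.
have fi v : ccontinuous v -> (forall x, cabs (v x) <= C * kern (x + b)) ->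
    cintegrable mu (fun x : M => expi (- (eta * x)) * v x) /\
    cabs (cintegral mu (fun x => expi (- (eta * x)) * v x)) <= 2 * (C * pi).
  move=> cv vC.
  have mv : cmeasurable (fun x : M => expi (- (eta * x)) * v x).
    by apply: ccontinuous_cmeasurable; exact: ccontinuousM.
  have bv x : cabs (expi (- (eta * x)) * v x) <= C * kern (x + b).
    by rewrite cabsM cabs_expi mul1r.
  split; first exact: cintegrable_dom mv ik' bv.
  by rewrite -ikE'; exact: (cabs_cintegral_le mv ik' bv).
have cu := cderive_ccontinuous du; have cu' := cderive_ccontinuous du'.
have [i0 b0] := fi _ cu uC; have [_ b2] := fi _ cu'' u''C.
split => //; rewrite /kern ler_pdivlMr ?kern_den_gt0//.
set I := cintegral _ _ in b0 *.
have -> : cabs I * (1 + eta ^+ 2) = cabs I + cabs ((0 +i* - eta) * ((0 +i* - eta) * I)).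
  rewrite !cabsM; have -> : cabs (0 +i* - eta) = `|eta|.
    by rewrite /cabs /ComplexField.Normc.normc expr0n/= add0r sqrtr_sqr normrN.
  by rewrite mulrA -expr2 real_normK ?num_real//; ring.
rewrite (ibp _ _ du cu' uC u'C) mulrN (ibp _ _ du' cu'' u'C u''C) opprK.
have -> : 4 * pi * C = 2 * (C * pi) + 2 * (C * pi) by ring.
exact: lerD.
Qed.

End complex_line.

(** * Primitives and the value of the Fresnel integral *)

Section antiderivative.
Variable R : realType.

Lemma is_derive_add (f g : R -> R) (x a b : R) : is_derive x (1 : R) f a ->
  is_derive x (1 : R) g b -> is_derive x (1 : R) (fun y => f y + g y) (a + b).
Proof. by move=> fa gb; exact: (is_deriveD fa gb). Qed.

Lemma is_derive_sub (f g : R -> R) (x a b : R) : is_derive x (1 : R) f a ->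
  is_derive x (1 : R) g b -> is_derive x (1 : R) (fun y => f y - g y) (a - b).
Proof. by move=> fa gb; exact: (is_deriveB fa gb). Qed.

Lemma is_derive_inv (f : R -> R) (x a : R) : f x != 0 -> is_derive x (1 : R) f a ->
  is_derive x (1 : R) (fun y => (f y)^-1) (- (f x) ^- 2 * a).
Proof. by move=> f0 fa; exact: (is_deriveV f0 fa). Qed.

Lemma ge0_is_derive_le (F f : R -> R) (a b : R) : a <= b ->
  (forall x, x \in `[a, b] -> is_derive x (1 : R) F (f x)) ->
  (forall x, x \in `[a, b] -> 0 <= f x) -> F a <= F b.
Proof.
move=> ab d f0; apply: (@ger0_derive1_le_cc R F a b).
- by move=> x /subset_itv_oo_cc/d dx; exact: ex_derive.
- move=> x /subset_itv_oo_cc xab; have dx := d _ xab.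
  by rewrite derive1E derive_val; exact: f0.
- by apply: derivable_within_continuous => x /d dx; exact: ex_derive.
- by rewrite in_itv/= lexx.
- by rewrite in_itv/= lexx andbT.
- by [].
Qed.

Lemma is_derive_const (c x : R) : is_derive x (1 : R) (fun=> c) 0.
Proof. exact: is_derive_cst. Qed.

Lemma continuous_compR (f g : R -> R) : continuous f -> continuous g ->
  continuous (fun x => g (f x)).
Proof. by move=> cf cg x; exact: (continuous_comp (cf x) (cg (f x))). Qed.

Lemma continuousMR (f g : R -> R) : continuous f -> continuous g ->
  continuous (fun x => f x * g x).
Proof. by move=> cf cg x; apply: cvgM; [exact: cf|exact: cg]. Qed.

Notation mu := (@lebesgue_measure R).

(** The base point - N must lie to the left of the argument; subtracting the integral up to 0 makes
    [G N x] independent of the admissible N. The global formula takes N = |x| + 1, and near a given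
    x it agrees with the fixed choice |x| + 2, which can be differentiated. *)
Lemma exists_antiderivative (f : R -> R) : continuous f ->
  exists F : R -> R, F 0 = 0 /\ forall x, is_derive x (1 : R) F (f x).
Proof.
move=> cf; have ifi a b := @continuous_integrable_itv R f a b cf.
pose G N x := Rintegral mu `[- N, x] f - Rintegral mu `[- N, 0] f.
have GE N N' x : N <= N' -> 0 <= N -> - N <= x -> G N x = G N' x.
  move=> NN' N0 Nx.
  have E y : - N <= y -> Rintegral mu `[- N, y] f =
      Rintegral mu `[- N', y] f - Rintegral mu `[- N', - N] f.
    move=> Ny; rewrite Rintegral_itvB ?bnd_simp//; last by rewrite lerN2.
    by rewrite -Rintegral_itv_obnd_cbnd//; apply: integrableS (ifi (- N) y) => //;
      apply: subset_itvr; rewrite bnd_simp.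
  by rewrite /G !E// ?oppr_le0//; ring.
exists (fun x => G (`|x| + 1) x); split; first by rewrite /G normr0 subrr.
move=> x; apply: (@near_eq_is_derive _ _ _ (G (`|x| + 2))); last first.
  have [] := @continuous_FTC1_closed R f (- (`|x| + 2)) x (x + 1) _ (ifi _ _) _ (cf x).
  - by rewrite ltrDl.
  - by have := ler_norm (- x); rewrite normrN; lra.
  move=> dI dIE; rewrite /G -[f x]subr0; apply: is_deriveB.
  rewrite derive1E in dIE; exact: (DeriveDef dI dIE).
near=> y.
have yx : `|y| <= `|x| + 1.
  have : `|y - x| < 1.
    by rewrite distrC; near: y; apply/nbhs_ballP; exists 1 => /=.
  by have := ler_distD x y 0; rewrite !subr0; lra.
apply/esym/GE; [lra|by rewrite addr_ge0|].
by have := ler_norm (- y); rewrite normrN; lra.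
Unshelve. all: by end_near. Qed.

(** For h = cos and h = sin, the parts of the oscillatory analogue of the auxiliary integral of
    exp(- X^2 (1 + t^2)) / (1 + t^2), a classical device for the Gaussian integral. *)
Definition cossin_integral (h : R -> R) (X : R) : R :=
  Rintegral mu `[0, 1] (fun t => h (X ^+ 2 * (1 + t ^+ 2)) * kern t).

Lemma continuous_sqr_affine (X : R) : continuous (fun t : R => X ^+ 2 * (1 + t ^+ 2)).
Proof.
move=> t; apply: cvgM; first exact: cvg_cst.
by apply: cvgD; [exact: cvg_cst|exact: exprn_continuous].
Qed.

(** Differentiation in X produces a factor 1 + t^2 that cancels the kernel. On the interval ]X - 1,
    X + 1[ this leaves the constant majorant 2 (|X| + 1). *)
Lemma is_derive_cossin_integral (h h' : R -> R) (X : R) :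
  (forall x, is_derive x (1 : R) h (h' x)) -> continuous h' ->
  (forall x, `|h' x| <= 1) ->
  is_derive X (1 : R) (cossin_integral h)
    (Rintegral mu `[0, 1] (fun t => 2 * X * h' (X ^+ 2 * (1 + t ^+ 2)))).
Proof.
move=> dh ch' h'1; have ch := is_derive_continuous dh.
pose f (X t : R) := h (X ^+ 2 * (1 + t ^+ 2)) * kern t.
have df (Y t : R) : is_derive Y (1 : R) (f ^~ t) (2 * Y * h' (Y ^+ 2 * (1 + t ^+ 2))).
  have d1 := is_derive_mul (is_derive_sqr Y) (is_derive_cst (1 + t ^+ 2) Y 1).
  have d2 := is_derive_mul (is_derive_chain (g := fun Y => Y ^+ 2 * (1 + t ^+ 2))
    (dh _) d1) (is_derive_cst (kern t) Y 1).
  apply: (is_derive_eq d2); rewrite /kern /cst.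
  by field; rewrite gt_eqF// kern_den_gt0.
have d1E : forall Y t : R, partial1of2 f Y t = 2 * Y * h' (Y ^+ 2 * (1 + t ^+ 2)).
  by move=> Y t; rewrite partial1of2E; have [] := df Y t.
have int Y : mu.-integrable `[0, 1] (EFin \o f Y).
  apply: continuous_integrable_itv; apply: continuousMR; last exact: continuous_kern.
  exact: (continuous_compR (@continuous_sqr_affine Y) ch).
have XI : `](X - 1), (X + 1)[%classic X by rewrite /= in_itv/= ltrBlDr !ltrDl ltr01.
have h1 : forall x y : R, `](X - 1), (X + 1)[%classic x -> `[0, 1]%classic y ->
    derivable (f^~ y) x 1 by move=> Y t _ _; exact: ex_derive.
have h2 : forall x y : R, `](X - 1), (X + 1)[%classic x -> `[0, 1]%classic y ->
    `|partial1of2 f x y| <= 2 * (`|X| + 1).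
  move=> Y t; rewrite /= in_itv/= => /andP[Y1 Y2] _; rewrite d1E !normrM.
  rewrite (ger0_norm (ler0n R 2)) -mulrA ler_pM2l// -[leRHS]mulr1.
  apply: ler_pM => //.
  by rewrite ler_norml; have := ler_norm X; have := ler_norm (- X); rewrite normrN; lra.
have ic : mu.-integrable `[0, 1] (EFin \o (fun=> 2 * (`|X| + 1))).
  by apply: continuous_integrable_itv => t; exact: cvg_cst.
have G0 : forall y : R, 0 <= 2 * (`|X| + 1) by move=> _; rewrite mulr_ge0// addr_ge0.
have d := @derivable_under_integral R _ _ mu f _ (measurable_itv `[0, 1]) X _ _ XI (fun Y _ => int Y) h1 _ G0 ic h2.
have e := @differentiation_under_integral R _ _ mu f _ (measurable_itv `[0, 1]) X _ _ XI (fun Y _ => int Y) h1 _ G0 ic h2.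
apply: DeriveDef; first exact: d.
rewrite -derive1E [LHS]e; apply: eq_Rintegral => t _; exact: d1E.
Qed.

End antiderivative.

(* With Z := C + i S, the derivative of Z ^ 2 is that of i (pi / 4 - H), where
   H(X) is the integral of expi (X ^ 2 (1 + t ^ 2)) / (1 + t ^ 2) over [0, 1]
   and has real and imaginary parts H1 and H2. An integration by parts in t
   shows H = O(1 / X), so Z ^ 2 tends to i pi / 4; the sign of the limit of Z
   is fixed by S >= 0. *)
Section fresnel_constant.
Variable R : realType.
Notation mu := (@lebesgue_measure R).
Variables C S : R -> R.
Hypothesis C0 : C 0 = 0.
Hypothesis S0 : S 0 = 0.
Hypothesis dC : forall x : R, is_derive x (1 : R) C (cos (x ^+ 2)).
Hypothesis dS : forall x : R, is_derive x (1 : R) S (sin (x ^+ 2)).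
Notation H1 := (cossin_integral (@cos R)).
Notation H2 := (cossin_integral (@sin R)).

Let continuous_sqrM (X : R) : continuous (fun t : R => (X * t) ^+ 2).
Proof.
apply: (@continuous_compR R (fun t => X * t) (fun t => t ^+ 2)).
  by move=> t; apply: cvgM; [exact: cvg_cst|exact: cvg_id].
exact: exprn_continuous.
Qed.

Let dM (X t : R) : is_derive t (1 : R) (fun t => X * t) X.
Proof. by have := is_derive_affine X 0 t; under eq_fun do rewrite addr0. Qed.

Let ccosM X : continuous (fun t : R => X * cos ((X * t) ^+ 2)).
Proof.
apply: continuousMR; first by move=> t; exact: cvg_cst.
exact: (continuous_compR (@continuous_sqrM X) (@continuous_cos R)).
Qed.

Let csinM X : continuous (fun t : R => X * sin ((X * t) ^+ 2)).
Proof.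
apply: continuousMR; first by move=> t; exact: cvg_cst.
exact: (continuous_compR (@continuous_sqrM X) (@continuous_sin R)).
Qed.

(** The substitution s = X t, carried out as the fundamental theorem for C(X t). *)
Let intC X : Rintegral mu `[0, 1] (fun t => X * cos ((X * t) ^+ 2)) = C X.
Proof.
have dF t : is_derive t (1 : R) (fun t => C (X * t)) (X * cos ((X * t) ^+ 2)).
  have := is_derive_chain (g := fun t => X * t) (dC _) (dM X t).
  by rewrite mulrC.
by rewrite (ftc_itv ler01 dF (@ccosM X)) mulr0 C0 subr0 mulr1.
Qed.

Let intS X : Rintegral mu `[0, 1] (fun t => X * sin ((X * t) ^+ 2)) = S X.
Proof.
have dF t : is_derive t (1 : R) (fun t => S (X * t)) (X * sin ((X * t) ^+ 2)).
  have := is_derive_chain (g := fun t => X * t) (dS _) (dM X t).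
  by rewrite mulrC.
by rewrite (ftc_itv ler01 dF (@csinM X)) mulr0 S0 subr0 mulr1.
Qed.

Let icos X : mu.-integrable `[0, 1] (EFin \o (fun t => X * cos ((X * t) ^+ 2))).
Proof.
exact: continuous_integrable_itv.
Qed.

Let isin X : mu.-integrable `[0, 1] (EFin \o (fun t => X * sin ((X * t) ^+ 2))).
Proof.
exact: continuous_integrable_itv.
Qed.

(** Since X^2 (1 + t^2) = X^2 + (X t)^2, the addition formula separates the factors in X^2 from the
    integrals over t, which are C and S. *)
Lemma is_derive_H1 X : is_derive X (1 : R) H1
  (- (2 * (sin (X ^+ 2) * C X + cos (X ^+ 2) * S X))).
Proof.
have := is_derive_cossin_integral (h := cos) (h' := fun x => - sin x) X.
move=> /(_ _ _ _)/is_derive_eq; apply.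
- by move=> x; apply: cvgN; exact: continuous_sin.
- by move=> x; rewrite normrN ler_norml sin_geN1 sin_le1.
rewrite -intC -intS -!RintegralZl// -RintegralD//; last 2 first.
  exact: (integrableZl _ (sin (X ^+ 2)) (icos X)).
  exact: (integrableZl _ (cos (X ^+ 2)) (isin X)).
rewrite -RintegralZl//; last first.
  apply: (integrableD _ (integrableZl _ (sin (X ^+ 2)) (icos X))
    (integrableZl _ (cos (X ^+ 2)) (isin X))) => //.
rewrite -mulN1r -RintegralZl//; last first.
  apply: (integrableZl _ 2 (integrableD _ (integrableZl _ (sin (X ^+ 2)) (icos X))
    (integrableZl _ (cos (X ^+ 2)) (isin X)))) => //.
apply: eq_Rintegral => t _.
by rewrite mulrDr mulr1 -exprMn sinD; ring.
Qed.

Lemma is_derive_H2 X : is_derive X (1 : R) H2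
  (2 * (cos (X ^+ 2) * C X - sin (X ^+ 2) * S X)).
Proof.
have := is_derive_cossin_integral (h := sin) (h' := cos) X.
move=> /(_ _ _ _)/is_derive_eq; apply.
- by move=> x; exact: continuous_cos.
- by move=> x; rewrite ler_norml cos_geN1 cos_le1.
rewrite -intC -intS -!RintegralZl// -RintegralB//; last 2 first.
  exact: (integrableZl _ (cos (X ^+ 2)) (icos X)).
  exact: (integrableZl _ (sin (X ^+ 2)) (isin X)).
rewrite -RintegralZl//; last first.
  apply: (integrableB _ (integrableZl _ (cos (X ^+ 2)) (icos X))
    (integrableZl _ (sin (X ^+ 2)) (isin X))) => //.
apply: eq_Rintegral => t _.
by rewrite mulrDr mulr1 -exprMn cosD; ring.
Qed.

Lemma fresnel_CS X : 2 * (C X * S X) = pi / 4 - H1 X.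
Proof.
have : 2 * (C X * S X) + H1 X = 2 * (C 0 * S 0) + H1 0.
  apply: (is_derive_0_is_cst (f := fun X => 2 * (C X * S X) + H1 X)) => x.
  apply: (is_derive_eq (is_derive_add (is_derive_mul (is_derive_const 2 x)
    (is_derive_mul (dC x) (dS x))) (is_derive_H1 x))).
  by ring.
(* At X = 0 the integrand is the kernel, so the constant of integration is atan 1 = pi / 4. *)
have -> : H1 0 = pi / 4.
  have := ftc_itv ler01 (@is_derive1_atan R) (@continuous_kern R).
  rewrite atan1 atan0 subr0 => <-.
  by apply: eq_Rintegral => t _; rewrite expr0n mul0r cos0 mul1r.
by rewrite C0 mul0r mulr0 add0r => <-; rewrite addrK.
Qed.

Lemma fresnel_CC X : C X ^+ 2 - S X ^+ 2 = H2 X.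
Proof.
have : C X ^+ 2 - S X ^+ 2 - H2 X = C 0 ^+ 2 - S 0 ^+ 2 - H2 0.
  apply: (is_derive_0_is_cst (f := fun X => C X ^+ 2 - S X ^+ 2 - H2 X)) => x.
  apply: (is_derive_eq (is_derive_sub (is_derive_sub
    (is_derive_chain (f := fun y => y ^+ 2) (is_derive_sqr _) (dC x))
    (is_derive_chain (f := fun y => y ^+ 2) (is_derive_sqr _) (dS x))) (is_derive_H2 x))).
  by ring.
have -> : H2 0 = 0.
  rewrite /cossin_integral -[RHS](@Rintegral_set0 _ _ R mu (fun=> 0)).
  rewrite Rintegral_mkcond [RHS]Rintegral_mkcond; apply: eq_Rintegral => t _.
  by rewrite !patchE expr0n mul0r sin0 mul0r !if_same.
by rewrite C0 S0 expr0n subrr subr0 => /eqP; rewrite subr_eq0 => /eqP.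
Qed.

Lemma integral_kern01_le (f : R -> R) : continuous f -> (forall x, `|f x| <= 1) ->
  `|Rintegral mu `[0, 1] f| <= 1.
Proof.
move=> cf f1; apply: le_trans (le_normr_Rintegral _ _) _ => //.
  exact: continuous_integrable_itv.
apply: (@le_trans _ _ (Rintegral mu `[0, 1] (fun=> 1))).
  apply: le_Rintegral => //.
    by apply: integrable_norm => //; exact: continuous_integrable_itv.
  by apply: continuous_integrable_itv => t; exact: cvg_cst.
by rewrite Rintegral_cst//= lebesgue_measure_itv/= lte_fin ltr01 oppr0 adde0 mul1r.
Qed.

(** The two identities control Z^2 for Z = C + i S: (C^2 + S^2)^2 = (C^2 - S^2)^2 + (2 C S)^2 is at
    most 1 + 4, hence below 4^2. The crude bound must come before the decay of H1 and H2, whose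
    proof integrates by parts against C and S. *)
Lemma fresnel_bounded X : `|C X| <= 2 /\ `|S X| <= 2.
Proof.
have bH (h : R -> R) : continuous h -> (forall x, `|h x| <= 1) ->
    `|cossin_integral h X| <= 1.
  move=> ch h1; apply: integral_kern01_le.
    apply: continuousMR; last exact: continuous_kern.
    exact: (continuous_compR (@continuous_sqr_affine R X) ch).
  move=> t; rewrite normrM (ger0_norm (kern_ge0 _)).
  by apply: mulr_ile1 => //; [exact: kern_ge0|exact: kern_le1].
have b1 : `|H1 X| <= 1.
  by apply: bH; [exact: continuous_cos|move=> x; rewrite ler_norml cos_geN1 cos_le1].
have b2 : `|H2 X| <= 1.
  by apply: bH; [exact: continuous_sin|move=> x; rewrite ler_norml sin_geN1 sin_le1].
have p4 : pi / 4 <= 1 :> R.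
  have [/andP[_ h] _] := @pihalf_02_cos_pihalf R; lra.
have p0 : 0 <= pi / 4 :> R by rewrite divr_ge0// pi_ge0.
have e1 := fresnel_CS X; have e2 := fresnel_CC X.
move: b1 b2; rewrite !ler_norml => /andP[b11 b12] /andP[b21 b22].
have c2 := sqr_ge0 (C X); have s2 := sqr_ge0 (S X).
have e3 : (C X ^+ 2 + S X ^+ 2) ^+ 2 = (C X ^+ 2 - S X ^+ 2) ^+ 2 + (2 * (C X * S X)) ^+ 2.
  by ring.
have h1 : (C X ^+ 2 + S X ^+ 2) ^+ 2 <= 4 ^+ 2.
  rewrite e3 e1 e2.
  have : H2 X ^+ 2 <= 1 by nra.
  have : (pi / 4 - H1 X) ^+ 2 <= 4.
    by move: (pi / 4 : R) p0 p4 => p p0 p4; nra.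
  lra.
have h2 : C X ^+ 2 + S X ^+ 2 <= 4.
  by rewrite -(ler_pXn2r (ltn0Sn 1)) ?nnegrE ?addr_ge0.
by split; apply/andP; split; nra.
Qed.

Lemma fresnelN X : C (- X) = - C X /\ S (- X) = - S X.
Proof.
have N (F f : R -> R) : F 0 = 0 -> (forall x, is_derive x (1 : R) F (f (x ^+ 2))) ->
    F (- X) = - F X.
  move=> F0 dF; apply/eqP; rewrite -addr_eq0; apply/eqP.
  have : F (- X) + F X = F (- 0) + F 0.
    apply: (is_derive_0_is_cst (f := fun x => F (- x) + F x)) => x.
    have dN : is_derive x (1 : R) (fun y : R => - y) (-1).
      by have := is_derive_affine (-1) 0 x; under eq_fun do rewrite addr0 mulN1r.
    apply: (is_derive_eq (is_derive_add (is_derive_chain (g := fun y => - y) (dF _) dN) (dF x))).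
    by rewrite sqrrN; ring.
  by rewrite oppr0 F0 addr0.
by split; [exact: (N C cos C0 dC)|exact: (N S sin S0 dS)].
Qed.

(** The difference is the integral of 2 x (1 - sin x^2) from 0 to t. It is used at small t, to make
    the boundary term (1 - cos t^2) / (2 t) small. *)
Lemma oneBcos_sqr_le (t : R) : 0 <= t -> 1 - cos (t ^+ 2) <= t ^+ 2.
Proof.
move=> t0; rewrite -subr_ge0.
pose F (x : R) := x ^+ 2 - (1 - cos (x ^+ 2)).
have dF (x : R) : is_derive x (1 : R) F (2 * x * (1 - sin (x ^+ 2))).
  apply: (is_derive_eq (is_derive_sub (is_derive_sqr x) (is_derive_sub (is_derive_const 1 x)
    (is_derive_chain (g := fun x => x ^+ 2) (is_derive_cos _) (is_derive_sqr x))))).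
  by ring.
have cf : continuous (fun x : R => 2 * x * (1 - sin (x ^+ 2))).
  apply: continuousMR.
    by move=> x; apply: cvgM; [exact: cvg_cst|exact: cvg_id].
  move=> x; apply: cvgB; first exact: cvg_cst.
  exact: (continuous_compR (f := fun x : R => x ^+ 2) (@exprn_continuous R 2) (@continuous_sin R)).
have := ftc_itv t0 dF cf.
rewrite {2}/F expr0n cos0 subrr subr0 subr0 -/(F t) => <-.
apply: Rintegral_ge0 => x; rewrite /= in_itv/= => /andP[x0 _].
by rewrite !mulr_ge0// subr_ge0 sin_le1.
Qed.

(** On [0, 1] the integrand sin x^2 is nonnegative. Beyond, integration by parts with the primitive
    1 - cos x^2 shows that P(t) = S(t) - (1 - cos t^2) / (2 t) is nondecreasing, so S(X) >= P(X) >=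
    P(t) >= - t / 2 for every small t > 0. *)
Lemma fresnel_S_ge0 X : 0 <= X -> 0 <= S X.
Proof.
rewrite le_eqVlt => /predU1P[<-|X0]; first by rewrite S0.
have csin2 : continuous (fun x : R => sin (x ^+ 2)).
  exact: (continuous_compR (f := fun x : R => x ^+ 2) (@exprn_continuous R 2) (@continuous_sin R)).
have S01 t : 0 <= t -> t <= 1 -> 0 <= S t.
  move=> t0 t1; have := ftc_itv t0 dS csin2; rewrite S0 subr0 => <-.
  apply: Rintegral_ge0 => x; rewrite /= in_itv/= => /andP[x0 xt].
  apply: sin_ge0_pi; rewrite sqr_ge0/=.
  have x1 : x ^+ 2 <= 1 by rewrite expr_le1// (le_trans xt).
  by apply: le_trans x1 _; have [] := @pihalf_02_cos_pihalf R; have := @pi_ge2 R; lra.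
pose P (t : R) := S t - (1 - cos (t ^+ 2)) * (2 * t)^-1.
pose P' (t : R) := (1 - cos (t ^+ 2)) * (2 * t ^+ 2)^-1.
have dP (t : R) : 0 < t -> is_derive t (1 : R) P (P' t).
  move=> t0; have t20 : 2 * t != 0 by rewrite mulf_neq0// gt_eqF.
  have d2 : is_derive t (1 : R) (fun t => (2 * t)^-1) (- (2 * t) ^- 2 * 2).
    have d0 : is_derive t (1 : R) (fun t => 2 * t) 2.
      by have := is_derive_affine 2 0 t; under eq_fun do rewrite addr0.
    exact: (is_derive_inv (f := fun t => 2 * t) t20 d0).
  apply: (is_derive_eq (is_derive_sub (dS t) (is_derive_mul (is_derive_sub (is_derive_const 1 t)
    (is_derive_chain (g := fun x => x ^+ 2) (is_derive_cos _) (is_derive_sqr t))) d2))).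
  by rewrite /P'; field; rewrite gt_eqF.
have P'0 t : 0 <= P' t.
  by rewrite /P' mulr_ge0 ?subr_ge0 ?cos_le1// invr_ge0 mulr_ge0// sqr_ge0.
have PX t : 0 < t -> t <= 1 -> t <= X -> - t / 2 <= S X.
  move=> t0 t1 tX.
  have d (x : R) : x \in `[t, X] -> is_derive x (1 : R) P (P' x).
    by rewrite in_itv/= => /andP[tx _]; apply: dP; exact: lt_le_trans tx.
  have PtX : P t <= P X.
    exact: (ge0_is_derive_le tX d).
  apply: (@le_trans _ _ (P t)).
    rewrite /P; have h := S01 t (ltW t0) t1; have c := oneBcos_sqr_le (ltW t0).
    have : (1 - cos (t ^+ 2)) / (2 * t) <= t / 2.
      by rewrite ler_pdivrMr ?mulr_gt0//; apply: le_trans c _; rewrite le_eqVlt; apply/orP; left; apply/eqP; field.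
    lra.
  apply: le_trans PtX _; rewrite /P lerBlDr lerDl mulr_ge0 ?subr_ge0 ?cos_le1// invr_ge0.
  by rewrite mulr_ge0// ltW.
rewrite leNgt; apply/negP => SX.
(* With t <= - S(X), the bound S(X) >= - t / 2 gives S(X) >= S(X) / 2, impossible for a negative
   number. *)
pose t := Num.min (Num.min 1 X) (- S X).
have t0 : 0 < t by rewrite /t !lt_min ltr01 X0 oppr_gt0.
have := PX t t0; rewrite /t !ge_min lexx/= => /(_ isT); rewrite lexx orbT/= => /(_ isT).
have : Num.min (Num.min 1 X) (- S X) <= - S X by rewrite ge_min lexx orbT.
lra.
Qed.

(** Let A and B be the integrals of cos (X t)^2 and sin (X t)^2 against the kernel. By parts, X
    times either one is Z(X) / 2 minus the integral of Z(X t) kern'(t), with Z = C or S, hence at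
    most 1 + 2 = 3 since |Z| <= 2 and |kern'| <= 1. The addition formula writes H1 and H2 as sums of
    two such terms, whence 6. *)
Lemma cossin_bound X : 0 < X -> `|H1 X| <= 6 / X /\ `|H2 X| <= 6 / X.
Proof.
move=> X0.
pose dk (t : R) := - (2 * t) * kern t ^+ 2.
have dkern t : is_derive t (1 : R) (@kern R) (dk t).
  apply: (is_derive_eq (is_derive_inv (f := fun t => 1 + t ^+ 2) _ (is_derive_add (is_derive_const 1 t) (is_derive_sqr t)))).
    by rewrite gt_eqF// kern_den_gt0.
  by rewrite /dk /kern -exprVn; ring.
have cdk : continuous dk.
  apply: continuousMR; last exact: (continuousMR (@continuous_kern R) (@continuous_kern R)).
  by move=> t; apply: cvgN; apply: cvgM; [exact: cvg_cst|exact: cvg_id].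
have dk1 t : `|dk t| <= 1.
  rewrite normrM normrN normrX (ger0_norm (kern_ge0 t)) expr2 mulrA.
  apply: mulr_ile1; [by rewrite mulr_ge0// kern_ge0|exact: kern_ge0| |exact: kern_le1].
  rewrite /kern ler_pdivrMr ?kern_den_gt0// mul1r ler_norml.
  by have := sqr_ge0 (t - 1); have := sqr_ge0 (t + 1); nra.
have key (h Z : R -> R) : Z 0 = 0 -> (forall x, is_derive x (1 : R) Z (h (x ^+ 2))) ->
    continuous h -> (forall x, `|Z x| <= 2) ->
    `|Rintegral mu `[0, 1] (fun t => h ((X * t) ^+ 2) * kern t)| <= 3 / X.
  move=> Z0 dZ ch Z2.
  have cZ := is_derive_continuous dZ.
  have cM : continuous (fun t : R => X * t).
    by move=> t; apply: cvgM; [exact: cvg_cst|exact: cvg_id].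
  have c1 : continuous (fun t : R => h ((X * t) ^+ 2) * kern t).
    apply: continuousMR; last exact: continuous_kern.
    exact: (continuous_compR (@continuous_sqrM X) ch).
  have c2 : continuous (fun t : R => Z (X * t) * dk t).
    by apply: continuousMR => //; exact: continuous_compR.
  have c3 : continuous (fun t : R => Z (X * t) / 2 * dk t).
    have -> : (fun t : R => Z (X * t) / 2 * dk t) = (fun t => Z (X * t) * dk t * 2^-1).
      by apply/funext => t; ring.
    by apply: continuousMR => // t; exact: cvg_cst.
  have dF t : is_derive t (1 : R) (fun t => Z (X * t) * kern t)
      (X * (h ((X * t) ^+ 2) * kern t) + Z (X * t) * dk t).
    apply: (is_derive_eq (is_derive_mul (is_derive_chain (g := fun t => X * t) (dZ _) (dM X t)) (dkern t))).
    by ring.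
  have := ftc_itv ler01 dF.
  rewrite mulr1 mulr0 Z0 mul0r subr0 => e.
  have {}e : X * Rintegral mu `[0, 1] (fun t => h ((X * t) ^+ 2) * kern t) =
      Z X * kern 1 - 2 * Rintegral mu `[0, 1] (fun t => Z (X * t) / 2 * dk t).
    have iA : mu.-integrable `[0, 1] (EFin \o (fun t => h ((X * t) ^+ 2) * kern t)).
      exact: continuous_integrable_itv.
    have iB : mu.-integrable `[0, 1] (EFin \o (fun t => Z (X * t) / 2 * dk t)).
      exact: continuous_integrable_itv.
    rewrite -e ?RintegralD//.
    - rewrite !RintegralZl//.
      have -> : Rintegral mu `[0, 1] (fun t => Z (X * t) * dk t) =
          2 * Rintegral mu `[0, 1] (fun t => Z (X * t) / 2 * dk t).
        by rewrite -RintegralZl//; apply: eq_Rintegral => t _; field.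
      by rewrite addrK.
    - exact: (integrableZl _ X iA).
    - exact: continuous_integrable_itv.
    - move=> t; apply: cvgD; last exact: c2.
      by apply: cvgM; [exact: cvg_cst|exact: c1].
  have i2 : `|Rintegral mu `[0, 1] (fun t => Z (X * t) / 2 * dk t)| <= 1.
    apply: integral_kern01_le => //.
    move=> t; rewrite normrM; apply: mulr_ile1 => //.
    by rewrite normrM (@ger0_norm _ 2^-1) // ler_pdivrMr// mul1r.
  rewrite ler_pdivlMr// -(ger0_norm (ltW X0)) -normrM mulrC (ger0_norm (ltW X0)) e.
  apply: le_trans (ler_normB _ _) _; rewrite !normrM (ger0_norm (ler0n R 2)).
  have k1 : kern 1 = 2^-1 :> R by rewrite /kern expr1n.
  rewrite k1 (@ger0_norm _ 2^-1)//; have := Z2 X; lra.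
have kc := key cos C C0 dC (@continuous_cos R) (fun x => (fresnel_bounded x).1).
have ks := key sin S S0 dS (@continuous_sin R) (fun x => (fresnel_bounded x).2).
have ic : mu.-integrable `[0, 1] (EFin \o (fun t => cos ((X * t) ^+ 2) * kern t)).
  apply: continuous_integrable_itv; apply: continuousMR; last exact: continuous_kern.
  exact: (continuous_compR (@continuous_sqrM X) (@continuous_cos R)).
have is_ : mu.-integrable `[0, 1] (EFin \o (fun t => sin ((X * t) ^+ 2) * kern t)).
  apply: continuous_integrable_itv; apply: continuousMR; last exact: continuous_kern.
  exact: (continuous_compR (@continuous_sqrM X) (@continuous_sin R)).
set A := Rintegral _ _ _ in kc; set B := Rintegral _ _ _ in ks.
have e1 : H1 X = cos (X ^+ 2) * A - sin (X ^+ 2) * B.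
  rewrite /A /B -!RintegralZl// -RintegralB//; last 2 first.
    exact: (integrableZl _ _ ic).
    exact: (integrableZl _ _ is_).
  by apply: eq_Rintegral => t _; rewrite mulrDr mulr1 -exprMn cosD; ring.
have e2 : H2 X = cos (X ^+ 2) * B + sin (X ^+ 2) * A.
  rewrite /A /B -!RintegralZl// -RintegralD//; last 2 first.
    exact: (integrableZl _ _ is_).
    exact: (integrableZl _ _ ic).
  by apply: eq_Rintegral => t _; rewrite mulrDr mulr1 -exprMn sinD; ring.
have c1 : `|cos (X ^+ 2)| <= 1 by rewrite ler_norml cos_geN1 cos_le1.
have s1 : `|sin (X ^+ 2)| <= 1 by rewrite ler_norml sin_geN1 sin_le1.
have M (a b : R) : `|a| <= 1 -> `|b| <= 3 / X -> `|a * b| <= 3 / X.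
  by move=> a1 b3; rewrite normrM -[leRHS]mul1r ler_pM.
have -> : 6 / X = 3 / X + 3 / X by rewrite -mulrDl; congr (_ / _); ring.
split.
  by rewrite e1; apply: le_trans (ler_normB _ _) _; apply: lerD; exact: M.
by rewrite e2; apply: le_trans (ler_normD _ _) _; apply: lerD; exact: M.
Qed.

(** From 2 C S -> pi / 4 and C^2 - S^2 -> 0 follows C^2 + S^2 -> pi / 4, hence S^2 -> pi / 8, and S
    >= 0 selects the root. *)
Lemma cvg_fresnel : C x @[x --> +oo] --> Num.sqrt (pi / 8) /\
  S x @[x --> +oo] --> Num.sqrt (pi / 8).
Proof.
have H0 (H : R -> R) : (forall X, 0 < X -> `|H X| <= 6 / X) -> H x @[x --> +oo] --> (0 : R).
  move=> HX; apply/cvgrPdist_le => e e0; near=> x.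
  have x0 : 0 < x by near: x; apply: nbhs_pinfty_gt; rewrite num_real.
  rewrite sub0r normrN; apply: le_trans (HX _ x0) _.
  by rewrite ler_pdivrMr// mulrC -ler_pdivrMr.
have h1 : H1 x @[x --> +oo] --> (0 : R) by apply: H0 => X X0; exact: (cossin_bound X0).1.
have h2 : H2 x @[x --> +oo] --> (0 : R) by apply: H0 => X X0; exact: (cossin_bound X0).2.
have p4 : 0 <= pi / 4 :> R by rewrite divr_ge0// pi_ge0.
have cCS : 2 * (C x * S x) @[x --> +oo] --> (pi / 4 : R).
  have : pi / 4 - H1 x @[x --> +oo] --> (pi / 4 - 0 : R).
    by apply: cvgB => //; exact: cvg_cst.
  by rewrite subr0; apply: cvg_trans; apply: near_eq_cvg; apply: nearW => x; rewrite fresnel_CS.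
have cS2 : (C x ^+ 2 + S x ^+ 2) @[x --> +oo] --> (pi / 4 : R).
  have -> : (fun x => C x ^+ 2 + S x ^+ 2) =
      (fun x => Num.sqrt (H2 x ^+ 2 + (2 * (C x * S x)) ^+ 2)).
    apply/funext => x; rewrite -fresnel_CC -[LHS]ger0_norm ?addr_ge0 ?sqr_ge0//.
    by rewrite -sqrtr_sqr; congr Num.sqrt; ring.
  rewrite (_ : pi / 4 = Num.sqrt (0 ^+ 2 + (pi / 4) ^+ 2)); last first.
    by rewrite expr0n add0r sqrtr_sqr ger0_norm.
  exact: (cvg_comp _ _ (cvgD (cvgM h2 h2) (cvgM cCS cCS)) (@sqrt_continuous R _)).
have cS : S x @[x --> +oo] --> Num.sqrt (pi / 8).
  have : Num.sqrt ((C x ^+ 2 + S x ^+ 2 - H2 x) / 2) @[x --> +oo] --> Num.sqrt ((pi / 4 - 0) / 2).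
    have cq : (C x ^+ 2 + S x ^+ 2 - H2 x) / 2 @[x --> +oo] --> ((pi / 4 - 0) / 2 : R).
      by apply: cvgM; [exact: cvgB|exact: cvg_cst].
    exact: (cvg_comp _ _ cq (@sqrt_continuous R _)).
  rewrite subr0 (_ : pi / 4 / 2 = pi / 8 :> R); last by field.
  apply: cvg_trans; apply: near_eq_cvg; near=> x.
  rewrite -fresnel_CC (_ : _ / 2 = S x ^+ 2); last by field.
  rewrite sqrtr_sqr ger0_norm//; apply: fresnel_S_ge0.
  by near: x; apply: nbhs_pinfty_ge; rewrite num_real.
split => //.
have s0 : 0 < Num.sqrt (pi / 8) :> R by rewrite sqrtr_gt0 divr_gt0// pi_gt0.
have sS : \forall x \near +oo, 0 < S x.
  by move/cvgr_gt : cS; apply.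
(* Dividing 2 C S by 2 S recovers C together with its sign. *)
have : (2 * (C x * S x)) * (2 * S x)^-1 @[x --> +oo] --> pi / 4 / (2 * Num.sqrt (pi / 8)).
  apply: cvgM => //; apply: cvgV; first by rewrite mulf_neq0// gt_eqF.
  by apply: cvgM => //; exact: cvg_cst.
rewrite (_ : pi / 4 / (2 * Num.sqrt (pi / 8)) = Num.sqrt (pi / 8)); last first.
  apply: (@mulIf _ (2 * Num.sqrt (pi / 8))); first by rewrite mulf_neq0// gt_eqF.
  rewrite mulfVK ?mulf_neq0// ?gt_eqF// mulrCA -expr2 sqr_sqrtr ?divr_ge0 ?pi_ge0//.
  by field.
apply: cvg_trans; apply: near_eq_cvg; near=> x.
have Sx : S x != 0 by rewrite gt_eqF//; near: x.
by field.
Unshelve. all: by end_near. Qed.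

End fresnel_constant.

Section fresnel_sigmoid.
Variable R : realType.

Lemma expi_Npiquarter :
  expi (- (pi / 4)) = (Num.sqrt 2^-1) +i* (- Num.sqrt 2^-1) :> R[i].
Proof.
have h4 : - ((pi : R) / 2) < (pi : R) / 4 < (pi : R) / 2.
  by have := @pi_gt0 R; move=> p; apply/andP; split; lra.
have c0 : 0 < cos (pi / 4) :> R by apply: cos_gt0_pihalf.
have sc : sin (pi / 4) = cos (pi / 4) :> R.
  have := @tan_piquarter R; rewrite /tan => /(congr1 (fun x => x * cos (pi / 4))).
  by rewrite mul1r divfK// gt_eqF.
have c2 : cos (pi / 4) = Num.sqrt 2^-1 :> R.
  have := cos2Dsin2 (pi / 4 : R); rewrite sc => h.
  have -> : 2^-1 = cos (pi / 4) ^+ 2 :> R by lra.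
  by rewrite sqrtr_sqr ger0_norm// ltW.
by rewrite /expi cosN sinN sc c2.
Qed.

(** The reciprocal of the integral of exp(i y^2) over R. *)
Definition fresnel_unit : R[i] := (Num.sqrt pi)^-1%:C * expi (- (pi / 4)).

(* E is a rescaled Fresnel integral with limits 0 at -oo and 1 at +oo. *)
Lemma exists_fresnel_sigmoid : exists (E : R -> R[i]) (B : R),
  [/\ cderive E (fun y => fresnel_unit * expi (y ^+ 2)),
      forall y, cabs (E y) <= B &
      forall d, 0 < d -> exists2 X, 0 < X &
        forall y, X <= `|y| -> cabs (E y - heaviside y) <= d].
Proof.
have cc : continuous (fun x : R => cos (x ^+ 2)).
  exact: (continuous_compR (f := fun x : R => x ^+ 2) (@exprn_continuous R 2) (@continuous_cos R)).
have cs : continuous (fun x : R => sin (x ^+ 2)).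
  exact: (continuous_compR (f := fun x : R => x ^+ 2) (@exprn_continuous R 2) (@continuous_sin R)).
have [C [C0 dC]] := exists_antiderivative cc.
have [S [S0 dS]] := exists_antiderivative cs.
have [limC limS] := cvg_fresnel C0 S0 dC dS.
pose Z y := C y +i* S y.
(* Z vanishes at 0 and is odd, so the normalized Z has limits -1/2 and 1/2; adding 1/2 gives E(- y)
   = 1 - E(y), and the limit at +oo yields the one at -oo. *)
pose E y := fresnel_unit * Z y + (2^-1)%:C.
have sp0 : 0 < Num.sqrt pi :> R by rewrite sqrtr_gt0 pi_gt0.
have EN y : E (- y) = 1 - E y.
  have [CN SN] := fresnelN C0 S0 dC dS y.
  have ZN : Z (- y) = - Z y by rewrite /Z CN SN.
  rewrite /E ZN.
  have h2 : (2^-1)%:C = 1 - (2^-1)%:C :> R[i].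
    by apply: complex_ext => /=; [field|rewrite subr0].
  by rewrite {1}h2; ring.
have EZ : E y @[y --> +oo] --> (1 : R[i]).
  have p2 : Num.sqrt 2^-1 * (Num.sqrt (pi / 8) + Num.sqrt (pi / 8)) / Num.sqrt pi = 2^-1 :> R.
    have -> : Num.sqrt (pi / 8) = Num.sqrt pi * (Num.sqrt 2^-1 / 2) :> R.
      have -> : pi / 8 = pi * (2^-1 * (2^-1) ^+ 2) :> R by field.
      by rewrite sqrtrM ?pi_ge0// sqrtrM// sqrtr_sqr ger0_norm.
    have -> : Num.sqrt 2^-1 * (Num.sqrt pi * (Num.sqrt 2^-1 / 2) + Num.sqrt pi * (Num.sqrt 2^-1 / 2)) / Num.sqrt pi
       = (Num.sqrt 2^-1) ^+ 2 :> R.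
      by field; rewrite gt_eqF.
    by rewrite sqr_sqrtr.
  apply/cvg_ReImP; split.
    have -> : (fun y => complex.Re (E y)) =
        (fun y => Num.sqrt 2^-1 * (C y + S y) / Num.sqrt pi + 2^-1).
      apply/funext => y; rewrite /E /fresnel_unit expi_Npiquarter /=.
      by ring.
    have -> : complex.Re 1 = Num.sqrt 2^-1 * (Num.sqrt (pi / 8) + Num.sqrt (pi / 8)) / Num.sqrt pi + 2^-1 :> R.
      by rewrite p2 /=; field.
    apply: cvgD; last exact: cvg_cst.
    apply: cvgM; last exact: cvg_cst.
    by apply: cvgM; [exact: cvg_cst|exact: cvgD].
  have -> : (fun y => complex.Im (E y)) =
      (fun y => Num.sqrt 2^-1 * (S y - C y) / Num.sqrt pi).
    apply/funext => y; rewrite /E /fresnel_unit expi_Npiquarter /=.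
    by ring.
  have -> : complex.Im 1 = Num.sqrt 2^-1 * (Num.sqrt (pi / 8) - Num.sqrt (pi / 8)) / Num.sqrt pi :> R.
    by rewrite subrr mulr0 mul0r.
  apply: cvgM; last exact: cvg_cst.
  by apply: cvgM; [exact: cvg_cst|exact: cvgB].
exists E, (cabs fresnel_unit * 4 + 1); split.
- have dZ : cderive Z (fun y => expi (y ^+ 2)) by move=> y; split; [exact: dC|exact: dS].
  have := cderiveD (cderiveZ fresnel_unit dZ) (cderive_cst (2^-1)%:C).
  by under [X in cderive _ X -> _]eq_fun do rewrite addr0.
- move=> y; apply: le_trans (ler_cabsD _ _) _; apply: lerD.
    rewrite cabsM ler_wpM2l ?cabs_ge0//; apply: le_trans (cabs_le_ReIm _) _ => /=.
    by have [] := fresnel_bounded C0 S0 dC dS y; lra.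
  by rewrite cabs_real ger0_norm//; lra.
- move=> d d0; move/cvg_cabsP/cvgrPdist_le : EZ => /(_ _ d0)[X [_ XP]].
  exists (`|X| + 1); first by rewrite ltr_pwDr.
  have XE y : `|X| + 1 <= y -> cabs (E y - 1) <= d.
    move=> Xy; have := XP y; rewrite sub0r normrN ger0_norm ?cabs_ge0//; apply.
    by have := ler_norm X; lra.
  move=> y; have [y0|y0] := leP 0 y => Xy.
    by rewrite (ger0_norm y0) in Xy; rewrite /heaviside y0; apply: XE.
  rewrite (ltr0_norm y0) in Xy; have -> : heaviside y = 0 by rewrite /heaviside leNgt y0.
  rewrite subr0.
  by rewrite -(opprK y) EN cabsB; exact: XE.
Qed.

End fresnel_sigmoid.

(** * The chirp in one variable and weights that spread out *)

Section chirp.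
Variable R : realType.
Notation mu := (@lebesgue_measure R).
Notation M := (measurableTypeR R).
Variables (hbar : R).
Hypothesis hbar_gt0 : 0 < hbar.

(** With the chosen branch, (2 pi i hbar)^(-n/2) is an n-th power, so one factor can be attached to
    each coordinate and the normalized integrand stays a product. *)
Lemma planck_factorE n : (planck_factor hbar n)%:C * expi (- (pi * n%:R / 4)) =
  ((Num.sqrt (2 * hbar))^-1%:C * fresnel_unit R) ^+ n.
Proof.
have p0 := @pi_gt0 R.
have h0 : 0 < 2 * pi * hbar by rewrite !mulr_gt0.
have -> : planck_factor hbar n = (Num.sqrt (2 * hbar))^-1 ^+ n * (Num.sqrt pi)^-1 ^+ n.
  rewrite -exprMn -invfM -sqrtrM ?mulr_ge0 ?ltW// exprVn.
  rewrite /planck_factor powRN; congr _^-1.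
  rewrite [n%:R / 2]mulrC powRrM powR12_sqrt ?ltW// powR_mulrn ?sqrtr_ge0//.
  by congr (Num.sqrt _ ^+ _); ring.
rewrite (_ : - (pi * n%:R / 4) = (- (pi / 4)) *+ n); last by rewrite -mulr_natr; ring.
by rewrite expiMn /fresnel_unit !exprMn rmorphM !rmorphXn mulrA.
Qed.

(* Completing the square turns A into a constant multiple of a translated
   sigmoid, which makes the bound B uniform in w. *)
Lemma exists_chirp_antiderivative : exists B : R, forall w : R, exists A : R -> R[i],
  [/\ cderive A (fun x => (Num.sqrt (2 * hbar))^-1%:C * fresnel_unit R *
        expi ((2 * hbar)^-1 * x ^+ 2 + w * x)),
      forall x, cabs (A x) <= B &
      forall d, 0 < d -> exists2 X, 0 < X & forall x, X <= `|x| ->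
        cabs (A x - expi (- (hbar / 2 * w ^+ 2)) * heaviside x) <= d].
Proof.
have [E [B [dE EB Elim]]] := exists_fresnel_sigmoid R.
have h20 : 0 < 2 * hbar by rewrite mulr_gt0.
have s0 : 0 < Num.sqrt (2 * hbar) by rewrite sqrtr_gt0.
exists B => w; set r := Num.sqrt (2 * hbar) in s0 *.
have r2 : r ^+ 2 = 2 * hbar by rewrite sqr_sqrtr// ltW.
(* L(x) = (x + hbar w) / sqrt(2 hbar), so that x^2 / (2 hbar) + w x = L(x)^2 - hbar w^2 / 2. *)
pose L x := r^-1 * x + r^-1 * (hbar * w).
exists (fun x => expi (- (hbar / 2 * w ^+ 2)) * E (L x)); split.
- have := cderiveZ (expi (- (hbar / 2 * w ^+ 2)))
    (cderive_chain dE (fun x => is_derive_affine r^-1 (r^-1 * (hbar * w)) x)).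
  congr cderive; apply/funext => x.
  have -> : (2 * hbar)^-1 * x ^+ 2 + w * x = - (hbar / 2 * w ^+ 2) + (L x) ^+ 2.
    rewrite /L -mulrDr exprMn exprVn r2; field; rewrite ?gt_eqF//.
  by rewrite expiD; ring.
- by move=> x; rewrite cabsM cabs_expi mul1r.
(* Beyond this threshold |L x| >= X, and x and L x have the same sign. The threshold depends on w,
   unlike the bound [B]: the limits are only pointwise in w. *)
- move=> d /Elim[X X0 XE]; exists (r * X + `|hbar * w|).
    by rewrite ltr_pwDl ?mulr_gt0.
  move=> x xX.
  have rL : r * L x = x + hbar * w by rewrite /L; field; rewrite ?gt_eqF//.
  have -> : heaviside x = heaviside (L x).
    rewrite /heaviside; congr ((nat_of_bool _)%:R)%:C; apply/idP/idP.
      move=> x0; rewrite -(pmulr_rge0 _ s0) rL.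
      have := ler_norm (- (hbar * w)); rewrite normrN.
      have := mulr_gt0 s0 X0; rewrite (ger0_norm x0) in xX; lra.
    rewrite -(pmulr_rge0 _ s0) rL => h.
    rewrite leNgt; apply/negP => x0.
    have := ler_norm (hbar * w); have := mulr_gt0 s0 X0.
    rewrite (ltr0_norm x0) in xX; lra.
  rewrite -mulrBr cabsM cabs_expi mul1r; apply: XE.
  have rL' : r * `|L x| = `|x + hbar * w| by rewrite -rL normrM (ger0_norm (ltW s0)).
  rewrite -(ler_pM2l s0) rL'.
  by have := ler_normB (x + hbar * w) (hbar * w); rewrite addrK; lra.
Qed.

(** As e tends to 0 the kernel keeps its mass pi but spreads out: on |x| >= X the small values of
    [D] contribute at most d' pi = d / 2, and on |x| < X the kernel is at most e. *)
Lemma cvg_integral_vanishing (D : R -> R) (B : R) :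
  measurable_fun (setT : set M) D -> (forall x, 0 <= D x <= B) ->
  (forall d, 0 < d -> exists2 X, 0 < X & forall x, X <= `|x| -> D x <= d) ->
  Rintegral mu setT (fun x => D x * (e * kern (e * x))) @[e --> 0^'+] --> (0 : R).
Proof.
move=> mD DB Dlim.
have p0 := @pi_gt0 R.
have B0 : 0 <= B by have /andP[a b] := DB 0; exact: le_trans b.
have ik e : 0 < e -> mu.-integrable setT (EFin \o (fun x => e * kern (e * x))) /\
    Rintegral mu setT (fun x => e * kern (e * x)) = pi.
  move=> e0; have [] := @integral_kern_affine R e 0 e0.
  by under eq_fun do rewrite addr0.
apply/cvgrPdist_le => d d0; pose d' := d / (2 * pi).
have d'0 : 0 < d' by rewrite divr_gt0// mulr_gt0.
have dpi : d' * pi = d / 2.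
  by rewrite /d' invfM mulrA mulfVK// gt_eqF.
have [X X0 XD] := Dlim _ d'0.
(* B + 1 in place of B keeps the constant positive, since e is chosen below a quotient by it. *)
have C0 : 0 < (B + 1) * (1 + X ^+ 2) * pi.
  apply: mulr_gt0 => //; apply: mulr_gt0; last exact: kern_den_gt0.
  by rewrite ltr_wpDl.
near=> e.
have e0 : 0 < e by near: e; exact: nbhs_right_gt.
have [ie ieE] := ik e e0.
have [i1 i1E] := ik 1 ltr01.
have {}i1E : Rintegral mu setT (@kern R) = pi.
  by rewrite -i1E; apply: eq_Rintegral => x _; rewrite !mul1r.
have pos x : 0 <= D x * (e * kern (e * x)).
  by have /andP[a b] := DB x; rewrite mulr_ge0// mulr_ge0 ?kern_ge0// ltW.
have mE : measurable_fun (setT : set M) (fun x => D x * (e * kern (e * x))).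
  by apply: measurable_funM => //; apply/measurable_EFinP; exact: measurable_int ie.
(* (1 + X^2) kern x is at least 1 for |x| < X and replaces the indicator of that interval, so the
   majorant is a combination of kernels of known mass. *)
have bd x : D x * (e * kern (e * x)) <= d' * (e * kern (e * x)) + B * e * (1 + X ^+ 2) * kern x.
  have k0 := kern_ge0 (e * x); have k1 := kern_le1 (e * x); have k2 := kern_ge0 x.
  have /andP[a b] := DB x.
  have [Xx|xX] := leP X `|x|.
    apply: ler_wpDr.
      by rewrite !mulr_ge0 ?addr_ge0 ?sqr_ge0// ltW.
    by apply: ler_wpM2r; [rewrite mulr_ge0// ltW|exact: XD].
  apply: ler_wpDl.
    by apply: mulr_ge0; [exact: ltW|apply: mulr_ge0; [exact: ltW|exact: k0]].
  rewrite -!mulrA; apply: ler_pM => //; first by rewrite mulr_ge0// ltW.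
  rewrite ler_pM2l//; apply: le_trans k1 _.
  rewrite /kern ler_pdivlMr ?kern_den_gt0// mul1r lerD2l.
  by rewrite -(real_normK (num_real x)) ler_pXn2r ?nnegrE// ltW.
have ig : mu.-integrable setT (EFin \o (fun x => d' * (e * kern (e * x)) + B * e * (1 + X ^+ 2) * kern x)).
  have := integrableD measurableT (integrableZl measurableT d' ie)
    (integrableZl measurableT (B * e * (1 + X ^+ 2)) (integrable_kern R)).
  exact.
have iD : mu.-integrable setT (EFin \o (fun x => D x * (e * kern (e * x)))).
  apply: le_integrable ig => //; first exact/measurable_EFinP.
  by move=> x _ /=; rewrite lee_fin ger0_norm// (le_trans (bd x))// ler_norm.
rewrite sub0r normrN ger0_norm; last exact: Rintegral_ge0.
apply: le_trans (le_Rintegral measurableT iD ig (fun x _ => bd x)) _.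
have a1 : Rintegral mu setT (fun x => d' * (e * kern (e * x))) = d' * pi.
  by rewrite -ieE; exact: RintegralZl.
have a2 : Rintegral mu setT (fun x => B * e * (1 + X ^+ 2) * kern x) =
    B * e * (1 + X ^+ 2) * pi.
  by rewrite -i1E; apply: RintegralZl => //; exact: integrable_kern.
rewrite (_ : Rintegral _ _ _ = d' * pi + B * e * (1 + X ^+ 2) * pi); last first.
  apply: etrans (congr2 +%R a1 a2); apply: RintegralD => //.
    exact: (integrableZl measurableT d' ie).
  exact: (integrableZl measurableT _ (integrable_kern R)).
rewrite dpi.
rewrite [leRHS]splitr lerD2l.
apply: (@le_trans _ _ ((B + 1) * (1 + X ^+ 2) * pi * e)).
  rewrite -subr_ge0.
  have -> : (B + 1) * (1 + X ^+ 2) * pi * e - B * e * (1 + X ^+ 2) * pi = (1 + X ^+ 2) * pi * e by ring.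
  by rewrite mulr_ge0 ?(ltW e0)// mulr_ge0 ?(ltW p0)// (ltW (kern_den_gt0 X)).
rewrite mulrC -ler_pdivlMr//; near: e; apply: nbhs_right_le.
by rewrite !divr_gt0.
Unshelve. all: by end_near. Qed.

End chirp.

(** * Iterated integration and integration by parts on R^n *)

Section tuple_integral.
Variable R : realType.
Notation M := (measurableTypeR R).
Notation leb := (@lebesgue_measure R).
Notation lam := (lebesgue_tuple R).

Lemma Rintegral_tuple_cons n (f : n.+1.-tuple M -> R) :
  measurable_fun setT f ->
  (leb \x lam n)%E.-integrable setT (EFin \o (fun p => f (tuple_cons p))) ->
  (lam n.+1).-integrable setT (EFin \o f) /\
  Rintegral (lam n.+1) setT f =
  Rintegral (leb \x lam n)%E setT (fun p => f (tuple_cons p)).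
Proof.
move=> mf fi; split.
  exact: (integrable_pushforward (@measurable_tuple_cons _ M n) (D := setT)
    ((measurable_EFinP _ _).2 mf) fi measurableT).
by rewrite /Rintegral; congr fine;
  exact: (integral_pushforward (@measurable_tuple_cons _ M n) (D := setT)
    ((measurable_EFinP _ _).2 mf) fi measurableT).
Qed.

Lemma cintegral_tuple_cons n (f : n.+1.-tuple M -> R[i]) :
  cmeasurable f -> cintegrable (leb \x lam n)%E (fun p => f (tuple_cons p)) ->
  cintegrable (lam n.+1) f /\
  cintegral (lam n.+1) f = cintegral (leb \x lam n)%E (fun p => f (tuple_cons p)).
Proof.
move=> [mR mI] [fR fI].
have [a b] := Rintegral_tuple_cons mR fR; have [c e] := Rintegral_tuple_cons mI fI.
by split => //; apply: complex_ext; [exact: b|exact: e].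
Qed.

Lemma tnth_tuple_cons0 n (p : M * n.-tuple M) : tnth (tuple_cons p) ord0 = p.1.
Proof. by case: p. Qed.

Lemma tnth_tuple_consS n (p : M * n.-tuple M) i :
  tnth (tuple_cons p) (lift ord0 i) = tnth p.2 i.
Proof. by case: p => a t; rewrite /tuple_cons tnthS. Qed.

Lemma prod_tuple_cons (V : comNzRingType) n (g : 'I_n.+1 -> R -> V) (p : M * n.-tuple M) :
  \prod_i g i (tnth (tuple_cons p) i) =
  g ord0 p.1 * \prod_i g (lift ord0 i) (tnth p.2 i).
Proof.
rewrite big_ord_recl tnth_tuple_cons0; congr (_ * _).
by apply: eq_bigr => i _; rewrite tnth_tuple_consS.
Qed.

Lemma tupleP_cons n (t : n.+1.-tuple M) : exists p, t = tuple_cons p.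
Proof.
exists (thead t, [tuple of behead t]); rewrite /tuple_cons /=.
by rewrite [LHS]tuple_eta.
Qed.

Lemma measurable_prodr d (T : measurableType d) (I : finType) (g : I -> T -> R) :
  (forall i, measurable_fun setT (g i)) ->
  measurable_fun setT (fun t => \prod_i g i t).
Proof. by move=> mg; apply: measurable_prod => i _; exact: mg. Qed.

Lemma integrable_tuple_prod n (g : 'I_n -> R -> R) :
  (forall i x, 0 <= g i x) -> (forall i, leb.-integrable setT (EFin \o g i)) ->
  (lam n).-integrable setT (EFin \o (fun t => \prod_i g i (tnth t i))) /\
  Rintegral (lam n) setT (fun t => \prod_i g i (tnth t i)) =
  \prod_i Rintegral leb setT (g i).
Proof.
elim: n g => [|n IH] g g0 gi.
  have -> : (fun t : 0.-tuple M => \prod_i g i (tnth t i)) = fun=> 1.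
    by apply/funext => t; rewrite big_ord0.
  rewrite big_ord0; split.
    by apply: finite_measure_integrable_cst.
  by rewrite /Rintegral /= integral_dirac// diracT mul1e.
have mg i : measurable_fun (setT : set M) (g i).
  by apply/measurable_EFinP; exact: measurable_int (gi i).
have [h1 h2] := IH (fun i => g (lift ord0 i)) (fun i => g0 _) (fun i => gi _).
have P0 t : 0 <= \prod_i g (lift ord0 i) (tnth t i) by apply: prodr_ge0 => i _; exact: g0.
have [p1 p2] := integrable_prod (m1 := leb) (m2 := lam n) (g0 ord0) P0 (gi ord0) h1.
have E : (fun p => \prod_i g i (tnth (tuple_cons p) i)) =
    (fun z : M * n.-tuple M => g ord0 z.1 * \prod_i g (lift ord0 i) (tnth z.2 i)).
  by apply/funext => p; rewrite prod_tuple_cons.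
have [] := @Rintegral_tuple_cons n (fun t => \prod_i g i (tnth t i)) _ _.
- apply: measurable_prodr => i; apply: measurableT_comp => //.
  exact: measurable_tnth.
- by rewrite E.
move=> q1 q2; split => //.
by rewrite q2 E p2 h2 big_ord_recl.
Qed.

Definition ktuple n (t : n.-tuple M) : R := \prod_i kern (tnth t i).

Lemma ktuple_ge0 n (t : n.-tuple M) : 0 <= ktuple t.
Proof. by apply: prodr_ge0 => i _; exact: kern_ge0. Qed.

Lemma ktuple_cons n (p : M * n.-tuple M) : ktuple (tuple_cons p) = kern p.1 * ktuple p.2.
Proof. exact: (prod_tuple_cons (fun=> @kern R) p). Qed.

Lemma integrable_ktuple n C : (lam n).-integrable setT (EFin \o (fun t => C * ktuple t)).
Proof.
have [i _] := @integrable_tuple_prod n (fun=> @kern R) (fun _ => @kern_ge0 R)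
  (fun _ => integrable_kern R).
exact: (integrableZl measurableT C i).
Qed.

Lemma cintegrable_ktuple n (f : n.-tuple M -> R[i]) C : cmeasurable f ->
  (forall t, cabs (f t) <= C * ktuple t) -> cintegrable (lam n) f.
Proof. by move=> mf fC; apply: cintegrable_dom mf (integrable_ktuple n C) fC. Qed.

Lemma cmeasurable_cons n (f : n.+1.-tuple M -> R[i]) : cmeasurable f ->
  cmeasurable (fun p : M * n.-tuple M => f (tuple_cons p)).
Proof. by move=> mf; apply: cmeasurable_comp mf _; exact: measurable_tuple_cons. Qed.

Lemma cmeasurable_cons1 n (f : n.+1.-tuple M -> R[i]) x : cmeasurable f ->
  cmeasurable (fun t : n.-tuple M => f (tuple_cons (x, t))).
Proof.
move=> mf; apply: (cmeasurable_comp (cmeasurable_cons mf)).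
exact: measurable_pair1.
Qed.

Lemma cmeasurable_cons2 n (f : n.+1.-tuple M -> R[i]) t : cmeasurable f ->
  cmeasurable (fun x : M => f (tuple_cons (x, t))).
Proof.
move=> mf; apply: (cmeasurable_comp (cmeasurable_cons mf)).
exact: measurable_pair2.
Qed.

(** Both orders are recorded: inductions on the dimension use the tail integral with the first
    coordinate frozen, then the one-dimensional result with the tail frozen. *)
Lemma cintegral_tuple_fubini n (f : n.+1.-tuple M -> R[i]) C : cmeasurable f ->
  (forall t, cabs (f t) <= C * ktuple t) ->
  cintegral (lam n.+1) f =
    cintegral leb (fun x => cintegral (lam n) (fun t => f (tuple_cons (x, t)))) /\
  cintegral (lam n.+1) f =
    cintegral (lam n) (fun t => cintegral leb (fun x => f (tuple_cons (x, t)))).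
Proof.
move=> mf fC.
have ip : cintegrable (leb \x lam n)%E (fun p => f (tuple_cons p)).
  have i0 : (lam n).-integrable setT (EFin \o @ktuple n).
    by have := integrable_ktuple n 1; under eq_fun do rewrite mul1r.
  have [i1 _] := integrable_prod (m1 := leb) (m2 := lam n) (@kern_ge0 R)
    (@ktuple_ge0 n) (integrable_kern R) i0.
  have i2 := integrableZl measurableT C i1.
  apply: (cintegrable_dom (cmeasurable_cons mf) i2) => p.
  by have := fC (tuple_cons p); rewrite ktuple_cons.
have [_ ->] := cintegral_tuple_cons mf ip.
split.
  have [] // := cintegral_fubini1 ip; move=> x.
  apply: (@cintegrable_ktuple n _ (C * kern x)); first exact: cmeasurable_cons1.
  by move=> t; rewrite -mulrA -(ktuple_cons (x, t)).
have [] // := cintegral_fubini2 ip; move=> t.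
apply: (@cintegrable_kern R _ (C * ktuple t)); first exact: cmeasurable_cons2.
by move=> x; rewrite -mulrA [ktuple t * _]mulrC -(ktuple_cons (x, t)).
Qed.

Lemma cintegral_tuple_prod n (f : 'I_n -> M -> R[i]) (g : 'I_n -> M -> R) :
  (forall i, cmeasurable (f i)) -> (forall i, leb.-integrable setT (EFin \o g i)) ->
  (forall i x, cabs (f i x) <= g i x) ->
  cintegral (lam n) (fun t => \prod_i f i (tnth t i)) = \prod_i cintegral leb (f i).
Proof.
elim: n f g => [|n IH] f g mf gi fg.
  have -> : (fun t : 0.-tuple M => \prod_i f i (tnth t i)) = fun=> 1.
    by apply/funext => t; rewrite big_ord0.
  rewrite big_ord0; apply: complex_ext => /=.
    by rewrite /Rintegral integral_dirac// diracT mul1e.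
  by rewrite /Rintegral integral0.
have g0 i x : 0 <= g i x := le_trans (cabs_ge0 _) (fg i x).
have [h1 _] := integrable_tuple_prod (fun i => g0 (lift ord0 i)) (fun i => gi (lift ord0 i)).
have P0 (t : n.-tuple M) : 0 <= \prod_i g (lift ord0 i) (tnth t i).
  by apply: prodr_ge0 => i _; exact: g0.
have [p1 _] := integrable_prod (m1 := leb) (m2 := lam n) (g0 ord0) P0 (gi ord0) h1.
have mP m (F : 'I_m -> M -> R[i]) : (forall i, cmeasurable (F i)) ->
    cmeasurable (fun t : m.-tuple M => \prod_i F i (tnth t i)).
  move=> mF; apply: cmeasurable_prod => i; apply: (cmeasurable_comp (mF i)).
  exact: measurable_tnth.
have ip : cintegrable (leb \x lam n)%E
    (fun p => \prod_i f i (tnth (tuple_cons p) i)).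
  apply: (cintegrable_dom (cmeasurable_cons (mP _ _ mf)) p1) => p.
  rewrite prod_tuple_cons cabsM cabs_prod; apply: ler_pM; rewrite ?cabs_ge0//.
    by apply: prodr_ge0 => i _; exact: cabs_ge0.
  by apply: ler_prod => i _; rewrite cabs_ge0 fg.
have if' : cintegrable (lam n) (fun t => \prod_i f (lift ord0 i) (tnth t i)).
  apply: (cintegrable_dom _ h1).
    exact: (mP n (fun i => f (lift ord0 i))).
  by move=> t; rewrite cabs_prod; apply: ler_prod => i _; rewrite cabs_ge0 fg.
have [_ ->] := cintegral_tuple_cons (mP _ _ mf) ip.
have [] := cintegral_fubini1 ip.
  move=> x; under [X in cintegrable _ X]eq_fun do rewrite prod_tuple_cons.
  exact: (cintegrableZ (f ord0 x) if').
move=> _ ->; rewrite big_ord_recl.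
transitivity (cintegral leb (fun x => (\prod_i cintegral leb (f (lift ord0 i))) * f ord0 x)).
  apply: eq_cintegral => x.
  transitivity (f ord0 x * cintegral (lam n) (fun t => \prod_i f (lift ord0 i) (tnth t i))).
    rewrite -cintegralZ//; apply: eq_cintegral => t.
    by rewrite prod_tuple_cons.
  by rewrite (IH (fun i => f (lift ord0 i)) (fun i => g (lift ord0 i)))// mulrC.
rewrite cintegralZ 1?mulrC//.
exact: (cintegrable_dom (mf ord0) (gi ord0)).
Qed.

Definition tset n (t : n.-tuple M) (i : 'I_n) (s : R) : n.-tuple M :=
  [tuple if j == i then s else tnth t j | j < n].

Lemma tset_cons0 n (t : n.-tuple M) s r :
  tset (tuple_cons (r, t)) ord0 s = tuple_cons (s, t).
Proof.
apply: eq_from_tnth => j; rewrite tnth_mktuple.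
case: (unliftP ord0 j) => [i ->|->]; last by rewrite eqxx tnth_tuple_cons0.
by rewrite eq_sym (negbTE (neq_lift _ _)) !tnth_tuple_consS.
Qed.

Lemma tset_consS n (t : n.-tuple M) i s r :
  tset (tuple_cons (r, t)) (lift ord0 i) s = tuple_cons (r, tset t i s).
Proof.
apply: eq_from_tnth => j; rewrite tnth_mktuple.
case: (unliftP ord0 j) => [k ->|->]; last first.
  by rewrite (negbTE (neq_lift _ _)) !tnth_tuple_cons0.
by rewrite (inj_eq lift_inj) !tnth_tuple_consS tnth_mktuple.
Qed.

(* [u k] is the mixed derivative of [u n] along the coordinates k, ..., n-1. *)
Definition ladder n (u : nat -> n.-tuple M -> R[i]) (C : R) :=
  [/\ forall k, (k <= n)%N -> cmeasurable (u k),
      forall k t, (k <= n)%N -> cabs (u k t) <= C * ktuple t,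
      forall (i : 'I_n) t, cderive (fun s => u i.+1 (tset t i s)) (fun s => u i (tset t i s)) &
      forall (i : 'I_n) t, ccontinuous (fun s => u i (tset t i s))].

(** Freezing coordinate 0 leaves the derivatives along the others, that is the steps from n+1 down
    to 1; hence the shifted index. *)
Lemma ladder_cons n (u : nat -> n.+1.-tuple M -> R[i]) C x : ladder u C ->
  ladder (fun k t => u k.+1 (tuple_cons (x, t))) (C * kern x).
Proof.
have E k (i : 'I_n) t : (fun s => u k (tset (tuple_cons (x, t)) (lift ord0 i) s)) =
    (fun s => u k (tuple_cons (x, tset t i s))).
  by apply/funext => s; rewrite tset_consS.
move=> [mu uC du cu]; split.
- by move=> k kn; apply: cmeasurable_cons1; exact: mu.
- by move=> k t kn; apply: le_trans (uC _ _ _) _ => //; rewrite ktuple_cons mulrA.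
- by move=> i t; have := du (lift ord0 i) (tuple_cons (x, t)); rewrite !E.
- by move=> i t; have := cu (lift ord0 i) (tuple_cons (x, t)); rewrite !E.
Qed.

(** The remaining step of the ladder, from 1 to 0, as a one-dimensional statement in coordinate 0
    with the tail frozen. *)
Lemma ladder_cons0 n (u : nat -> n.+1.-tuple M -> R[i]) C t : ladder u C ->
  [/\ cderive (fun s => u 1%N (tuple_cons (s, t))) (fun s => u 0%N (tuple_cons (s, t))),
      ccontinuous (fun s => u 0%N (tuple_cons (s, t))),
      forall s, cabs (u 1%N (tuple_cons (s, t))) <= C * ktuple t * kern s &
      forall s, cabs (u 0%N (tuple_cons (s, t))) <= C * ktuple t * kern s].
Proof.
have E k : (fun s => u k (tset (tuple_cons (0 : M, t)) ord0 s)) =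
    (fun s => u k (tuple_cons (s, t))).
  by apply/funext => s; rewrite tset_cons0.
move=> [mu uC du cu]; split.
- by have := du ord0 (tuple_cons (0 : M, t)); rewrite !E.
- by have := cu ord0 (tuple_cons (0 : M, t)); rewrite !E.
- by move=> s; apply: le_trans (uC 1%N _ _) _ => //; rewrite ktuple_cons -mulrA [kern _ * _]mulrC.
- by move=> s; apply: le_trans (uC 0%N _ _) _ => //; rewrite ktuple_cons -mulrA [kern _ * _]mulrC.
Qed.

Lemma cmeasurable_tuple_prod n (F : 'I_n -> M -> R[i]) :
  (forall i, cmeasurable (F i)) ->
  cmeasurable (fun t : n.-tuple M => \prod_i F i (tnth t i)).
Proof.
move=> mF; apply: cmeasurable_prod => i; apply: (cmeasurable_comp (mF i)).
exact: measurable_tnth.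
Qed.

Lemma cabs_prod_le n (F : 'I_n -> R[i]) (B : R) :
  (forall i, cabs (F i) <= B) -> cabs (\prod_i F i) <= B ^+ n.
Proof.
move=> FB; rewrite cabs_prod -[in leRHS](card_ord n) -prodr_const.
by apply: ler_prod => i _; rewrite cabs_ge0 FB.
Qed.

Lemma cabs_weighted n (F : 'I_n -> M -> R[i]) (u : n.-tuple M -> R[i]) (B C : R) t :
  (forall i x, cabs (F i x) <= B) -> cabs (u t) <= C * ktuple t ->
  cabs (\prod_i F i (tnth t i) * u t) <= B ^+ n * C * ktuple t.
Proof.
move=> FB uC; rewrite cabsM -mulrA; apply: ler_pM => //; rewrite ?cabs_ge0//.
exact: cabs_prod_le.
Qed.

(** One integration by parts per coordinate, each descending one step of the ladder and costing a
    sign. The induction treats the tail first and coordinate 0 last, with an exchange of integrals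
    in between. *)
Lemma ladder_by_parts n (u : nat -> n.-tuple M -> R[i]) C (A e : 'I_n -> R -> R[i]) B E :
  ladder u C -> (forall i, cderive (A i) (e i)) -> (forall i, ccontinuous (e i)) ->
  (forall i x, cabs (A i x) <= B) -> (forall i x, cabs (e i x) <= E) ->
  cintegral (lam n) (fun t => \prod_i e i (tnth t i) * u n t) =
  (-1) ^+ n * cintegral (lam n) (fun t => \prod_i A i (tnth t i) * u 0%N t).
Proof.
elim: n u C A e => [|n IH] u C A e lu dA ce AB eE.
  rewrite expr0 mul1r; apply: eq_cintegral => t.
  by rewrite !big_ord0.
have [mu uC du cu] := lu.
have me i : cmeasurable (e i : M -> R[i]) by exact: ccontinuous_cmeasurable.
have mA i : cmeasurable (A i : M -> R[i]).
  exact: ccontinuous_cmeasurable (cderive_ccontinuous (dA i)).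
have meu : cmeasurable (fun t : n.+1.-tuple M => \prod_i e i (tnth t i) * u n.+1 t).
  by apply: cmeasurableM; [exact: cmeasurable_tuple_prod|exact: mu].
have mAu : cmeasurable (fun t : n.+1.-tuple M => \prod_i A i (tnth t i) * u 0%N t).
  by apply: cmeasurableM; [exact: cmeasurable_tuple_prod|exact: mu].
have sgn k : cabs ((-1) ^+ k : R[i]) = 1 by rewrite cabsX cabsN cabs1 expr1n.
have mAu' : cmeasurable (fun t : n.+1.-tuple M => (-1) ^+ n.+1 * (\prod_i A i (tnth t i) * u 0%N t)).
  by apply: cmeasurableM => //; exact: cmeasurable_cst.
have bAu (t : n.+1.-tuple M) : cabs (\prod_i A i (tnth t i) * u 0%N t) <= B ^+ n.+1 * C * ktuple t.
  exact: cabs_weighted AB (uC 0%N t isT).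
have bAu' (t : n.+1.-tuple M) : cabs ((-1) ^+ n.+1 * (\prod_i A i (tnth t i) * u 0%N t)) <=
    B ^+ n.+1 * C * ktuple t.
  by rewrite cabsM sgn mul1r; exact: bAu.
have iAu := cintegrable_ktuple mAu bAu.
rewrite -cintegralZ//.
have [-> _] := cintegral_tuple_fubini meu (fun t => cabs_weighted eE (uC n.+1 t (leqnn _))).
have [_ ->] := cintegral_tuple_fubini mAu' bAu'.
pose A' i := A (lift ord0 i); pose e' i := e (lift ord0 i).
have bA' (t : n.-tuple M) : cabs (\prod_i A' i (tnth t i)) <= B ^+ n.
  by apply: cabs_prod_le => i; exact: AB.
(* The halfway integrand: already integrated by parts in the tail, not yet in coordinate 0. Fubini
   is applied to it in both orders. *)
pose g (t : n.+1.-tuple M) := (-1) ^+ n * (e ord0 (thead t) *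
   (\prod_i A' i (tnth [tuple of behead t] i) * u 1%N t)).
have gE x t : g (tuple_cons (x, t)) = (-1) ^+ n * (e ord0 x *
    (\prod_i A' i (tnth t i) * u 1%N (tuple_cons (x, t)))).
  rewrite /g; congr (_ * (_ * (_ * _))).
  by apply: eq_bigr => i _; congr (A' i (tnth _ _)); apply: val_inj.
have mg : cmeasurable g.
  apply: cmeasurableM; first exact: cmeasurable_cst.
  apply: cmeasurableM; first by apply: (cmeasurable_comp (me ord0)); exact: measurable_tnth.
  apply: cmeasurableM; last exact: mu.
  apply: (cmeasurable_comp (cmeasurable_tuple_prod (fun i => mA (lift ord0 i)))).
  exact: measurable_behead.
have gC t : cabs (g t) <= E * (B ^+ n * C) * ktuple t.
  have [[x t'] ->] := tupleP_cons t; rewrite gE cabsM sgn mul1r cabsM -mulrA.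
  apply: ler_pM; rewrite ?cabs_ge0//.
  by rewrite cabsM -mulrA; apply: ler_pM; rewrite ?cabs_ge0//; exact: uC.
have [g1 g2] := cintegral_tuple_fubini mg gC.
transitivity (cintegral (lam n.+1) g).
  rewrite g1; apply: eq_cintegral => x.
  have lx := ladder_cons x lu; have [mx xC _ _] := lx.
  have ie : cintegrable (lam n) (fun t => \prod_i e' i (tnth t i) * u n.+1 (tuple_cons (x, t))).
    apply: (@cintegrable_ktuple n _ (E ^+ n * (C * kern x))).
      apply: cmeasurableM; last exact: (mx n).
      exact: (cmeasurable_tuple_prod (fun i => me (lift ord0 i))).
    move=> t; exact: (cabs_weighted (F := e') (u := fun t => u n.+1 (tuple_cons (x, t)))
      (fun i => eE _) (xC n t (leqnn n))).
  have iA : cintegrable (lam n) (fun t => \prod_i A' i (tnth t i) * u 1%N (tuple_cons (x, t))).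
    apply: (@cintegrable_ktuple n _ (B ^+ n * (C * kern x))).
      apply: cmeasurableM; last exact: (mx 0%N).
      exact: (cmeasurable_tuple_prod (fun i => mA (lift ord0 i))).
    move=> t; exact: (cabs_weighted (F := A') (u := fun t => u 1%N (tuple_cons (x, t)))
      (fun i => AB _) (xC 0%N t isT)).
  transitivity (e ord0 x * cintegral (lam n) (fun t => \prod_i e' i (tnth t i) * u n.+1 (tuple_cons (x, t)))).
    rewrite -cintegralZ//; apply: eq_cintegral => t.
    by rewrite (prod_tuple_cons e (x, t)) mulrA.
  rewrite (IH _ _ A' e' lx (fun i => dA _) (fun i => ce _) (fun i => AB _) (fun i => eE _)).
  rewrite mulrA -cintegralZ//; apply: eq_cintegral => t.
  by rewrite gE; ring.
rewrite g2; apply: eq_cintegral => t.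
have [d0 c0 b1 b0] := ladder_cons0 t lu.
have [i1 i2 i12] := cftc_line_sum (dA ord0) (ce ord0) d0 c0 (AB ord0) (eE ord0) b1 b0.
set P := \prod_i A' i (tnth t i).
transitivity ((-1) ^+ n * P * cintegral leb (fun x => e ord0 x * u 1%N (tuple_cons (x, t)))).
  rewrite -cintegralZ//; apply: eq_cintegral => x.
  by rewrite gE -/P; ring.
rewrite i12 mulrN -mulNr -cintegralZ//; apply: eq_cintegral => x.
by rewrite (prod_tuple_cons A (x, t)) /= -/P exprS; ring.
Qed.

Definition tuple_origin n : n.-tuple M := [tuple 0 | _ < n].

Lemma tuple_originS n : tuple_origin n.+1 = tuple_cons (0 : M, tuple_origin n).
Proof.
apply: eq_from_tnth => j; rewrite tnth_mktuple.
case: (unliftP ord0 j) => [k ->|->]; last by rewrite tnth_tuple_cons0.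
by rewrite tnth_tuple_consS tnth_mktuple.
Qed.

(** The fundamental theorem on the positive orthant: integrating the full mixed derivative [u 0]
    over it leaves, up to sign, the value of [u n] at the corner. *)
Lemma ladder_heaviside n (u : nat -> n.-tuple M -> R[i]) C : ladder u C ->
  u n (tuple_origin n) =
  (-1) ^+ n * cintegral (lam n) (fun t => \prod_i heaviside (tnth t i) * u 0%N t).
Proof.
elim: n u C => [|n IH] u C lu.
  rewrite expr0 mul1r; under eq_cintegral do rewrite big_ord0 mul1r.
  have [mu _ _ _] := lu; have [mR mI] := mu 0%N isT.
  have t0 : tuple_origin 0 = [tuple] by apply: eq_from_tnth => -[].
  apply: complex_ext; rewrite /= /Rintegral integral_dirac//.
  - by rewrite diracT mul1e t0.
  - exact/measurable_EFinP.
  - by rewrite diracT mul1e t0.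
  - exact/measurable_EFinP.
have [mu uC du cu] := lu.
have bH (i : 'I_n.+1) (x : M) : cabs (heaviside x) <= 1 by exact: cabs_heaviside.
have bH' (i : 'I_n) (x : M) : cabs (heaviside x) <= 1 by exact: cabs_heaviside.
have sgn k : cabs ((-1) ^+ k : R[i]) = 1 by rewrite cabsX cabsN cabs1 expr1n.
have mH m : cmeasurable (fun t : m.-tuple M => \prod_i heaviside (tnth t i)).
  exact: (@cmeasurable_tuple_prod m (fun=> @heaviside R) (fun=> @cmeasurable_heaviside R)).
have mHu : cmeasurable (fun t : n.+1.-tuple M => \prod_i heaviside (tnth t i) * u 0%N t).
  by apply: cmeasurableM => //; exact: mu.
have bHu t := cabs_weighted (F := fun=> @heaviside R) bH (uC 0%N t isT).
have iHu := cintegrable_ktuple mHu bHu.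
have mHu' : cmeasurable (fun t : n.+1.-tuple M =>
    (-1) ^+ n.+1 * (\prod_i heaviside (tnth t i) * u 0%N t)).
  by apply: cmeasurableM => //; exact: cmeasurable_cst.
have bHu' (t : n.+1.-tuple M) : cabs ((-1) ^+ n.+1 * (\prod_i heaviside (tnth t i) * u 0%N t))
    <= 1 ^+ n.+1 * C * ktuple t.
  by rewrite cabsM sgn mul1r; exact: bHu.
rewrite -cintegralZ//.
have [_ ->] := cintegral_tuple_fubini mHu' bHu'.
(* The tail is handled on the hyperplane where coordinate 0 vanishes; [chalf_line] then writes the
   value at 0 as a half-line integral. *)
rewrite tuple_originS (IH _ _ (ladder_cons 0 lu)).
have [mx xC _ _] := ladder_cons (0 : M) lu.
rewrite -cintegralZ; last first.
  apply: (@cintegrable_ktuple n _ (1 ^+ n * (C * kern 0))).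
    by apply: cmeasurableM => //; exact: (mx 0%N).
  move=> t; have := cabs_weighted (F := fun=> @heaviside R)
    (u := fun t => u 1%N (tuple_cons (0 : M, t))) bH' (xC 0%N t isT).
  exact.
apply: eq_cintegral => t.
have [d0 c0 b1 b0] := ladder_cons0 t lu.
have [i0 e0] := chalf_line d0 c0 b1 b0.
set P := \prod_i heaviside (tnth t i).
transitivity ((-1) ^+ n.+1 * P * (- u 1%N (tuple_cons (0 : M, t)))).
  by rewrite exprS; ring.
rewrite -e0 -cintegralZ//; apply: eq_cintegral => x.
by rewrite (prod_tuple_cons (fun=> @heaviside R) (x, t)) /= -/P; ring.
Qed.

End tuple_integral.

(** * Row vectors: measurability and partial derivatives *)

Section row_vectors.
Variable R : realType.
Notation M := (measurableTypeR R).
Implicit Types (n : nat).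

Lemma row_norm_le n (x : 'rV[R]_n) (C : R) : 0 <= C ->
  (forall i, `|x 0 i| <= C) -> `|x| <= C.
Proof.
move=> C0 xC; rewrite [leLHS]mx_normrE; apply: bigmax_le => // -[i j] _ /=.
by rewrite ord1.
Qed.

Lemma row_coord_le n (x : 'rV[R]_n) i : `|x 0 i| <= `|x|.
Proof.
rewrite [leRHS]mx_normrE.
exact: (le_bigmax _ (fun ij : 'I_1 * 'I_n => `|x ij.1 ij.2|) (0, i)).
Qed.

Lemma row_ofE n (t : n.-tuple M) i : row_of t 0 i = tnth t i.
Proof. by rewrite mxE. Qed.

(** Links the topology of row vectors to the product sigma-algebra of tuples: an open set is a
    countable union of cubes with rational centres and radii 1 / (k + 1). *)
Lemma measurable_row_of_open n (A : set 'rV[R]_n) : open A ->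
  measurable (@row_of R n @^-1` A).
Proof.
move=> oA.
pose box (p : 'rV[rat]_n * nat) : set 'rV[R]_n :=
  [set x | forall i, `|x 0 i - ratr (p.1 0 i)| < p.2.+1%:R^-1].
have mbox p : measurable (@row_of R n @^-1` (box p)).
  have -> : @row_of R n @^-1` box p = \bigcap_(i in [set: 'I_n])
      ((fun t : n.-tuple M => tnth t i) @^-1` [set s | `|s - ratr (p.1 0 i)| < p.2.+1%:R^-1]).
    apply/seteqP; split => t /=.
      by move=> h i _ /=; have := h i; rewrite row_ofE.
    by move=> h i; rewrite row_ofE; exact: h.
  apply: fin_bigcap_measurable => // i _.
  rewrite -[X in measurable X]setTI; apply: measurable_tnth => //.
  rewrite (_ : [set s | _] = `](ratr (p.1 0 i) - p.2.+1%:R^-1), (ratr (p.1 0 i) + p.2.+1%:R^-1)[%classic).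
    exact: measurable_itv.
  by apply/seteqP; split => s /=; rewrite in_itv/= ltr_distl.
have -> : @row_of R n @^-1` A = \bigcup_(p : 'rV[rat]_n * nat)
    (if `[< box p `<=` A >] then @row_of R n @^-1` (box p) else set0).
  apply/seteqP; split => [t /= At|t [p _]]; last first.
    by case: asboolP => // h; exact: h.
  have [e /= e0 eA] := (nbhs_ballP _ _).1 (open_nbhs_nbhs (conj oA At)).
  (* Twice the radius: the point and the rest of the cube are each within one radius of the rational
     centre. *)
  have [k k0 ke] : exists2 k : nat, (0 < k.+1%:R^-1 :> R) & 2 * (k.+1%:R^-1 : R) < e.
    exists (Num.truncn (2 / e)); first by rewrite invr_gt0.
    by rewrite ltr_pdivrMr// mulrC -ltr_pdivrMr// truncnS_gt.
  have qP i : exists q : rat, `|tnth t i - ratr q| < k.+1%:R^-1.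
    have : tnth t i - k.+1%:R^-1 < tnth t i + k.+1%:R^-1.
      by rewrite ltrD2l gtrN.
    move=> /rat_in_itvoo[q]; rewrite in_itv/= => qt; exists q.
    by rewrite distrC ltr_distl.
  pose q i := sval (cid (qP i)).
  pose p : 'rV[rat]_n * nat := (\row_i q i, k).
  have pt : box p (row_of t).
    by move=> i; rewrite row_ofE mxE; exact: (svalP (cid (qP i))).
  exists p => //; case: asboolP => // nA; exfalso; apply: nA => x xp; apply: eA.
  rewrite mx_norm_ball /ball_/=.
  apply: le_lt_trans ke; apply: row_norm_le; first by rewrite mulr_ge0// ltW.
  move=> i; rewrite !mxE.
  have h1 := xp i; have h2 := pt i; rewrite row_ofE in h2.
  apply: ltW; apply: le_lt_trans (ler_distD (ratr (p.1 0 i)) _ _) _.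
  by rewrite mulr_natl mulr2n ltrD// distrC.
apply: countable_bigcupT_measurable; first exact: countableP.
by move=> p; case: asboolP => _; [exact: mbox|exact: measurable0].
Qed.

Lemma measurable_row_of n (f : 'rV[R]_n -> R) : continuous f ->
  measurable_fun setT (fun t : n.-tuple M => f (row_of t)).
Proof.
move=> cf; apply: (measurability _ (RGenOpens.measurableE R)).
move=> _ [_ [a [b ->]] <-]; rewrite setTI.
apply: (@measurable_row_of_open n (f @^-1` `]a, b[)).
by apply: open_comp => [x _|]; [exact: cf|exact: interval_open].
Qed.

Lemma cmeasurable_row_of n (f : 'rV[R]_n -> R[i]) : continuous f ->
  cmeasurable (fun t : n.-tuple M => f (row_of t)).
Proof.
move=> cf; split.
  by apply: (@measurable_row_of n (fun x => complex.Re (f x))) => x; have /cvg_ReImP[] := cf x.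
by apply: (@measurable_row_of n (fun x => complex.Im (f x))) => x; have /cvg_ReImP[] := cf x.
Qed.

Definition rset n (x : 'rV[R]_n) (i : 'I_n) (s : R) : 'rV[R]_n :=
  \row_j (if j == i then s else x 0 j).

Lemma row_of_tset n (t : n.-tuple M) i s : row_of (tset t i s) = rset (row_of t) i s.
Proof. by apply/rowP => j; rewrite !mxE tnth_mktuple. Qed.

Lemma rset_id n (x : 'rV[R]_n) i : rset x i (x 0 i) = x.
Proof. by apply/rowP => j; rewrite !mxE; case: eqP => [->|]. Qed.

Lemma rset_rset n (x : 'rV[R]_n) i s r : rset (rset x i s) i r = rset x i r.
Proof. by apply/rowP => j; rewrite !mxE; case: eqP. Qed.

Lemma scale_rset n (x : 'rV[R]_n) i s (e : R) : e *: rset x i s = rset (e *: x) i (e * s).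
Proof. by apply/rowP => j; rewrite !mxE; case: eqP. Qed.

Lemma growth_rset n (g : 'rV[R]_n -> R) (x : 'rV[R]_n) i :
  (fun h : R => h^-1 *: ((g \o shift x) (h *: delta_mx 0 i) - g x)) =
  (fun h : R => h^-1 *: (((fun s => g (rset x i s)) \o shift (x 0 i)) (h *: 1) -
    (fun s => g (rset x i s)) (x 0 i))).
Proof.
apply/funext => h /=; rewrite rset_id; congr (_ *: (g _ - _)).
apply/rowP => j; rewrite !mxE eqxx /=; case: eqP => [->|_] /=.
  by rewrite /GRing.scale/= !mulr1.
by rewrite mulr0 add0r.
Qed.

(** The difference quotients on both sides are the same function of the increment, so the
    one-variable calculus applies to partial derivatives. *)
Lemma is_derive_rset n (g : 'rV[R]_n -> R) (x : 'rV[R]_n) i (l : R) :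
  is_derive x (delta_mx 0 i) g l <-> is_derive (x 0 i) (1 : R) (fun s => g (rset x i s)) l.
Proof.
split => -[d e]; apply: DeriveDef.
- by move: d; rewrite /derivable growth_rset.
- by rewrite -e /derive growth_rset.
- by move: d; rewrite /derivable growth_rset.
- by rewrite -e /derive growth_rset.
Qed.

Lemma is_derive_slice n (g : 'rV[R]_n -> R) (x : 'rV[R]_n) i s :
  derivable g (rset x i s) (delta_mx 0 i) ->
  is_derive s (1 : R) (fun s => g (rset x i s)) ('D_(delta_mx 0 i) g (rset x i s)).
Proof.
move=> d; have /is_derive_rset : is_derive (rset x i s) (delta_mx 0 i) g ('D_(delta_mx 0 i) g (rset x i s)).
  exact: DeriveDef.
rewrite mxE eqxx; under eq_fun do rewrite rset_rset.
by [].
Qed.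

End row_vectors.

(** * Decay of Schwartz functions and their dilations *)

Section schwartz_decay.
Variables (R : realType) (n : nat).
Notation M := (measurableTypeR R).
Implicit Types (phi : 'rV[R]_n -> R[i]).

Lemma schwartz_weight_le phi k a x : schwartz phi ->
  schwartz_weight k a phi x <= schwartz_seminorm k a phi.
Proof.
move=> [_ _ h]; rewrite /schwartz_seminorm.
by have := ub_le_sup (h k a); apply; exists x.
Qed.

Lemma schwartz_seminorm_ge0 phi k a : schwartz phi -> 0 <= schwartz_seminorm k a phi.
Proof.
move=> sphi; apply: le_trans (schwartz_weight_le k a 0 sphi).
by rewrite mulr_ge0 ?exprn_ge0 ?cabs_ge0.
Qed.

(** The product of the 1 + x_i^2 is at most (1 + |x|^2)^n <= 2^n (1 + |x|^(2n)), so the weights of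
    order 0 and 2 n suffice. *)
Lemma schwartz_decay phi a (x : 'rV[R]_n) : schwartz phi ->
  cabs (cpartial a phi x) <=
    2 ^+ n * (schwartz_seminorm 0 a phi + schwartz_seminorm (2 * n) a phi) *
    \prod_i kern (x 0 i).
Proof.
move=> sphi; set c := cabs _.
have c0 : 0 <= c by exact: cabs_ge0.
have P0 : 0 < \prod_i (1 + x 0 i ^+ 2) by apply: prodr_gt0 => i _; exact: kern_den_gt0.
have -> : \prod_i kern (x 0 i) = (\prod_i (1 + x 0 i ^+ 2))^-1 by rewrite prodfV.
rewrite ler_pdivlMr//.
have h1 := schwartz_weight_le 0 a x sphi; have h2 := schwartz_weight_le (2 * n) a x sphi.
rewrite /schwartz_weight expr0 mul1r -/c in h1; rewrite /schwartz_weight -/c in h2.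
have hP : \prod_i (1 + x 0 i ^+ 2) <= (1 + `|x| ^+ 2) ^+ n.
  have <- : \prod_(i < n) (1 + `|x| ^+ 2) = (1 + `|x| ^+ 2) ^+ n by rewrite prodr_const card_ord.
  apply: ler_prod => i _.
  rewrite addr_ge0 ?sqr_ge0//= lerD2l -(real_normK (num_real (x 0 i))).
  by rewrite ler_pXn2r ?nnegrE// row_coord_le.
have hQ : (1 + `|x| ^+ 2) ^+ n <= 2 ^+ n * (1 + `|x| ^+ (2 * n)).
  rewrite exprM; set y := `|x| ^+ 2; have y0 : 0 <= y by rewrite exprn_ge0.
  have [y1|y1] := leP y 1.
    apply: (@le_trans _ _ (2 ^+ n)).
      by apply: lerXn2r; rewrite ?nnegrE; lra.
    by rewrite ler_peMr ?exprn_ge0// lerDl exprn_ge0.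
  apply: (@le_trans _ _ ((2 * y) ^+ n)).
    by apply: lerXn2r; rewrite ?nnegrE; lra.
  by rewrite exprMn ler_wpM2l ?exprn_ge0// lerDr.
apply: (@le_trans _ _ (c * (2 ^+ n * (1 + `|x| ^+ (2 * n))))).
  by rewrite ler_wpM2l// (le_trans hP).
rewrite mulrCA ler_wpM2l ?exprn_ge0// mulrDr mulr1; apply: lerD => //.
by rewrite mulrC.
Qed.

Lemma continuous_scale_row (e : R) : continuous (fun x : 'rV[R]_n => e *: x).
Proof. by move=> x; exact: scaler_continuous. Qed.

Lemma continuous_cpartial phi a : schwartz phi -> continuous (cpartial a phi).
Proof.
move=> [sR sI _] x; apply/(cvg_ReImP (nbhs_filter x)); split => /=.
  exact: (sR a).1.
exact: (sI a).1.
Qed.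

Lemma cpartial_nil phi : cpartial [::] phi = phi.
Proof. by apply/funext => x; rewrite /cpartial/=; case: (phi x). Qed.

(** The coordinates k, ..., n - 1: empty for k = n, all of them for k = 0. Since [partial] applies
    the head of the list last, lowering k adds one outer derivative. *)
Definition tail_coords k : seq 'I_n := drop k (enum 'I_n).

Lemma tail_coordsE (i : 'I_n) : tail_coords i = i :: tail_coords i.+1.
Proof.
by rewrite /tail_coords (drop_nth i) ?size_enum_ord// nth_ord_enum.
Qed.

Lemma cderive_cpartial phi (a : seq 'I_n) i (x : 'rV[R]_n) (e : R) : schwartz phi ->
  cderive (fun s => cpartial a phi (e *: rset x i s))
    (fun s => e%:C * cpartial (i :: a) phi (e *: rset x i s)).
Proof.
move=> [sR sI _] s; rewrite complex_ReM complex_ImM /= !mul0r subr0 addr0.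
have h (f : 'rV[R]_n -> R) : derivable f (rset (e *: x) i (e * s)) (delta_mx 0 i) ->
    is_derive s (1 : R) (fun s => f (e *: rset x i s))
      (e * 'D_(delta_mx 0 i) f (e *: rset x i s)).
  move=> df; rewrite scale_rset mulrC; under eq_fun do rewrite scale_rset.
  have d := is_derive_affine e 0 s; under [X in is_derive _ _ X _]eq_fun do rewrite -[e * _]addr0.
  apply: (is_derive_chain (f := fun r => f (rset (e *: x) i r)) (g := fun s => e * s + 0)) => //.
  by rewrite addr0; exact: is_derive_slice.
by split; apply: h; [exact: (sR a).2|exact: (sI a).2].
Qed.

(** The powers of e come from the chain rule. The first bound, by a kernel of constant mass with [C]
    independent of e, governs the limit; the constant [Ce] of the ladder depends on e and is used
    only at fixed e. *)
Lemma schwartz_ladder phi : schwartz phi -> exists C : R, forall e, 0 < e ->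
  (forall t : n.-tuple M, cabs ((e ^+ n)%:C * cpartial (tail_coords 0) phi (e *: row_of t)) <=
    C * \prod_i (e * kern (e * tnth t i))) /\
  exists Ce, ladder (fun k t => (e ^+ (n - k))%:C * cpartial (tail_coords k) phi (e *: row_of t)) Ce.
Proof.
move=> sphi.
pose c k := 2 ^+ n * (schwartz_seminorm 0 (tail_coords k) phi +
  schwartz_seminorm (2 * n) (tail_coords k) phi).
have c0 k : 0 <= c k.
  by rewrite mulr_ge0 ?exprn_ge0 ?addr_ge0 ?schwartz_seminorm_ge0.
exists (c 0%N) => e e0.
have dec k (t : n.-tuple M) : cabs (cpartial (tail_coords k) phi (e *: row_of t)) <=
    c k * \prod_i kern (e * tnth t i).
  have := schwartz_decay (tail_coords k) (e *: row_of t) sphi.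
  rewrite -/(c k); under eq_bigr do rewrite mxE row_ofE.
  by [].
split.
  move=> t; rewrite cabsM cabs_real ger0_norm ?exprn_ge0 ?(ltW e0)//.
  rewrite big_split/= prodr_const card_ord mulrCA ler_wpM2l ?exprn_ge0 ?(ltW e0)//.
  exact: dec.
pose S := \sum_(k < n.+1) c k.
have cS k : (k <= n)%N -> c k <= S.
  move=> kn; rewrite /S (bigD1 (Ordinal (kn : (k < n.+1)%N)))//= lerDl.
  by apply: sumr_ge0 => i _; exact: c0.
(* One constant for all k: (1 + e)^n bounds every e^(n - k), [S] every [c k], and the last factor
   undoes the dilation of the n kernels. *)
exists ((1 + e) ^+ n * S * (1 + e ^- 2) ^+ n); split.
- move=> k kn; apply: cmeasurableM; first exact: cmeasurable_cst.
  apply: (cmeasurable_row_of (f := fun x => cpartial (tail_coords k) phi (e *: x))).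
  move=> x; apply: (continuous_comp (f := fun x : 'rV[R]_n => e *: x)).
    exact: continuous_scale_row.
  exact: continuous_cpartial.
- move=> k t kn; rewrite cabsM cabs_real ger0_norm ?exprn_ge0 ?(ltW e0)//.
  rewrite -!mulrA; apply: ler_pM; rewrite ?exprn_ge0 ?cabs_ge0 ?(ltW e0)//.
    apply: (@le_trans _ _ ((1 + e) ^+ (n - k))).
      by have e0' := ltW e0; apply: lerXn2r; rewrite ?nnegrE; lra.
    by rewrite ler_weXn2l ?lerDl ?leq_subr ?(ltW e0).
  apply: le_trans (dec k t) _; apply: ler_pM => //.
  + by apply: prodr_ge0 => i _; exact: kern_ge0.
  + exact: cS.
  + rewrite /ktuple.
    have <- : \prod_(i < n) (1 + e ^- 2) = (1 + e ^- 2) ^+ n by rewrite prodr_const card_ord.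
    rewrite -big_split/=.
    by apply: ler_prod => i _; rewrite kern_ge0 kern_scale_le.
- move=> i t; rewrite tail_coordsE.
  have := cderiveZ (e ^+ (n - i.+1))%:C (cderive_cpartial (tail_coords i.+1) i (row_of t) e sphi).
  have <- : (fun s => (e ^+ (n - i.+1))%:C * cpartial (tail_coords i.+1) phi (e *: row_of (tset t i s))) =
      (fun s => (e ^+ (n - i.+1))%:C * cpartial (tail_coords i.+1) phi (e *: rset (row_of t) i s)).
    by apply/funext => s; rewrite row_of_tset.
  congr cderive; apply/funext => s; rewrite row_of_tset mulrA; congr (_ * _).
  by rewrite -rmorphM -exprSr subnSK.
- move=> i t; apply: ccontinuousM.
    exact: cderive_ccontinuous (cderive_cst _).
  have := cderive_ccontinuous (cderive_cpartial (tail_coords i) i (row_of t) e sphi).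
  by under [X in _ -> ccontinuous X]eq_fun do rewrite row_of_tset.
Qed.

End schwartz_decay.

(** * The Gaussian as a Schwartz function *)

Section gaussian.
Variable R : realType.
Implicit Types (p : {poly R}) (s : R).

(** A family closed under differentiation and under multiplication by polynomials, so a plain bound
    for all its members gives all the Schwartz estimates. *)
Definition poly_gauss p s : R := p.[s] * expR (- s ^+ 2).

Lemma poly_gauss_bounded p : exists C : R, forall s, `|poly_gauss p s| <= C.
Proof.
have mono (k : nat) : exists C : R, forall s, `|s| ^+ k * expR (- s ^+ 2) <= C.
  (* From a single term of the exponential series: |s|^k <= (1 + s^2)^(k+1) <= (k+1)! exp(1 +
     s^2). *)
  exists (expR 1 * k.+1`!%:R) => s.
  have y0 : 0 <= 1 + s ^+ 2 by rewrite addr_ge0 ?sqr_ge0.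
  have s1 : `|s| ^+ k <= (1 + s ^+ 2) ^+ k.+1.
    have [h|h] := leP `|s| 1.
      apply: (@le_trans _ _ 1); first by rewrite exprn_ile1.
      by rewrite exprn_ege1// lerDl sqr_ge0.
    apply: (@le_trans _ _ (`|s| ^+ k.+1)); first by rewrite ler_weXn2l// ltW.
    apply: lerXn2r; rewrite ?nnegrE// -(real_normK (num_real s)).
    by have := sqr_ge0 (`|s| - 1); nra.
  have := expR_ge1Dxn k y0.
  rewrite expRD => h.
  have f0 : 0 < (k.+1)`!%:R :> R by rewrite ltr0n fact_gt0.
  have {}h : (1 + s ^+ 2) ^+ k.+1 <= expR 1 * expR (s ^+ 2) * k.+1`!%:R.
    by rewrite -ler_pdivrMr//; lra.
  rewrite expRN ler_pdivrMr ?expR_gt0//.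
  by apply: le_trans s1 _; apply: le_trans h _; rewrite le_eqVlt; apply/orP; left; apply/eqP; ring.
elim/poly_ind: p => [|q c _].
  by exists 0 => s; rewrite /poly_gauss horner0 mul0r normr0.
set p := q * 'X + c%:P.
pose D k := projT1 (cid (mono k)).
exists (\sum_(i < size p) `|p`_i| * D i) => s.
rewrite /poly_gauss horner_coef mulr_suml.
apply: le_trans (ler_norm_sum _ _ _) _; apply: ler_sum => i _.
rewrite -mulrA normrM ler_wpM2l// normrM normrX (ger0_norm (expR_ge0 _)).
exact: (projT2 (cid (mono i))).
Qed.

Lemma poly_gauss_kern p : exists C : R, forall s, `|poly_gauss p s| <= C * kern s.
Proof.
have [C CP] := poly_gauss_bounded ((1 + 'X ^+ 2) * p); exists C => s.
rewrite /kern ler_pdivlMr ?kern_den_gt0//; apply: le_trans (CP s).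
rewrite /poly_gauss hornerM hornerD hornerXn hornerE -mulrA [leRHS]normrM.
by rewrite (ger0_norm (ltW (kern_den_gt0 s))) mulrC.
Qed.

Definition dpoly_gauss p : {poly R} := p^`() - 2%:P * 'X * p.

Lemma is_derive_poly_gauss p s :
  is_derive s (1 : R) (poly_gauss p) (poly_gauss (dpoly_gauss p) s).
Proof.
have dN : is_derive s (1 : R) (fun s => - s ^+ 2) (- (2 * s)).
  have := is_derive_sub (is_derive_const 0 s) (is_derive_sqr s).
  by under eq_fun do rewrite sub0r; rewrite sub0r.
have := is_derive_mul (is_derive_poly p s) (is_derive_chain (g := fun s => - s ^+ 2) (is_derive_expR _) dN).
move=> h; apply: (is_derive_eq h).
by rewrite /poly_gauss /dpoly_gauss hornerD hornerN !hornerM hornerC hornerX; ring.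
Qed.

Lemma continuous_poly_gauss p : continuous (poly_gauss p).
Proof. exact: is_derive_continuous (is_derive_poly_gauss p). Qed.

Variable n : nat.

Definition gauss_tensor (G : 'I_n -> {poly R}) (x : 'rV[R]_n) : R :=
  \prod_i poly_gauss (G i) (x 0 i).

Lemma continuous_gauss_tensor G : continuous (gauss_tensor G).
Proof.
move=> x; rewrite /gauss_tensor /continuous_at.
elim: (index_enum _) => [|i r IH].
  have E : (fun y : 'rV[R]_n => \prod_(i <- [::]) poly_gauss (G i) (y 0 i)) = fun=> 1.
    by apply/funext => y; rewrite big_nil.
  have C : continuous (fun y : 'rV[R]_n => \prod_(i <- [::]) poly_gauss (G i) (y 0 i)).
    by rewrite E; exact: cst_continuous.
  exact: C.
have C : continuous (fun y : 'rV[R]_n => poly_gauss (G i) (y 0 i)).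
  move=> y; apply: (@continuous_comp _ _ _ (fun x : 'rV[R]_n => x 0 i) (poly_gauss (G i))).
    exact: coord_continuous.
  exact: continuous_poly_gauss.
have E : (fun y : 'rV[R]_n => \prod_(j <- i :: r) poly_gauss (G j) (y 0 j)) =
  fun y => poly_gauss (G i) (y 0 i) * \prod_(j <- r) poly_gauss (G j) (y 0 j).
  by apply/funext => y; rewrite big_cons.
by rewrite E big_cons; apply: cvgM IH; exact: C.
Qed.

Definition dgauss_tensor (i : 'I_n) (G : 'I_n -> {poly R}) j :=
  if j == i then dpoly_gauss (G j) else G j.

Lemma is_derive_gauss_tensor G i (x : 'rV[R]_n) :
  is_derive x (delta_mx 0 i) (gauss_tensor G) (gauss_tensor (dgauss_tensor i G) x).
Proof.
apply/is_derive_rset.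
pose P := \prod_(j | j != i) poly_gauss (G j) (x 0 j).
have E s : gauss_tensor G (rset x i s) = poly_gauss (G i) s * P.
  rewrite /gauss_tensor (bigD1 i)//= mxE eqxx; congr (_ * _).
  by apply: eq_bigr => j ji; rewrite mxE (negbTE ji).
under [X in is_derive _ _ X _]eq_fun do rewrite E.
have -> : gauss_tensor (dgauss_tensor i G) x = poly_gauss (dpoly_gauss (G i)) (x 0 i) * P.
  rewrite /gauss_tensor (bigD1 i)//= /dgauss_tensor eqxx; congr (_ * _).
  by apply: eq_bigr => j ji; rewrite (negbTE ji).
have := is_derive_mul (is_derive_poly_gauss (G i) (x 0 i)) (is_derive_const P (x 0 i)).
by move=> h; apply: (is_derive_eq h); rewrite mulr0 addr0.
Qed.

Lemma partial_gauss_tensor a G : partial a (gauss_tensor G) =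
  gauss_tensor (foldr dgauss_tensor G a).
Proof.
elim: a => [|i a IH] //=; rewrite IH; apply/funext => x.
by have [_ ->] := is_derive_gauss_tensor (foldr dgauss_tensor G a) i x.
Qed.

Lemma partial_cst0 (a : seq 'I_n) : partial a (fun=> 0 : R) = fun=> 0.
Proof.
elim: a => [|i a IH] //=; rewrite IH; apply/funext => x.
exact: derive_cst.
Qed.

(** The weight (1 + X^2)^k is absorbed into every polynomial factor. The product of the 1 + x_i^2
    dominates each |x_i|, hence the maximum norm, because all its factors are at least 1. *)
Lemma gauss_tensor_decay G k : exists C : R, forall x, `|x| ^+ k * `|gauss_tensor G x| <= C.
Proof.
have h i := poly_gauss_bounded ((1 + 'X ^+ 2) ^+ k * G i).
exists (\prod_i projT1 (cid (h i))) => x.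
apply: (@le_trans _ _ (\prod_i `|poly_gauss ((1 + 'X ^+ 2) ^+ k * G i) (x 0 i)|)); last first.
  apply: ler_prod => i _; rewrite normr_ge0/=; exact: (projT2 (cid (h i))).
have E i : `|poly_gauss ((1 + 'X ^+ 2) ^+ k * G i) (x 0 i)| =
    (1 + x 0 i ^+ 2) ^+ k * `|poly_gauss (G i) (x 0 i)|.
  rewrite /poly_gauss hornerM horner_exp hornerD hornerXn hornerE -mulrA normrM.
  by rewrite ger0_norm// exprn_ge0// ltW// kern_den_gt0.
under eq_bigr do rewrite E.
rewrite big_split/= prodrXl /gauss_tensor normr_prod; apply: ler_wpM2r.
  by apply: prodr_ge0 => i _.
have P0 : 1 <= \prod_i (1 + x 0 i ^+ 2).
  elim/big_ind : _ => // [a b a1 b1|i _]; first by rewrite mulr_ege1.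
  by rewrite lerDl sqr_ge0.
apply: lerXn2r; [by rewrite nnegrE|by rewrite nnegrE (le_trans ler01)|].
apply: row_norm_le; first by rewrite (le_trans ler01).
move=> i; apply: (@le_trans _ _ (1 + x 0 i ^+ 2)).
  by rewrite -(real_normK (num_real (x 0 i))); have := sqr_ge0 (`|x 0 i| - 1); nra.
rewrite (bigD1 i)//= ler_peMr ?(ltW (kern_den_gt0 _))//.
elim/big_ind : _ => // [a b a1 b1|j _]; first by rewrite mulr_ege1.
by rewrite lerDl sqr_ge0.
Qed.

(** Used twice: as the window of the short-time Fourier transform, and as an admissible
    regularization that pins down the value of [fresnel]. *)
Definition gaussian (x : 'rV[R]_n) : R[i] := (gauss_tensor (fun=> 1) x)%:C.

Lemma schwartz_gaussian : schwartz gaussian.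
Proof.
split.
- move=> a; rewrite (_ : (fun x => _) = gauss_tensor (fun=> 1))// partial_gauss_tensor.
  split; first exact: continuous_gauss_tensor.
  by move=> i x; have [] := is_derive_gauss_tensor (foldr dgauss_tensor (fun=> 1) a) i x.
- move=> a; rewrite (_ : (fun x => _) = fun=> 0)// partial_cst0.
  by split; [exact: cst_continuous|move=> i x; exact: derivable_cst].
- move=> k a; have [C CP] := gauss_tensor_decay (foldr dgauss_tensor (fun=> 1) a) k.
  exists C => _ [x _ <-]; rewrite /schwartz_weight /cpartial.
  rewrite (_ : (fun y => complex.Re _) = gauss_tensor (fun=> 1))// partial_gauss_tensor.
  rewrite (_ : (fun y => complex.Im _) = fun=> 0)// partial_cst0.
  by rewrite cabs_real.
Qed.

Lemma gaussian0 : gaussian 0 = 1.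
Proof.
rewrite /gaussian /gauss_tensor big1// => i _.
by rewrite /poly_gauss mxE hornerE expr0n oppr0 expR0 mul1r.
Qed.

End gaussian.

Lemma integrable_bigsum d (T : measurableType d) (R : realType)
    (m : {measure set T -> \bar R}) (I : Type) (s : seq I) (f : I -> T -> R) :
  (forall i, m.-integrable setT (EFin \o f i)) ->
  m.-integrable setT (EFin \o (fun x => \sum_(i <- s) f i x)) /\
  Rintegral m setT (fun x => \sum_(i <- s) f i x) = \sum_(i <- s) Rintegral m setT (f i).
Proof.
move=> fi; elim: s => [|i s [IH1 IH2]].
  rewrite (_ : (fun x => _) = fun=> 0); last by apply/funext => x; rewrite big_nil.
  split; last by rewrite big_nil /Rintegral integral0.
  exact: integrable0.
rewrite (_ : (fun x => _) = fun x => f i x + \sum_(j <- s) f j x); last first.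
  by apply/funext => x; rewrite big_cons.
split; last by rewrite big_cons -IH2 RintegralD//; exact: fi.
by have := integrableD measurableT (fi i) IH1; under eq_fun do rewrite /= -EFinD.
Qed.

(** * The Fresnel integral of a plane wave *)

Section plane_waves.
Variables (R : realType) (hbar : R).
Hypothesis hbar_gt0 : 0 < hbar.
Variable n : nat.
Notation M := (measurableTypeR R).
Notation leb := (@lebesgue_measure R).
Notation lam := (lebesgue_tuple R).
Implicit Types (w : 'I_n -> R) (phi : 'rV[R]_n -> R[i]).

Definition wave w (x : 'rV[R]_n) : R[i] := expi (\sum_i x 0 i * w i).

Lemma cabs_wave w x : cabs (wave w x) = 1.
Proof. exact: cabs_expi. Qed.

(** Telescoping, one factor at a time; B >= 1 lets the shorter products of remaining factors be
    bounded by the same power. *)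
Lemma cabs_prodB m (F G : 'I_m -> R[i]) (B : R) : 1 <= B ->
  (forall i, cabs (F i) <= B) -> (forall i, cabs (G i) <= B) ->
  cabs (\prod_i F i - \prod_i G i) <= B ^+ m * \sum_i cabs (F i - G i).
Proof.
move=> B1; have B0 : 0 <= B by rewrite (le_trans ler01).
elim: m F G => [|m IH] F G FB GB.
  by rewrite !big_ord0 subrr cabs0 mulr0.
rewrite !big_ord_recl.
set PF := \prod_(i < m) _; set PG := \prod_(i < m) _.
have -> : F ord0 * PF - G ord0 * PG = F ord0 * (PF - PG) + (F ord0 - G ord0) * PG by ring.
apply: le_trans (ler_cabsD _ _) _; rewrite !cabsM.
have hI : cabs (PF - PG) <= B ^+ m * \sum_(i < m) cabs (F (lift ord0 i) - G (lift ord0 i)).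
  by apply: IH.
have hG : cabs PG <= B ^+ m by apply: cabs_prod_le.
rewrite mulrDr addrC; apply: lerD.
  rewrite mulrC ler_wpM2r ?cabs_ge0// (le_trans hG)//.
  by rewrite exprS ler_peMl ?exprn_ge0.
by rewrite exprS -mulrA; apply: ler_pM; rewrite ?cabs_ge0.
Qed.

Lemma cmeasurable_chirp_wave w : cmeasurable (fun t : n.-tuple M =>
  expi ((2 * hbar)^-1 * dotr (row_of t) (row_of t)) * wave w (row_of t)).
Proof.
have mt i : measurable_fun setT (fun t : n.-tuple M => row_of t 0 i).
  by under eq_fun do rewrite row_ofE; exact: measurable_tnth.
apply: cmeasurableM; apply: cmeasurable_expi.
- apply: measurable_funM => //; rewrite /dotr; apply: measurable_sum => i.
  exact: measurable_funM.
- by apply: measurable_sum => i; exact: measurable_funM.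
Qed.

Lemma schwartz_scaled phi (e : R) : schwartz phi -> 0 < e ->
  cmeasurable (fun t : n.-tuple M => phi (e *: row_of t)) /\
  exists C, forall t : n.-tuple M, cabs (phi (e *: row_of t)) <= C * ktuple t.
Proof.
move=> sphi e0; have [C h] := schwartz_ladder sphi; have [_ [Ce lad]] := h e e0.
have E t : (e ^+ (n - n))%:C * cpartial (tail_coords n n) phi (e *: row_of t) = phi (e *: row_of t).
  by rewrite subnn expr0 mul1r /tail_coords drop_oversize ?size_enum_ord// cpartial_nil.
have [m b _ _] := lad; split.
  by have := m n (leqnn n); under eq_fun do rewrite E.
by exists Ce => t; have := b n t (leqnn n); rewrite E.
Qed.

(** The bound is uniform in w and e, the limit only pointwise in w: exactly the input of dominated
    convergence against a measure in w. *)
Lemma cvg_fresnel_reg_wave phi : schwartz phi -> exists2 C : R,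
  (forall w e, 0 < e -> cabs (fresnel_reg hbar phi (wave w) e) <= C) &
  (phi 0 = 1 -> forall w, fresnel_reg hbar phi (wave w) e @[e --> 0^'+] -->
    expi (- (hbar / 2 * \sum_i w i ^+ 2))).
Proof.
move=> sphi.
have [B AP] := exists_chirp_antiderivative hbar_gt0.
have [C ladP] := schwartz_ladder sphi.
pose c : R[i] := (Num.sqrt (2 * hbar))^-1%:C * fresnel_unit R.
pose u e k (t : n.-tuple M) := (e ^+ (n - k))%:C * cpartial (tail_coords n k) phi (e *: row_of t).
pose A w i := projT1 (cid (AP (w i))).
pose ch w i x := c * expi ((2 * hbar)^-1 * x ^+ 2 + w i * x).
have dA w i : cderive (A w i) (ch w i) by case: (projT2 (cid (AP (w i)))).
have bA w i x : cabs (A w i x) <= B by have [_ + _] := projT2 (cid (AP (w i))); exact.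
have vA w i : forall d, 0 < d -> exists2 X, 0 < X & forall x, X <= `|x| ->
        cabs (A w i x - expi (- (hbar / 2 * w i ^+ 2)) * heaviside x) <= d.
  by case: (projT2 (cid (AP (w i)))).
have B0 : 0 <= B.
  by have [A0 [_ h _]] := AP 0; apply: le_trans (h 0); exact: cabs_ge0.
have C0 : 0 <= C.
  have [h _] := ladP 1 ltr01; have h1 := h [tuple 0 | _ < n].
  have := le_trans (cabs_ge0 _) h1; rewrite pmulr_lge0//.
  by apply: prodr_gt0 => i _; rewrite mul1r kern_gt0.
have cch w i : ccontinuous (ch w i).
  have := cderiveM (cderive_cst c) (cderive_expi (h := fun x => (2 * hbar)^-1 * x ^+ 2 + w i * x)
    (h' := fun x => (2 * hbar)^-1 * (2 * x) + w i) _).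
  move=> h; apply: cderive_ccontinuous; apply: h => x.
  have := is_derive_add (is_derive_mul (is_derive_const (2 * hbar)^-1 x) (is_derive_sqr x))
    (is_derive_mul (is_derive_const (w i) x) (@is_derive_id _ _ x 1)).
  by move=> h; apply: (is_derive_eq h); ring.
have bch w i x : cabs (ch w i x) <= cabs c by rewrite /ch cabsM cabs_expi mulr1.
have uE e t : u e n t = phi (e *: row_of t).
  by rewrite /u subnn expr0 mul1r /tail_coords drop_oversize ?size_enum_ord// cpartial_nil.
(* Completely integrated by parts: all n derivatives now fall on phi(e x), and the chirps are
   replaced by their bounded primitives. *)
have regE w e : 0 < e -> fresnel_reg hbar phi (wave w) e =
    (-1) ^+ n * cintegral (lam n) (fun t => \prod_i A w i (tnth t i) * u e 0%N t).
  move=> e0; have [_ [Ce lad]] := ladP e e0.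
  rewrite -(ladder_by_parts lad (dA w) (cch w) (bA w) (bch w)).
  rewrite /fresnel_reg planck_factorE// -/c /cintegral_Rn -cintegralZ; last first.
    have [m [K b]] := schwartz_scaled sphi e0.
    apply: (cintegrable_ktuple (C := K)).
      by apply: cmeasurableM => //; exact: cmeasurable_chirp_wave.
    by move=> t; rewrite !cabsM cabs_wave cabs_expi !mul1r.
  apply: eq_cintegral => t; rewrite -/(u e n t) uE !mulrA; congr (_ * _).
  rewrite -mulrA /wave -expiD big_split/= prodr_const card_ord; congr (_ * _).
  rewrite -expi_sum big_split/= -mulr_sumr /dotr; congr expi; congr (_ + _).
    by congr (_ * _); apply: eq_bigr => i _; rewrite row_ofE expr2.
  by apply: eq_bigr => i _; rewrite row_ofE mulrC.
have kint e : 0 < e -> leb.-integrable setT (EFin \o (fun x => e * kern (e * x))) /\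
    Rintegral leb setT (fun x => e * kern (e * x)) = pi.
  move=> e0; have := integral_kern_affine 0 e0.
  by under eq_fun do rewrite addr0.
have mu0 e : 0 < e -> cmeasurable (u e 0%N).
  by move=> e0; have [_ [Ce [m _ _ _]]] := ladP e e0; exact: m.
have mA w i : cmeasurable (A w i : M -> R[i]).
  by apply: ccontinuous_cmeasurable; exact: cderive_ccontinuous (dA w i).
have ktu e (g : 'I_n -> R -> R) : 0 < e -> (forall i, measurable_fun setT (g i : M -> R)) ->
    (exists K, forall i x, 0 <= g i x <= K) ->
    (lam n).-integrable setT (EFin \o (fun t => \prod_i (g i (tnth t i) * (e * kern (e * tnth t i))))) /\
    Rintegral (lam n) setT (fun t => \prod_i (g i (tnth t i) * (e * kern (e * tnth t i)))) =
    \prod_i Rintegral leb setT (fun x => g i x * (e * kern (e * x))).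
  move=> e0 mg [K gK].
  apply: (integrable_tuple_prod (g := fun i x => g i x * (e * kern (e * x)))).
    by move=> i x; have /andP[g0 _] := gK i x; rewrite !mulr_ge0 ?kern_ge0 ?(ltW e0).
  move=> i; have [ki _] := kint e e0.
  have iK : leb.-integrable setT (EFin \o (fun x => K * (e * kern (e * x)))).
    have := integrableZl measurableT K ki.
    by under eq_fun do rewrite -EFinM.
  apply: le_integrable iK => //.
  - apply/measurable_EFinP; apply: measurable_funM => //.
    by apply/measurable_EFinP; exact: measurable_int ki.
  - move=> x _ /=; rewrite lee_fin; have /andP[g0 gk] := gK i x.
    have k0 : 0 <= e * kern (e * x) by rewrite mulr_ge0 ?kern_ge0 ?(ltW e0).
    by rewrite [leLHS]normrM [leRHS]normrM ler_wpM2r// (ger0_norm g0) (le_trans gk)// ler_norm.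
have kpow e : 0 < e ->
   (lam n).-integrable setT (EFin \o (fun t => \prod_i (e * kern (e * tnth t i)))) /\
    Rintegral (lam n) setT (fun t => \prod_i (e * kern (e * tnth t i))) = pi ^+ n.
  move=> e0; have := integrable_tuple_prod (g := fun (i : 'I_n) x => e * kern (e * x)) _ _.
  case.
  - by move=> i x; rewrite mulr_ge0 ?kern_ge0 ?(ltW e0).
  - by move=> i; have [] := kint e e0.
  - move=> h1 ->; split=> //.
    by rewrite (eq_bigr (fun=> pi)) ?prodr_const ?card_ord// => i _; have [] := kint e e0.
(* The n primitives give B^n, the weight has mass at most C pi^n, and 2 comes from
   [cabs_cintegral_le]. *)
exists (2 * (B ^+ n * C * pi ^+ n)).
  move=> w e e0; rewrite regE// cabsM cabsX cabsN cabs1 expr1n mul1r.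
  have [ki kv] := kpow e e0; have [lb _] := ladP e e0.
  have := @cabs_cintegral_le _ _ _ (lam n) (fun t => \prod_i A w i (tnth t i) * u e 0%N t)
    (fun t => B ^+ n * C * \prod_i (e * kern (e * tnth t i))) _ _ _.
  rewrite RintegralZl// kv; apply.
  - by apply: cmeasurableM; [exact: cmeasurable_tuple_prod|exact: mu0].
  - have := integrableZl measurableT (B ^+ n * C) ki.
    by under eq_fun do rewrite -EFinM.
  - move=> t; rewrite cabsM -mulrA; apply: ler_pM; rewrite ?cabs_ge0//.
      exact: cabs_prod_le.
    by have := lb t; rewrite /u subn0.
move=> phi0 w.
pose a i : R[i] := expi (- (hbar / 2 * w i ^+ 2)).
pose D i x := cabs (A w i x - a i * heaviside x).
have limE : expi (- (hbar / 2 * \sum_i w i ^+ 2)) = \prod_i a i.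
  by rewrite -expi_sum mulr_sumr sumrN.
rewrite limE; apply/cvg_cabsP.
have mD i : measurable_fun (setT : set M) (D i).
  apply: measurable_cabs; apply: cmeasurableB => //; apply: cmeasurableM.
    exact: cmeasurable_cst.
  exact: cmeasurable_heaviside.
have ba i x : cabs (a i * heaviside x) <= 1 by rewrite cabsM cabs_expi mul1r cabs_heaviside.
have bD i x : 0 <= D i x <= B + 1.
  rewrite /D cabs_ge0/=; apply: le_trans (ler_cabsD _ _) _; rewrite cabsN.
  by apply: lerD.
pose r e i := Rintegral leb setT (fun x => D i x * (e * kern (e * x))).
have rlim i : r e i @[e --> 0^'+] --> (0 : R).
  by apply: (cvg_integral_vanishing (mD i) (bD i)); exact: vA.
(* After telescoping, the i-th term carries the vanishing integral [r e i] in coordinate i and a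
   full mass pi in each of the n - 1 others; for n = 0 the sum is empty, so the truncated [n.-1] is
   harmless. *)
pose b e := 2 * (C * (1 + B) ^+ n * \sum_i (r e i * pi ^+ n.-1)).
apply: (@squeeze_cvgr _ _ _ _ (fun=> 0) b); last 2 first.
- exact: cvg_cst.
- rewrite [X in _ --> X](_ : 0 = 2 * (C * (1 + B) ^+ n * \sum_(i < n) (0 * pi ^+ n.-1))); last first.
    by rewrite big1 ?mulr0// => i _; rewrite mul0r.
  apply: cvgMr; apply: cvgMr.
  apply: cvg_big => [|i _]; first exact: add_continuous.
  exact: cvgMl.
near=> e.
have e0 : 0 < e by [].
rewrite cabs_ge0/=.
have [lb [Ce lad]] := ladP e e0.
have := ladder_heaviside lad.
rewrite -/(u e n _) uE (_ : e *: row_of _ = 0); last first.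
  by apply/rowP => i; rewrite !mxE tnth_mktuple mulr0.
rewrite phi0 => one.
have intA : cintegrable (lam n) (fun t => \prod_i A w i (tnth t i) * u e 0%N t).
  have [m bb _ _] := lad.
  apply: (cintegrable_ktuple (C := B ^+ n * Ce)).
    by apply: cmeasurableM; [exact: cmeasurable_tuple_prod|exact: mu0].
  by move=> t; apply: cabs_weighted => //; exact: bb.
have intH : cintegrable (lam n) (fun t => \prod_i heaviside (tnth t i) * u e 0%N t).
  have [m bb _ _] := lad.
  apply: (cintegrable_ktuple (C := 1 ^+ n * Ce)).
    apply: cmeasurableM; last exact: mu0.
    by apply: (cmeasurable_tuple_prod (F := fun=> @heaviside R)) => i; exact: cmeasurable_heaviside.
  by move=> t; apply: (cabs_weighted (F := fun=> @heaviside R)); [move=> i x; exact: cabs_heaviside|exact: bb].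
(* By [one], the expected limit is itself an integral against the same weight, with Heaviside
   multiples in place of the primitives; the error is then one integral. *)
have -> : fresnel_reg hbar phi (wave w) e - \prod_i a i = (-1) ^+ n * cintegral (lam n)
   (fun t => \prod_i A w i (tnth t i) * u e 0%N t -
     \prod_i a i * (\prod_i heaviside (tnth t i) * u e 0%N t)).
  rewrite cintegralB//; last exact: cintegrableZ.
  rewrite cintegralZ// regE// mulrBr; congr (_ - _).
  by rewrite mulrCA -[LHS]mulr1; congr (_ * _).
rewrite cabsM cabsX cabsN cabs1 expr1n mul1r.
(* Puts the i-th telescoping term in product form, so that its integral factors over the
   coordinates. *)
pose g i (j : 'I_n) x := if j == i then D j x else 1.
have gP i : (lam n).-integrable setT (EFin \o (fun t => \prod_j (g i j (tnth t j) * (e * kern (e * tnth t j))))) /\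
    Rintegral (lam n) setT (fun t => \prod_j (g i j (tnth t j) * (e * kern (e * tnth t j)))) =
    r e i * pi ^+ n.-1.
  have [] := ktu e (g i) e0 _ _.
  - by move=> j; rewrite /g; case: eqP.
  - exists (B + 1) => j x; rewrite /g; case: eqP => // _.
    by rewrite ler01 lerDr B0.
  move=> h1 ->; split => //; rewrite (bigD1 i)//= {1}/g eqxx; congr (_ * _).
  rewrite (eq_bigr (fun=> pi)); last first.
    move=> j ji; rewrite /g (negbTE ji); under eq_fun do rewrite mul1r.
    by have [] := kint e e0.
  by rewrite prodr_const cardC1 card_ord.
pose dom t := C * (1 + B) ^+ n * \sum_i \prod_j (g i j (tnth t j) * (e * kern (e * tnth t j))).
have domi : (lam n).-integrable setT (EFin \o dom) /\
   Rintegral (lam n) setT dom = C * (1 + B) ^+ n * \sum_i (r e i * pi ^+ n.-1).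
  have [isum isumE] := integrable_bigsum (m := lam n) (index_enum 'I_n) (fun i => (gP i).1).
  split.
    have := integrableZl measurableT (C * (1 + B) ^+ n) isum.
    by under eq_fun do rewrite -EFinM.
  rewrite /dom RintegralZl//; congr (_ * _); rewrite isumE.
  by apply: eq_bigr => i _; have [] := gP i.
have [di dv] := domi.
rewrite /b -dv; apply: cabs_cintegral_le => //.
  apply: cmeasurableB; first by have [] := cintegrable_cmeasurable intA.
  by have [] := cintegrable_cmeasurable (cintegrableZ (\prod_i a i) intH).
move=> t; rewrite mulrA -mulrBl -big_split/= cabsM.
have lbt : cabs (u e 0%N t) <= C * \prod_i (e * kern (e * tnth t i)).
  by have := lb t; rewrite /u subn0.
have h1 : cabs (\prod_i A w i (tnth t i) - \prod_i (a i * heaviside (tnth t i))) <=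
    (1 + B) ^+ n * \sum_i D i (tnth t i).
  apply: cabs_prodB; first by rewrite lerDl.
    by move=> i; apply: le_trans (bA _ _ _) _; rewrite lerDr.
  by move=> i; apply: le_trans (ba _ _) _; rewrite lerDl.
apply: le_trans (ler_pM (cabs_ge0 _) (cabs_ge0 _) h1 lbt) _.
have E : \sum_i \prod_j (g i j (tnth t j) * (e * kern (e * tnth t j))) =
    (\sum_i D i (tnth t i)) * \prod_i (e * kern (e * tnth t i)).
  rewrite mulr_suml; apply: eq_bigr => i _.
  rewrite big_split/=; congr (_ * _).
  by rewrite (bigD1 i)//= {1}/g eqxx big1 ?mulr1// => j ji; rewrite /g (negbTE ji).
by rewrite /dom E le_eqVlt; apply/orP; left; apply/eqP; ring.
Unshelve. all: by end_near. Qed.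

End plane_waves.

(** * Integrals against test functions and tempered distributions *)

Section test_functions.
Variables (R : realType) (n : nat).
Notation M := (measurableTypeR R).
Notation lam := (lebesgue_tuple R n).
Implicit Types (F h : 'rV[R]_n -> R[i]).

(** The integral of a nonnegative function is a supremum over the simple functions below it, so
    monotonicity holds without measurability. *)
Lemma ge0_le_integral_nonmeasurable d (T : measurableType d) (m : {measure set T -> \bar R})
    (f g : T -> \bar R) : (forall x, 0 <= f x)%E -> (forall x, f x <= g x)%E ->
  (\int[m]_x f x <= \int[m]_x g x)%E.
Proof.
move=> f0 fg; rewrite !ge0_integralTE//; last by move=> x; exact: le_trans (fg x).
by apply: le_ereal_sup => _ [h hf <-]; exists h => // x; exact: le_trans (fg x).
Qed.

(** An explicit majorant is kept because it is inherited unchanged by products with functions of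
    modulus 1 and dominates uniformly over all plane waves. *)
Definition absolutely_integrable h := cmeasurable (fun t : n.-tuple M => h (row_of t)) /\
  exists2 g, lam.-integrable setT (EFin \o g) & forall t : n.-tuple M, cabs (h (row_of t)) <= g t.

Lemma absolutely_integrable_bounded F h K : continuous F -> (forall x, cabs (F x) <= K) ->
  absolutely_integrable h -> cintegrable lam (fun t => F (row_of t) * h (row_of t)).
Proof.
move=> cF FK [mh [g gi hg]].
apply: (cintegrable_dom (g := fun t => K * g t)).
- by apply: cmeasurableM => //; exact: cmeasurable_row_of.
- by have := integrableZl measurableT K gi; under eq_fun do rewrite -EFinM.
- by move=> t; rewrite cabsM; apply: ler_pM; rewrite ?cabs_ge0.
Qed.

Lemma absolutely_integrable_unimodular h k :
  (forall x, cabs (k x) = 1) -> cmeasurable (fun t : n.-tuple M => k (row_of t)) ->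
  absolutely_integrable h -> absolutely_integrable (fun x => k x * h x).
Proof.
move=> k1 mk [mh [g gi hg]]; split; first exact: cmeasurableM.
by exists g => // t; rewrite cabsM k1 mul1r.
Qed.

Lemma schwartz_absolutely_integrable phi (e : R) : schwartz phi -> 0 < e ->
  absolutely_integrable (fun x => phi (e *: x)).
Proof.
move=> sphi e0; have [m [C phiC]] := schwartz_scaled sphi e0; split => //.
by exists (fun t => C * ktuple t) => //; exact: integrable_ktuple.
Qed.

Lemma cmeasurable_expi_dotr (c : R) (xi : 'rV[R]_n) :
  cmeasurable (fun t : n.-tuple M => expi (c * dotr xi (row_of t))).
Proof.
have mt i : measurable_fun setT (fun t : n.-tuple M => row_of t 0 i).
  by under eq_fun do rewrite row_ofE; exact: measurable_tnth.
apply: cmeasurable_expi; apply: measurable_funM => //; rewrite /dotr; apply: measurable_sum => i.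
exact: measurable_funM.
Qed.

Lemma cmeasurable_expi_dotrr (c : R) :
  cmeasurable (fun t : n.-tuple M => expi (c * dotr (row_of t) (row_of t))).
Proof.
have mt i : measurable_fun setT (fun t : n.-tuple M => row_of t 0 i).
  by under eq_fun do rewrite row_ofE; exact: measurable_tnth.
apply: cmeasurable_expi; apply: measurable_funM => //; rewrite /dotr; apply: measurable_sum => i.
exact: measurable_funM.
Qed.

Lemma gaussian_shiftE (x : 'rV[R]_n) (t : n.-tuple M) : conjc (gaussian (row_of t - x)) =
  \prod_i (poly_gauss 1 (tnth t i - x 0 i))%:C.
Proof.
rewrite /gaussian /gauss_tensor -rmorph_prod/= /conjc/= oppr0; congr (_ %:C).
by apply: eq_bigr => i _; rewrite !mxE.
Qed.

Lemma gaussian_absolutely_integrable (x : 'rV[R]_n) :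
  absolutely_integrable (fun y => conjc (gaussian (y - x))).
Proof.
have [C CP] := poly_gauss_kern (1 : {poly R}).
have C0 : 0 <= C.
  by have := le_trans (normr_ge0 _) (CP 0); rewrite pmulr_lge0// kern_gt0.
split.
  under eq_fun do rewrite gaussian_shiftE.
  apply: (cmeasurable_tuple_prod (F := fun i (s : M) => (poly_gauss 1 (s - x 0 i))%:C)) => i.
  apply: cmeasurable_real; apply: continuous_measurable_fun => s.
  apply: (@continuous_comp _ _ _ (fun s : R => s - x 0 i) (poly_gauss 1)).
    by apply: cvgB; [exact: cvg_id|exact: cvg_cst].
  exact: continuous_poly_gauss.
exists (fun t => \prod_i (C * kern (tnth t i - x 0 i))).
  have [] := integrable_tuple_prod (g := fun (i : 'I_n) s => C * kern (s - x 0 i)) _ _.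
  - by move=> i s; rewrite mulr_ge0 ?kern_ge0.
  - move=> i; have [ki _] := integral_kern_affine (- x 0 i) ltr01.
    have := integrableZl measurableT C ki.
    by under eq_fun do rewrite -EFinM !mul1r.
  - by [].
move=> t; rewrite gaussian_shiftE cabs_prod; apply: ler_prod => i _.
by rewrite cabs_ge0 cabs_real CP.
Qed.

Lemma stft_window_absolutely_integrable hbar (x xi : 'rV[R]_n) :
  absolutely_integrable (fun y => expi (- (hbar^-1 * dotr xi y)) * conjc (gaussian (y - x))).
Proof.
apply: absolutely_integrable_unimodular; last exact: gaussian_absolutely_integrable.
  by move=> y; exact: cabs_expi.
have := cmeasurable_expi_dotr (- hbar^-1) xi.
by under eq_fun do rewrite mulNr.
Qed.

Lemma tempered_distr_of F K : continuous F -> (forall x, cabs (F x) <= K) ->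
  tempered (distr_of F).
Proof.
move=> cF FK.
have K0 : 0 <= K := le_trans (cabs_ge0 _) (FK 0).
have ai phi : schwartz phi -> absolutely_integrable phi.
  move=> sphi; have := schwartz_absolutely_integrable sphi ltr01.
  by under eq_fun do rewrite scale1r.
split.
  move=> c phi psi sphi spsi; rewrite /distr_of /cintegral_Rn.
  have iphi := absolutely_integrable_bounded cF FK (ai _ sphi).
  have ipsi := absolutely_integrable_bounded cF FK (ai _ spsi).
  rewrite -cintegralZ// -cintegralD//; last exact: cintegrableZ.
  by apply: eq_cintegral => t; rewrite mulrDr mulrCA.
(* [schwartz_decay] without derivatives involves two seminorms, of orders 0 and 2 n, hence the inner
   2; pi^n is the mass of [ktuple], and the outer 2 comes from [cabs_cintegral_le]. *)
exists (2 * n)%N, (2 * (K * (2 ^+ n * 2)) * pi ^+ n) => phi sphi.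
set S := \sum_(k < _) _.
have S1 k : (k <= 2 * n)%N -> schwartz_seminorm k [::] phi <= S.
  move=> kn; rewrite /S (bigD1 (Ordinal (kn : (k < (2 * n).+1)%N)))//=.
  rewrite (bigD1 (@ord0 (2 * n)))//= (bigD1 [tuple])//=.
  rewrite -!addrA lerDl !addr_ge0//; repeat (apply: sumr_ge0 => ? _); exact: schwartz_seminorm_ge0.
have dec (t : n.-tuple M) : cabs (F (row_of t) * phi (row_of t)) <= K * (2 ^+ n * 2) * S * ktuple t.
  rewrite cabsM -!mulrA; apply: ler_pM; rewrite ?cabs_ge0//.
  have := schwartz_decay [::] (row_of t) sphi; rewrite cpartial_nil => /le_trans; apply.
  under eq_bigr do rewrite row_ofE.
  rewrite -!mulrA ler_wpM2l ?exprn_ge0// mulrA ler_wpM2r ?ktuple_ge0//.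
  by rewrite mulr_natl mulr2n; apply: lerD; apply: S1.
rewrite /distr_of /cintegral_Rn.
have bnd : cabs (cintegral lam (fun t => F (row_of t) * phi (row_of t))) <=
    2 * Rintegral lam setT (fun t => K * (2 ^+ n * 2) * S * ktuple t).
  apply: cabs_cintegral_le => //; last exact: integrable_ktuple.
  apply: cmeasurableM; first exact: cmeasurable_row_of.
  by have [] := ai _ sphi.
apply: le_trans bnd _.
rewrite RintegralZl//; last first.
  by have := @integrable_ktuple R n 1; under eq_fun do rewrite mul1r.
have -> : Rintegral lam setT (@ktuple R n) = pi ^+ n.
  have [ki kv] := integral_kern_affine (R := R) 0 ltr01.
  have [] := integrable_tuple_prod (g := fun (i : 'I_n) (x : R) => kern x) _ _.
  - by move=> i x; exact: kern_ge0.
  - by move=> i; exact: integrable_kern.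
  move=> _; rewrite /ktuple => ->.
  rewrite (eq_bigr (fun=> pi)) ?prodr_const ?card_ord// => i _.
  by rewrite -kv; under [in RHS]eq_fun do rewrite mul1r mul1r addr0.
by rewrite le_eqVlt; apply/orP; left; apply/eqP; ring.
Qed.

End test_functions.

(** * A linear class inside M^{oo,1} with a known Fresnel integral *)

Section fresnel_class.
Variables (R : realType) (hbar : R) (n : nat).
Notation M := (measurableTypeR R).
Notation lam := (lebesgue_tuple R n).
Implicit Types (F : 'rV[R]_n -> R[i]) (l : R[i]).

(* A condition sufficient for a Fresnel-summable symbol in M^{oo,1} and stable
   under linear combinations: the supremum in the definition of M^{oo,1} need
   not be measurable, so it is replaced by an integrable upper bound. *)
Definition fresnel_class F l := [/\ continuous F, exists K, forall x, cabs (F x) <= K,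
  forall phi, schwartz phi -> phi 0 = 1 -> fresnel_reg hbar phi F e @[e --> 0^'+] --> l &
  exists2 G, lam.-integrable setT (EFin \o G) & forall x (t : n.-tuple M),
    cabs (stft hbar (@gaussian R n) (distr_of F) x (row_of t)) <= G t].

Lemma fresnel_class_lin F1 F2 l1 l2 c : fresnel_class F1 l1 -> fresnel_class F2 l2 ->
  fresnel_class (fun x => c * F1 x + F2 x) (c * l1 + l2).
Proof.
move=> [c1 [K1 b1] r1 [G1 g1 d1]] [c2 [K2 b2] r2 [G2 g2 d2]].
(* Both [fresnel_reg] and [stft] are integrals of F against an absolutely integrable h, so this
   linearity serves the last two conditions. *)
have lin h : absolutely_integrable h -> cintegral_Rn (fun x => (c * F1 x + F2 x) * h x) =
    c * cintegral_Rn (fun x => F1 x * h x) + cintegral_Rn (fun x => F2 x * h x).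
  move=> ih; have i1 := absolutely_integrable_bounded c1 b1 ih.
  have i2 := absolutely_integrable_bounded c2 b2 ih.
  rewrite /cintegral_Rn -cintegralZ// -cintegralD//; last exact: cintegrableZ.
  by apply: eq_cintegral => t; rewrite mulrDl mulrA.
split.
- by move=> x; have := cvgD (cvgMr (a := c) (c1 x)) (c2 x); exact.
- exists (cabs c * K1 + K2) => x; apply: le_trans (ler_cabsD _ _) _.
  by rewrite lerD// cabsM ler_wpM2l ?cabs_ge0.
- move=> phi sphi phi0.
  apply: (cvg_trans _ (cvgD (cvgMr (a := c) (r1 phi sphi phi0)) (r2 phi sphi phi0))).
  apply: near_eq_cvg; near=> e.
  have e0 : 0 < e by [].
  change (c * fresnel_reg hbar phi F1 e + fresnel_reg hbar phi F2 e =
    fresnel_reg hbar phi (fun x => c * F1 x + F2 x) e).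
  rewrite /fresnel_reg.
  have E F : cintegral_Rn (fun x => expi ((2 * hbar)^-1 * dotr x x) * F x * phi (e *: x)) =
      cintegral_Rn (fun x => F x * (expi ((2 * hbar)^-1 * dotr x x) * phi (e *: x))).
    by congr cintegral_Rn; apply/funext => x; ring.
  rewrite !E lin; first by ring.
  apply: absolutely_integrable_unimodular; last exact: schwartz_absolutely_integrable.
    by move=> x; exact: cabs_expi.
  exact: cmeasurable_expi_dotrr.
- exists (fun t => cabs c * G1 t + G2 t).
    have := integrableD measurableT (integrableZl measurableT (cabs c) g1) g2.
    by under eq_fun do rewrite /= -EFinM -EFinD.
  move=> x t; rewrite /stft /distr_of lin; last exact: stft_window_absolutely_integrable.
  rewrite mulrDr mulrCA; apply: le_trans (ler_cabsD _ _) _; apply: lerD; last exact: d2.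
  by rewrite cabsM ler_wpM2l ?cabs_ge0//; exact: d1.
Unshelve. all: by end_near. Qed.

Lemma fresnel_class_modulation F l : fresnel_class F l -> modulation hbar F.
Proof.
move=> [cF [K FK] _ [G iG FG]]; split; [by []|by exists K|].
split; first exact: tempered_distr_of FK.
exists (@gaussian R n); split.
- exact: schwartz_gaussian.
- by exists 0; rewrite gaussian0 oner_neq0.
- rewrite /eintegral_Rn.
  have G0 t : 0 <= G t by apply: le_trans (FG 0 t); exact: cabs_ge0.
  apply: (@le_lt_trans _ _ (\int[lam]_t (G t)%:E)%E); last first.
    exact: integrable_lty.
  apply: ge0_le_integral_nonmeasurable => t.
    apply: (@le_trans _ _ (cabs (stft hbar (@gaussian R n) (distr_of F) 0 (row_of t)))%:E).
      by rewrite lee_fin cabs_ge0.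
    by apply: ereal_sup_ubound; exists 0.
  by apply: ge_ereal_sup => _ [x _ <-]; rewrite lee_fin.
Qed.

(** [xget] requires a unique candidate; any two agree because both are the limit for the Gaussian
    regularization. *)
Lemma fresnel_class_fresnel F l : fresnel_class F l -> fresnel hbar F = l.
Proof.
move=> [_ _ Fl _]; rewrite /fresnel.
apply: xget_unique => //= l' Fl'.
have := Fl _ (@schwartz_gaussian R n) (gaussian0 R n).
have := Fl' _ (@schwartz_gaussian R n) (gaussian0 R n).
move=> h1 h2; apply: (cvg_unique _ h1 h2).
exact: norm_hausdorff.
Qed.

End fresnel_class.

(** * Fourier transforms of finite positive measures *)

Section fourier_transform.
Variables (R : realType) (hbar : R).
Hypothesis hbar_gt0 : 0 < hbar.
Context d (T : measurableType d) (nu : {finite_measure set T -> \bar R}).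
Variables (n : nat) (w : T -> 'I_n -> R).
Hypothesis mw : forall i, measurable_fun setT (fun z => w z i).
Notation M := (measurableTypeR R).
Notation leb := (@lebesgue_measure R).
Notation lam := (lebesgue_tuple R n).
Implicit Types (x xi : 'rV[R]_n).

(** The Fourier transform of the image of [nu] under [w], written on T; later T is ell2 and [w]
    lists the first n coordinates. *)
Definition fourier x : R[i] := cintegral nu (fun z => wave (w z) x).

Lemma cintegrable_bounded (f : T -> R[i]) (C : R) : cmeasurable f ->
  (forall z, cabs (f z) <= C) -> cintegrable nu f.
Proof.
move=> mf fC; apply: (cintegrable_dom mf _ fC).
exact: finite_measure_integrable_cst.
Qed.

Lemma cmeasurable_wave x : cmeasurable (fun z => wave (w z) x).
Proof.
apply: cmeasurable_expi; apply: measurable_sum => i.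
by apply: measurable_funM => //; exact: measurable_cst.
Qed.

Lemma cabs_fourier_transform_le x : cabs (fourier x) <= 2 * fine (nu setT).
Proof.
have h : cabs (fourier x) <= 2 * Rintegral nu setT (fun=> 1).
  apply: cabs_cintegral_le.
  - exact: cmeasurable_wave.
  - exact: finite_measure_integrable_cst.
  - by move=> z; rewrite cabs_wave.
by rewrite Rintegral_cst// mul1r in h.
Qed.

Lemma continuous_wave v : continuous (@wave R n v).
Proof.
have cs : continuous (fun x : 'rV[R]_n => \sum_i x 0 i * v i).
  move=> x; have h (i : 'I_n) : (true : bool) -> (y : 'rV[R]_n) 0 i * v i @[y --> x] --> x 0 i * v i.
    by move=> _; have h := @coord_continuous R 1 n 0 i x; have := cvgMl (b := v i) h; exact.
  exact: (cvg_big (@add_continuous R) (P := xpredT) (Ff := fun i (y : 'rV[R]_n) => y 0 i * v i) (nbhs_filter x) h).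
move=> x; apply/(cvg_ReImP (nbhs_filter x)); split.
  apply: (@continuous_comp _ _ _ (fun x : 'rV[R]_n => \sum_i x 0 i * v i) (@cos R)); first exact: cs.
  exact: continuous_cos.
apply: (@continuous_comp _ _ _ (fun x : 'rV[R]_n => \sum_i x 0 i * v i) (@sin R)); first exact: cs.
exact: continuous_sin.
Qed.

(** Dominated convergence is sequential, so a failure of continuity is first turned into points
    within 1 / (k + 1) of x whose values stay away from the value at x. *)
Lemma continuous_fourier : continuous fourier.
Proof.
move=> x; apply/(cvg_cabsP (nbhs_filter x)); apply/cvgrPdist_lt => e e0.
apply/nbhs_ballP; apply: contrapT => nP.
have h (k : nat) : exists y, ball x k.+1%:R^-1 y /\ e <= cabs (fourier y - fourier x).
  apply: contrapT => nh; apply: nP; exists k.+1%:R^-1; first by rewrite /= invr_gt0.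
  move=> y xy /=; rewrite sub0r normrN ger0_norm ?cabs_ge0// ltNge; apply/negP => ey.
  by apply: nh; exists y.
pose y k := projT1 (cid (h k)).
have yx : y k @[k --> \oo] --> x.
  apply/cvg_ballP => r r0; near=> k.
  have [hk _] := projT2 (cid (h k)).
  apply: le_ball hk; apply: ltW; near: k.
  exact: (near_infty_natSinv_lt (PosNum r0)).
have : fourier (y k) @[k --> \oo] --> fourier x.
  apply: (cintegral_dct (m := nu) (g := fun=> 1)).
  - by move=> k; exact: cmeasurable_wave.
  - move=> z; apply: (cvg_comp _ _ yx); exact: continuous_wave.
  - exact: finite_measure_integrable_cst.
  - by move=> k z; rewrite cabs_wave.
move=> /(cvg_cabsP _)/cvgrPdist_lt /(_ e e0) [k _ /(_ k (leqnn k))] /=.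
rewrite sub0r normrN ger0_norm ?cabs_ge0// ltNge => /negP; apply.
by have [_ hk] := projT2 (cid (h k)).
Unshelve. all: by end_near. Qed.

(** Fubini, justified because plane waves have modulus 1 and [nu] is finite; it transfers
    regularized Fresnel integrals and short-time Fourier transforms from plane waves to
    superpositions. *)
Lemma cintegral_fourier (h : 'rV[R]_n -> R[i]) : absolutely_integrable h ->
  cintegrable nu (fun z => cintegral_Rn (fun x => wave (w z) x * h x)) /\
  cintegral_Rn (fun x => fourier x * h x) =
    cintegral nu (fun z => cintegral_Rn (fun x => wave (w z) x * h x)).
Proof.
move=> [mh [g gi hg]].
pose f (p : n.-tuple M * T) := wave (w p.2) (row_of p.1) * h (row_of p.1).
have mwave : cmeasurable (fun p : n.-tuple M * T => wave (w p.2) (row_of p.1)).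
  apply: cmeasurable_expi; apply: measurable_sum => i.
  under eq_fun do rewrite row_ofE.
  apply: measurable_funM.
    by apply: (measurableT_comp (measurable_tnth i)); exact: measurable_fst.
  by apply: (measurableT_comp (mw i)); exact: measurable_snd.
have mf : cmeasurable f.
  apply: cmeasurableM => //.
  by apply: (cmeasurable_comp (f := fun t : n.-tuple M => h (row_of t))).
have g0 t : 0 <= g t := le_trans (cabs_ge0 _) (hg t).
have i1 : nu.-integrable setT (EFin \o (fun=> 1)) by exact: finite_measure_integrable_cst.
have [gI _] := integrable_prod (m1 := lam) (m2 := nu) g0 (fun=> ler01) gi i1.
have fi : cintegrable (lam \x nu)%E f.
  apply: (cintegrable_dom mf gI) => p.
  by rewrite /f cabsM cabs_wave mul1r mulr1.
have s1 t : cintegrable nu (fun z => f (t, z)).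
  apply: (cintegrable_bounded (C := g t)) => [|z].
    have := cmeasurableM (cmeasurable_wave (row_of t)) (@cmeasurable_cst _ T R (h (row_of t))); exact.
  by rewrite /f cabsM cabs_wave mul1r.
have s2 z : cintegrable lam (fun t => f (t, z)).
  apply: (absolutely_integrable_bounded (continuous_wave (v := w z)) (K := 1)).
    by move=> x; rewrite cabs_wave.
  by split => //; exists g.
have [_ e1] := cintegral_fubini1 fi s1.
have [c2 e2] := cintegral_fubini2 fi s2.
split; first exact: c2.
rewrite -[RHS]e2 e1; apply: eq_cintegral => t.
rewrite mulrC -cintegralZ; last first.
  by apply: (cintegrable_bounded (C := 1)) => [|z]; [exact: cmeasurable_wave|rewrite cabs_wave].
by apply: eq_cintegral => z; rewrite mulrC.
Qed.

Lemma cvg_fresnel_reg_fourier phi : schwartz phi -> phi 0 = 1 ->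
  fresnel_reg hbar phi fourier e @[e --> 0^'+] -->
  cintegral nu (fun z => expi (- (hbar / 2 * \sum_i w z i ^+ 2))).
Proof.
move=> sphi phi0.
have [C bC lim] := cvg_fresnel_reg_wave hbar_gt0 sphi.
have E e : 0 < e -> cintegrable nu (fun z => fresnel_reg hbar phi (wave (w z)) e) /\
    fresnel_reg hbar phi fourier e = cintegral nu (fun z => fresnel_reg hbar phi (wave (w z)) e).
  move=> e0.
  have ai : absolutely_integrable (fun x => expi ((2 * hbar)^-1 * dotr x x) * phi (e *: x)).
    apply: absolutely_integrable_unimodular; last exact: schwartz_absolutely_integrable.
      by move=> x; exact: cabs_expi.
    exact: cmeasurable_expi_dotrr.
  have [i1 e1] := cintegral_fourier ai.
  have E F : cintegral_Rn (fun x => expi ((2 * hbar)^-1 * dotr x x) * F x * phi (e *: x)) =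
      cintegral_Rn (fun x => F x * (expi ((2 * hbar)^-1 * dotr x x) * phi (e *: x))).
    by congr cintegral_Rn; apply/funext => x; ring.
  have E2 : (fun z => fresnel_reg hbar phi (wave (w z)) e) = (fun z =>
      (planck_factor hbar n)%:C * expi (- (pi * n%:R / 4)) *
      cintegral_Rn (fun x => wave (w z) x * (expi ((2 * hbar)^-1 * dotr x x) * phi (e *: x)))).
    by apply/funext => z; rewrite /fresnel_reg E.
  rewrite E2; split; first exact: cintegrableZ.
  by rewrite cintegralZ// -e1 /fresnel_reg E.
(* The limit at 0 from the right is tested along positive sequences, where dominated convergence
   applies with the constant [C], uniform in the frequency. *)
have seq_lim (u : R^nat) : (forall k, 0 < u k) /\ u k @[k --> \oo] --> 0 ->
    fresnel_reg hbar phi fourier (u k) @[k --> \oo] -->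
    cintegral nu (fun z => expi (- (hbar / 2 * \sum_i w z i ^+ 2))).
  move=> [u0 ulim].
  rewrite (_ : (fun k => _) = fun k => cintegral nu (fun z => fresnel_reg hbar phi (wave (w z)) (u k))); last first.
    by apply/funext => k; have [_ ->] := E _ (u0 k).
  apply: (cintegral_dct (m := nu) (g := fun=> C)).
  - by move=> k; have [/cintegrable_cmeasurable] := E _ (u0 k).
  - move=> z; have /(cvg_ReImP (at_right_proper_filter _)) [h1 h2] := lim phi0 (w z).
    by apply/cvg_ReImP; split; [move/cvg_at_rightP : h1; apply|move/cvg_at_rightP : h2; apply].
  - exact: finite_measure_integrable_cst.
  - by move=> k z; exact: bC.
apply/cvg_ReImP; split; apply/cvg_at_rightP => u hu.
  by have /cvg_ReImP[] := seq_lim u hu.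
by have /cvg_ReImP[] := seq_lim u hu.
Qed.

(** The integral factors over the coordinates. In each one, v only shifts the frequency and x only
    moves the centre of the window, to which [cabs_fourier_le] is insensitive; so the bound holds
    for the supremum over x. *)
Lemma cabs_stft_wave_le : exists C : R, 0 <= C /\ forall (v : 'I_n -> R) x (t : n.-tuple M),
  cabs (cintegral_Rn (fun y => wave v y *
     (expi (- (hbar^-1 * dotr (row_of t) y)) * conjc (gaussian (y - x))))) <=
  C * \prod_i kern (hbar^-1 * tnth t i - v i).
Proof.
have [C0 CP0] := poly_gauss_kern (1 : {poly R}).
have [C1 CP1] := poly_gauss_kern (dpoly_gauss (1 : {poly R})).
have [C2 CP2] := poly_gauss_kern (dpoly_gauss (dpoly_gauss (1 : {poly R}))).
have pos (c : R) p : (forall s, `|poly_gauss p s| <= c * kern s) -> 0 <= c.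
  by move=> h; have := le_trans (normr_ge0 _) (h 0); rewrite pmulr_lge0// kern_gt0.
have C00 := pos _ _ CP0; have C10 := pos _ _ CP1; have C20 := pos _ _ CP2.
(* A common constant for the Gaussian and its first two derivatives. *)
pose C := C0 + C1 + C2.
have CP p (c : R) b s : (forall s, `|poly_gauss p s| <= c * kern s) -> c <= C ->
    cabs (poly_gauss p (s - b))%:C <= C * kern (s - b).
  move=> h cC; rewrite cabs_real; apply: le_trans (h _) _.
  by rewrite ler_wpM2r ?kern_ge0.
have dp (p : {poly R}) b : cderive (fun s => (poly_gauss p (s - b))%:C) (fun s => (poly_gauss (dpoly_gauss p) (s - b))%:C).
  move=> s; split; last exact: is_derive_const.
  have da : is_derive s (1 : R) (fun s => s - b) 1.
    have := is_derive_affine 1 (- b) s.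
    by under eq_fun do rewrite mul1r.
  have := is_derive_chain (g := fun s => s - b) (is_derive_poly_gauss p (s - b)) da.
  by rewrite mulr1.
pose F (v : 'I_n -> R) (x : 'rV[R]_n) (t : n.-tuple M) i s :=
  expi (- ((hbar^-1 * tnth t i - v i) * s)) * (poly_gauss 1 (s - x 0 i))%:C.
have FP v x t i : cintegrable leb (F v x t i : M -> R[i]) /\
    cabs (cintegral leb (F v x t i)) <= 4 * pi * C * kern (hbar^-1 * tnth t i - v i).
  apply: (cabs_fourier_le (b := - x 0 i) (u := fun s => (poly_gauss 1 (s - x 0 i))%:C) _ (dp 1 (x 0 i))
    (dp _ (x 0 i)) (cderive_ccontinuous (dp _ (x 0 i)))).
  - by move=> s; apply: CP CP0 _; rewrite /C; lra.
  - by move=> s; apply: CP CP1 _; rewrite /C; lra.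
  - by move=> s; apply: CP CP2 _; rewrite /C; lra.
exists ((4 * pi * C) ^+ n); split.
  by rewrite exprn_ge0// !mulr_ge0 ?pi_ge0// !addr_ge0.
move=> v x t.
have -> : cintegral_Rn (fun y => wave v y *
     (expi (- (hbar^-1 * dotr (row_of t) y)) * conjc (gaussian (y - x)))) =
    cintegral lam (fun s => \prod_i F v x t i (tnth s i)).
  apply: eq_cintegral => s; rewrite gaussian_shiftE mulrA big_split/=; congr (_ * _).
  rewrite /wave -expiD -expi_sum; congr expi.
  rewrite /dotr mulr_sumr -sumrB; apply: eq_bigr => i _; rewrite !row_ofE; ring.
rewrite (cintegral_tuple_prod (g := fun i s => C * kern (s - x 0 i))); last 3 first.
- by move=> i; have [/cintegrable_cmeasurable] := FP v x t i.
- move=> i; have [ki _] := integral_kern_affine (- x 0 i) ltr01.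
  have := integrableZl measurableT C ki.
  by under eq_fun do rewrite -EFinM !mul1r.
- by move=> i s; rewrite /F cabsM cabs_expi mul1r; apply: CP CP0 _; rewrite /C; lra.
rewrite cabs_prod.
apply: (@le_trans _ _ (\prod_i (4 * pi * C * kern (hbar^-1 * tnth t i - v i)))).
  by apply: ler_prod => i _; rewrite cabs_ge0; have [_ ->] := FP v x t i.
by rewrite big_split/= prodr_const card_ord.
Qed.

(** By Tonelli with the integration over t inside: a change of scale gives each slice the mass (hbar
    pi)^n, a constant that is integrable for a finite measure. *)
Lemma integrable_fourier_majorant :
  lam.-integrable setT (EFin \o (fun t =>
    Rintegral nu setT (fun z => \prod_i kern (hbar^-1 * tnth t i - w z i)))).
Proof.
pose f (p : n.-tuple M * T) := \prod_i kern (hbar^-1 * tnth p.1 i - w p.2 i).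
have f0 p : 0 <= f p by apply: prodr_ge0 => i _; exact: kern_ge0.
have mf : measurable_fun setT f.
  apply: measurable_prodr => i.
  apply: (measurableT_comp (@measurable_kern R)).
  apply: measurable_funB; last by apply: (measurableT_comp (mw i)); exact: measurable_snd.
  apply: measurable_funM => //.
  by apply: (measurableT_comp (measurable_tnth i)); exact: measurable_fst.
have slice z : lam.-integrable setT (EFin \o (fun t => f (t, z))) /\
   Rintegral lam setT (fun t => f (t, z)) = (hbar * pi) ^+ n.
  have hP i : leb.-integrable setT (EFin \o (fun s => kern (hbar^-1 * s - w z i))) /\
     Rintegral leb setT (fun s => kern (hbar^-1 * s - w z i)) = hbar * pi.
    have hi : 0 < hbar^-1 by rewrite invr_gt0.
    have [k1 k2] := integral_kern_affine (- w z i) hi.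
    have E : (fun s => kern (hbar^-1 * s - w z i)) = fun s => hbar * (hbar^-1 * kern (hbar^-1 * s - w z i)).
      by apply/funext => s; rewrite mulrA divff ?mul1r// gt_eqF.
    rewrite E; split; last by rewrite RintegralZl// k2.
    by have := integrableZl measurableT hbar k1; under eq_fun do rewrite -EFinM.
  have [] := integrable_tuple_prod (g := fun i s => kern (hbar^-1 * s - w z i)) _ _.
  - by move=> i s; exact: kern_ge0.
  - by move=> i; have [] := hP i.
  move=> h1 h2; split => //; rewrite /f/= h2.
  by rewrite (eq_bigr (fun=> hbar * pi)) ?prodr_const ?card_ord// => i _; have [] := hP i.
have fi : (lam \x nu)%E.-integrable setT (EFin \o f).
  apply/integrable21ltyP; first exact/measurable_EFinP.
  have E z : (\int[lam]_t `|(EFin \o f) (t, z)|)%E = ((hbar * pi) ^+ n)%:E.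
    have [s1 <-] := slice z; rewrite /Rintegral fineK; last exact: integrable_fin_num.
    by apply: eq_integral => t _ /=; rewrite ger0_norm.
  under eq_integral do rewrite E.
  by apply: integrable_lty => //; exact: finite_measure_integrable_cst.
have [] := Rintegral_fubini1 fi _ => //.
move=> t; apply: (@le_integrable _ _ _ nu setT measurableT _ (EFin \o (fun=> 1))) => //.
- apply/measurable_EFinP; apply: measurable_prodr => i.
  apply: (measurableT_comp (@measurable_kern R)).
  by apply: measurable_funB => //; exact: (measurable_cst (hbar^-1 * tnth t i)).
- move=> z _ /=; rewrite lee_fin normr1 ger0_norm//.
  apply: (@le_trans _ _ (\prod_(i < n) 1)); last by rewrite big1.
  by apply: ler_prod => i _; rewrite kern_ge0 kern_le1.
- exact: finite_measure_integrable_cst.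
Qed.

Lemma fresnel_class_fourier : fresnel_class hbar fourier
  (cintegral nu (fun z => expi (- (hbar / 2 * \sum_i w z i ^+ 2)))).
Proof.
split.
- exact: continuous_fourier.
- by exists (2 * fine (nu setT)); exact: cabs_fourier_transform_le.
- exact: cvg_fresnel_reg_fourier.
- have [C [C0 CP]] := cabs_stft_wave_le.
  pose g t := Rintegral nu setT (fun z => \prod_i kern (hbar^-1 * tnth t i - w z i)).
  (* The first factor normalizes [stft], 2 comes from [cabs_cintegral_le], and [C] is the plane-wave
     constant. *)
  exists (fun t => planck_factor hbar n * 2 * C * g t).
    have := integrableZl measurableT (planck_factor hbar n * 2 * C) integrable_fourier_majorant.
    by under eq_fun do rewrite -EFinM.
  move=> x t; rewrite /stft cabsM cabs_real ger0_norm ?powR_ge0//.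
  rewrite -!mulrA ler_wpM2l ?powR_ge0//.
  have [i1 e1] := cintegral_fourier (stft_window_absolutely_integrable hbar x (row_of t)).
  rewrite /distr_of e1.
  have m1 : measurable_fun setT (fun z => \prod_i kern (hbar^-1 * tnth t i - w z i)).
    apply: measurable_prodr => i.
    apply: (measurableT_comp (@measurable_kern R)).
    by apply: measurable_funB => //; exact: (measurable_cst (hbar^-1 * tnth t i)).
  have gi : nu.-integrable setT (EFin \o (fun z => \prod_i kern (hbar^-1 * tnth t i - w z i))).
    apply: (@le_integrable _ _ _ nu setT measurableT _ (EFin \o (fun=> 1))) => //.
    - exact/measurable_EFinP.
    - move=> z _ /=; rewrite lee_fin normr1 ger0_norm//; last by apply: prodr_ge0 => i _; exact: kern_ge0.
      apply: (@le_trans _ _ (\prod_(i < n) 1)); last by rewrite big1.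
      by apply: ler_prod => i _; rewrite kern_ge0 kern_le1.
    - exact: finite_measure_integrable_cst.
  rewrite /g -RintegralZl//; apply: cabs_cintegral_le.
  - exact: cintegrable_cmeasurable i1.
  - by have := integrableZl measurableT C gi; under eq_fun do rewrite -EFinM.
  - by move=> z; exact: CP.
Qed.

End fourier_transform.

(** * Coordinates on ell2 and passage to complex measures *)

Section ell2_coordinates.
Variable R : realType.
Implicit Types (x y : ell2 R).

Lemma cvg_series_finite (u : nat -> R) n : (forall k, (n <= k)%N -> u k = 0) ->
  series u @ \oo --> \sum_(k < n) u k.
Proof.
move=> u0; apply: cvg_near_cst; near=> k.
have nk : (n <= k)%N by near: k; exact: nbhs_infty_ge.
rewrite /series/= (big_cat_nat (leq0n n) nk)/= [X in _ + X](_ : _ = 0) ?addr0 ?big_mkord//.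
rewrite big_nat_cond big1// => j /andP[/andP[nj _] _]; exact: u0.
Unshelve. all: by end_near. Qed.

Lemma extend0_nth n (x : 'rV[R]_n) (i : 'I_n) : extend0 x i = x 0 i.
Proof. by rewrite /extend0 valK. Qed.

Lemma extend0_ge n (x : 'rV[R]_n) k : (n <= k)%N -> extend0 x k = 0.
Proof. by move=> nk; rewrite /extend0 insubF// ltnNge nk. Qed.

Lemma extend0_ell2 n (x : 'rV[R]_n) : extend0 x \in ell2_seq R.
Proof.
rewrite inE /ell2_seq/=; apply/cvg_ex; exists (\sum_(k < n) extend0 x k ^+ 2).
by apply: cvg_series_finite => k nk; rewrite extend0_ge// expr0n.
Qed.

Lemma ell2_dot_extend0 n (x : 'rV[R]_n) (xl : extend0 x \in ell2_seq R) y :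
  ell2_dot (exist _ (extend0 x) xl) y = \sum_i x 0 i * sval y i.
Proof.
apply: cvg_lim => //=.
have -> : \sum_i x 0 i * sval y i = \sum_(k < n) extend0 x k * sval y k.
  by apply: eq_bigr => i _; rewrite extend0_nth.
by apply: cvg_series_finite => k nk; rewrite extend0_ge// mul0r.
Qed.

Lemma cvg_ell2_dot y : \sum_(i < n) sval y i ^+ 2 @[n --> \oo] --> ell2_dot y y.
Proof.
have /set_mem cy := svalP y.
have E : (fun n => \sum_(i < n) sval y i ^+ 2) = series (fun k => sval y k ^+ 2).
  by apply/funext => n; rewrite /series/= big_mkord.
rewrite E /ell2_dot (_ : (fun k => _ * _) = fun k => sval y k ^+ 2)//.
Qed.

(** A single term is at most the whole series of squares. This makes coordinates continuous, hence
    Borel. *)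
Lemma ell2_coord_dist x y k : `|sval x k - sval y k| <= ell2_dist x y.
Proof.
have /set_mem cx := svalP x; have /set_mem cy := svalP y.
(* Convergence, from (a - b)^2 <= 2 a^2 + 2 b^2, is what lets the [limn] inside [ell2_dist] be
   compared with partial sums. *)
have c : cvgn (series (fun k => (sval x k - sval y k) ^+ 2)).
  apply: (@series_le_cvg _ _ (fun k => 2 * sval x k ^+ 2 + 2 * sval y k ^+ 2)).
  - by move=> j; exact: sqr_ge0.
  - by move=> j; rewrite addr_ge0// mulr_ge0 ?sqr_ge0.
  - by move=> j; have := sqr_ge0 (sval x j + sval y j); nra.
  - rewrite (_ : series _ = (fun n => 2 * series (fun k => sval x k ^+ 2) n +
        2 * series (fun k => sval y k ^+ 2) n)).
      by apply: is_cvgD; apply: is_cvgMr.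
    by apply/funext => n; rewrite /series/= big_split/= !mulr_sumr.
rewrite -(sqrtr_sqr (sval x k - sval y k)) /ell2_dist; apply: ler_wsqrtr.
apply: limr_ge => //; near=> n.
have kn : (k < n)%N by near: n; exact: nbhs_infty_gt.
rewrite /series/= big_mkord (bigD1 (Ordinal kn))//= lerDl.
by apply: sumr_ge0 => i _; exact: sqr_ge0.
Unshelve. all: by end_near. Qed.

Lemma measurable_ell2_coord k : measurable_fun setT (fun y : ell2_borel R => sval y k).
Proof.
apply: (measurability _ (RGenOpens.measurableE R)).
move=> _ [_ [a [b ->]] <-]; rewrite setTI; apply: sub_sigma_algebra => x /=.
rewrite in_itv/= => /andP[ax xb].
exists (Num.min (sval x k - a) (b - sval x k)); first by rewrite lt_min !subr_gt0 ax.
move=> y xy; have := le_lt_trans (ell2_coord_dist x y k) xy.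
by rewrite lt_min !ltr_norml => /andP[/andP[h1 h2] /andP[h3 h4]]; rewrite in_itv/=; apply/andP; split; lra.
Qed.

End ell2_coordinates.

Lemma fresnel_class_ext (R : realType) (hbar : R) n (F F' : 'rV[R]_n -> R[i]) l l' :
  F =1 F' -> l = l' -> fresnel_class hbar F l -> fresnel_class hbar F' l'.
Proof. by move=> /funext -> ->. Qed.

Section cmeasure_integrals.
Variables (R : realType) (hbar : R).
Hypothesis hbar_gt0 : 0 < hbar.
Context d (T : measurableType d).

(** The integral is a fixed combination of four integrals against finite Jordan parts, for each of
    which the constant 1 is an integrable majorant. *)
Lemma cvg_cmeasure_integral (mu : complex_measure T R) (g_ : nat -> T -> R[i]) g :
  (forall n, cmeasurable (g_ n)) -> (forall n z, cabs (g_ n z) <= 1) ->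
  (forall z, g_ n z @[n --> \oo] --> g z) ->
  cmeasure_integral mu (g_ n) @[n --> \oo] --> cmeasure_integral mu g.
Proof.
move=> mg g1 gg.
have h (nu : {finite_measure set T -> \bar R}) :
    cintegral nu (g_ n) @[n --> \oo] --> cintegral nu g.
  by apply: (cintegral_dct mg gg _ g1); exact: finite_measure_integrable_cst.
rewrite /cmeasure_integral /charge_cintegral.
exact: (cvgD (cvgB (h _) (h _)) (cvgMr (a := 0 +i* 1) (cvgB (h _) (h _)))).
Qed.

Variables (n : nat) (w : T -> 'I_n -> R).
Hypothesis mw : forall i, measurable_fun setT (fun z => w z i).

Lemma fresnel_class_cmeasure (mu : complex_measure T R) :
  fresnel_class hbar (fun x => cmeasure_integral mu (fun z => wave (w z) x))
    (cmeasure_integral mu (fun z => expi (- (hbar / 2 * \sum_i w z i ^+ 2)))).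
Proof.
have charge (nu : {charge set T -> \bar R}) :
    fresnel_class hbar (fun x => charge_cintegral nu (fun z => wave (w z) x))
      (charge_cintegral nu (fun z => expi (- (hbar / 2 * \sum_i w z i ^+ 2)))).
  (* Naming the decomposition makes visible that the function and its claimed Fresnel integral use
     the same Jordan parts. *)
  rewrite /charge_cintegral; cbv zeta; set h := svalP (cid (svalP (cid (Hahn_decomposition nu)))).
  have := fresnel_class_lin (-1) (fresnel_class_fourier hbar_gt0 (jordan_neg h) mw)
    (fresnel_class_fourier hbar_gt0 (jordan_pos h) mw).
  by apply: fresnel_class_ext => [x|]; rewrite mulN1r addrC.
have := fresnel_class_lin (0 +i* 1) (charge (cmeas_Im mu)) (charge (cmeas_Re mu)).
by apply: fresnel_class_ext => [x|]; rewrite addrC.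
Qed.

End cmeasure_integrals.

Theorem mainTheorem8 (R : realType) (hbar : R)
    (hbar_gt0 : 0 < hbar) (hbar_le1 : hbar <= 1)
    (mu : complex_measure (ell2_borel R) R)
    (h : {x : nat -> R | x \notin ell2_seq R} -> R[i])
    (f : (nat -> R) -> R[i])
    (f_ell2 : forall x : ell2 R, f (sval x) =
      cmeasure_integral mu (fun y : ell2_borel R => expi (ell2_dot x y)))
    (f_notell2 : forall x : {x : nat -> R | x \notin ell2_seq R},
      f (sval x) = h x) :
  DL' hbar f /\
  L' hbar f = cmeasure_integral mu
    (fun x : ell2_borel R => expi (- (hbar / 2 * ell2_dot x x))).
Proof.
have cls n : fresnel_class hbar (@cylinder R f n) (cmeasure_integral mu
    (fun y : ell2_borel R => expi (- (hbar / 2 * \sum_(i < n) sval y i ^+ 2)))).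
  have := fresnel_class_cmeasure hbar_gt0 (fun i : 'I_n => @measurable_ell2_coord R i) mu.
  have -> : @cylinder R f n = fun x => cmeasure_integral mu
      (fun y : ell2_borel R => wave (fun i : 'I_n => sval y i) x).
    (* A sequence extended by zeros lies in ell2, and its pairing with y is a finite sum over the
       first n coordinates of y: a plane wave in x. *)
    apply/funext => x; rewrite /cylinder (f_ell2 (exist _ (extend0 x) (extend0_ell2 x))).
    by congr cmeasure_integral; apply/funext => y; rewrite ell2_dot_extend0.
  exact.
(* The n-th Fresnel integral involves the n-th partial sum of |y|^2, which converges for each y in
   ell2, while the integrands keep modulus 1. *)
have lim : fresnel hbar (@cylinder R f n) @[n --> \oo] --> cmeasure_integral mu
    (fun x : ell2_borel R => expi (- (hbar / 2 * ell2_dot x x))).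
  rewrite (_ : (fun n => _) = fun n => cmeasure_integral mu
    (fun y : ell2_borel R => expi (- (hbar / 2 * \sum_(i < n) sval y i ^+ 2)))); last first.
    by apply/funext => n; exact: fresnel_class_fresnel (cls n).
  apply: cvg_cmeasure_integral.
  - move=> n; apply: cmeasurable_expi; apply: measurableT_comp => //.
    apply: measurable_funM => //; apply: measurable_sum => i.
    by apply: measurable_funX; exact: measurable_ell2_coord.
  - by move=> n y; rewrite cabs_expi.
  - move=> y.
    have lim : - (hbar / 2 * \sum_(i < n) sval y i ^+ 2) @[n --> \oo] --> - (hbar / 2 * ell2_dot y y).
      by apply: cvgN; apply: cvgMr; exact: cvg_ell2_dot.
    by apply/cvg_ReImP; split; [apply: continuous_cvg lim; exact: continuous_cos|
      apply: continuous_cvg lim; exact: continuous_sin].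
split; first split.
- by move=> n _; exact: fresnel_class_modulation (cls n).
- exact: cvgP lim.
- apply: cvg_lim lim; exact: norm_hausdorff.
Qed.
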